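(* Let $\mathcal G$ be a simple finite dimensional complex Lie algebra of type $A$, $D$ or $E$, with the invariant form normalized so that $\langle\alpha,\alpha\rangle=2$ for all roots $\alpha$; take $m=1$ and $\theta=\mathrm{id}$. Then there exists a module $W$ over the toroidal $Z_1$-algebra (that is, $k=1$), with $k_0$ acting as $1$, on which the centre acts faithfully, i.e. the linear map $\Omega_A/d_A\to\mathrm{End}(W)$ sending $t^{n}t^{\underline r}k_i$ to the coefficient of $\zeta^n$ in $k_i(\underline r,\zeta)$ is injective. Consequently the space $M(1)\otimes W$, on which $x_\alpha(\underline r,\zeta)$ acts as $E^-(-\alpha,\zeta)E^+(-\alpha,\zeta)\otimes Z(\alpha,\underline r,\zeta)$ for $\alpha\in\Phi$, $\beta(\underline r,\zeta)$ acts as $\beta(\zeta)k_0(\underline r,\zeta)$ for $\beta\in\underline h$, the central elements act through $W$, $d_0$ acts as $d_0\otimes1+1\otimes d_0$ and $d_i$ acts as $1\otimes d_i$ for $1\le i\le N$, is a faithful module for the toroidal Lie algebra $\tilde\tau=\tilde L(\mathcal G,\mathrm{id})$.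
   Context: Setting. $N\ge0$; $A=\mathbb C[t^{\pm1},t_1^{\pm1},\dots,t_N^{\pm1}]$; $t^{\underline r}=t_1^{r_1}\cdots t_N^{r_N}$ for $\underline r\in\mathbb Z^N$. $\Omega_A$ is the free $A$-module with basis $k_0,\dots,k_N$; $d_A$ is the linear span of the elements $r_0t^{r_0}t^{\underline r}k_0+\sum_{i=1}^Nr_it^{r_0}t^{\underline r}k_i$. With $x(r_0,\underline r)=x\otimes t^{r_0}t^{\underline r}$, $\tau=\mathcal G\otimes A\oplus\Omega_A/d_A$ has $\Omega_A/d_A$ central and $$[x(r_0,\underline r),y(s_0,\underline s)]=[x,y](r_0+s_0,\underline r+\underline s)+\langle x,y\rangle r_0t^{r_0+s_0}t^{\underline r+\underline s}k_0+\langle x,y\rangle\sum_{i=1}^Nr_it^{r_0+s_0}t^{\underline r+\underline s}k_i.$$ $\tilde\tau=\tau\oplus D$ with $D=\mathrm{span}\{d_0,\dots,d_N\}$, $[d_i,x(r_0,\underline r)]=r_ix(r_0,\underline r)$, $[d_i,t^{r_0}t^{\underline r}k_j]=r_it^{r_0}t^{\underline r}k_j$, $[d_i,d_j]=0$. $\underline h$ is a Cartan subalgebra of $\mathcal G$, identified with $\underline h^*$ via $\langle\,,\rangle$; $\Phi$ the root system; $x_\beta$ nonzero root vectors with $[x_\beta,x_{-\beta}]=\langle x_\beta,x_{-\beta}\rangle\beta$; $\epsilon(\beta,\gamma)$ is defined by $[x_\beta,x_\gamma]=\epsilon(\beta,\gamma)x_{\beta+\gamma}$ when $\beta+\gamma\in\Phi$.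 Series: $\delta(\zeta)=\sum_{i\in\mathbb Z}\zeta^i$; $D\sum b_i\zeta^i=\sum ib_i\zeta^i$; $D\delta(\zeta_1/\zeta_2)=(D\delta)(\zeta_1/\zeta_2)$; $x(\underline r,\zeta)=\sum_{i\in\mathbb Z}x\otimes t^it^{\underline r}\zeta^i$; $k_i(\underline r,\zeta)=\sum_{p\in\mathbb Z}t^pt^{\underline r}k_i\zeta^p$. Powers of $1-\zeta_1/\zeta_2$ are expanded in nonnegative powers of $\zeta_1/\zeta_2$ (similarly with $\zeta_2/\zeta_1$). Toroidal $Z_1$-algebra for $m=1$, $\theta=\mathrm{id}$, $k=1$: generated by the components of series $Z(\alpha,\underline r,\zeta)$, $k_i(\underline r,\zeta)$ ($\alpha\in\Phi$, $\underline r\in\mathbb Z^N$, $0\le i\le N$), by $\underline h$ and $d_0,\dots,d_N$, with relations: (1) $Z(\alpha,\underline r,\zeta)k_0(\underline s,\zeta)=Z(\alpha,\underline r+\underline s,\zeta)$; (2) $k_0(\underline r,\zeta)k_i(\underline s,\zeta)=k_i(\underline r+\underline s,\zeta)$; (3) $\sum_{i=1}^Nr_ik_i(\underline r,\zeta)+Dk_0(\underline r,\zeta)=0$; (4) $[d_0,Z(\beta,\underline r,\zeta)]=DZ(\beta,\underline r,\zeta)$; (5) $[d_0,k_i(\underline r,\zeta)]=Dk_i(\underline r,\zeta)$; (6) $[d_i,k_j(\underline r,\zeta)]=r_ik_j(\underline r,\zeta)$ for $1\le i\le N$; (7) the expression $$(1-\zeta_1/\zeta_2)^{\langle\beta_1,\beta_2\rangle}Z(\beta_1,\underline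 r,\zeta_1)Z(\beta_2,\underline s,\zeta_2)-(1-\zeta_2/\zeta_1)^{\langle\beta_1,\beta_2\rangle}Z(\beta_2,\underline s,\zeta_2)Z(\beta_1,\underline r,\zeta_1)$$ equals $\epsilon(\beta_1,\beta_2)Z(\beta_1+\beta_2,\underline r+\underline s,\zeta_2)\delta(\zeta_1/\zeta_2)$ if $\beta_1+\beta_2\in\Phi$; equals $$\langle x_{\beta_2},x_{-\beta_2}\rangle\Big(-\beta_2k_0(\underline r+\underline s,\zeta_2)\delta(\zeta_1/\zeta_2)+\sum_{i=1}^Nr_ik_i(\underline r+\underline s,\zeta_2)\delta(\zeta_1/\zeta_2)+k_0(\underline r+\underline s,\zeta_2)D\delta(\zeta_1/\zeta_2)\Big)$$ if $\beta_1+\beta_2=0$; and is $0$ if $\beta_1+\beta_2\notin\Phi\cup\{0\}$; (8) $[a,Z(\beta,\underline r,\zeta)]=\langle a,\beta\rangle Z(\beta,\underline r,\zeta)$ for $a\in\underline h$; (9) the components of the $k_i(\underline r,\zeta)$ commute with those of all $Z(\alpha,\underline s,\zeta)$ and of all $k_j(\underline s,\zeta)$, and with $\underline h$; (10) $[d_i,Z(\beta,\underline r,\zeta)]=r_iZ(\beta,\underline r,\zeta)$ for $1\le i\le N$, and the elements of $\underline h$ and $d_0,\dots,d_N$ commute with one another. In a module it is understood that each of the series applied to any given vector involves only finitely many positive powers of $\zeta$, so that the products are defined. $k_0$ denotes the $\zeta^0$-component of $k_0(\underline 0,\zeta)$. $M(1)$ is the level one Verma (Fock) module of the Lie algebra $\bigoplus_{i\in\mathbb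 Z}\underline h\otimes t^i\oplus\mathbb Ck_0\oplus\mathbb Cd_0$ with $[h\otimes t^i,h'\otimes t^j]=i\langle h,h'\rangle\delta_{i+j,0}k_0$, $[d_0,h\otimes t^i]=ih\otimes t^i$: it is generated by a vacuum vector killed by $h\otimes t^i$ ($i\ge0$) and by $d_0$, with $k_0$ acting as $1$. On $M(1)$, $E^\pm(\beta,\zeta)=\exp\big(\pm\sum_{j>0}\beta\otimes t^{\pm j}\zeta^{\pm j}/j\big)$. On $M(1)\otimes W$, $\beta(\zeta)=\sum_{i\in\mathbb Z}\beta\otimes t^i\zeta^i$ where $\beta\otimes t^i$ ($i\ne0$) acts on $M(1)$ and $\beta\otimes t^0=\beta\in\underline h$ acts on $W$. *)

(* Defs.v *)
From HB Require Import structures.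
From mathcomp Require Import all_boot all_order all_algebra.
From mathcomp Require Import generic_quotient ring_quotient complex.
From mathcomp Require Import boolp classical_sets functions cardinality fsbigop.
From mathcomp Require Import reals.

Set Implicit Arguments.
Unset Strict Implicit.
Unset Printing Implicit Defensive.

Import Order.TTheory GRing.Theory Num.Theory.
Local Open Scope classical_set_scope.
Local Open Scope quotient_scope.
Local Open Scope ring_scope.

Section FiniteSupport.
Variables (K : fieldType) (I : choiceType) (V : lmodType K).

Definition fin_supported : {pred I -> V} :=
  fun f => `[< finite_set [set i | f i != 0] >].

Lemma fin_supported_submod : submod_closed fin_supported.
Proof.
split.
  apply/asboolP; apply: (sub_finite_set _ (finite_set0 I)) => i /=.
  by rewrite eqxx.
move=> c f g /asboolP ff /asboolP fg; apply/asboolP.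
have fU : finite_set ([set i | f i != 0] `|` [set i | g i != 0]).
  by rewrite finite_setU.
apply: (sub_finite_set _ fU) => i /= cfg; case: (eqVneq (f i) 0) => [fi|]; last by left.
by right; apply: contra_neq cfg => gi; rewrite /GRing.add /GRing.scale /= fi gi scaler0 addr0.
Qed.

HB.instance Definition _ :=
  GRing.isSubmodClosed.Build K (I -> V) fin_supported fin_supported_submod.

(* The direct sum of copies of V indexed by I, e.g. V [t^r | r : I]. *)
Record finsupp : Type := FinSupp
  { finsupp_fun :> I -> V; _ : finsupp_fun \in fin_supported }.

HB.instance Definition _ := [isSub for finsupp_fun].
HB.instance Definition _ := [Choice of finsupp by <:].
HB.instance Definition _ := [SubChoice_isSubLmodule of finsupp by <:].

Lemma fsingle_subproof (i : I) (v : V) :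
  (fun j => if j == i then v else 0) \in fin_supported.
Proof.
apply/asboolP; apply: (sub_finite_set _ (finite_set1 i)) => j /=.
by case: (j =P i) => // _; rewrite eqxx.
Qed.

Definition fsingle i v : finsupp := FinSupp (fsingle_subproof i v).

Lemma fweight_subproof (c : I -> K) (f : finsupp) :
  (fun i => c i *: f i) \in fin_supported.
Proof.
case: f => f /= /asboolP ff; apply/asboolP; apply: (sub_finite_set _ ff) => i /=.
by apply: contra_neq => ->; rewrite scaler0.
Qed.

Definition fweight c f : finsupp := FinSupp (fweight_subproof c f).

Lemma fsingle0 i : fsingle i 0 = 0.
Proof. by apply: val_inj; apply/funext => j /=; case: ifP. Qed.

End FiniteSupport.
Arguments finsupp {K} I V.

Lemma fsbig_single (I : choiceType) (V : zmodType) (i : I) (F : I -> V) :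
  (forall j, j != i -> F j = 0) -> \sum_(j \in [set: I]) F j = F i.
Proof.
move=> F0; rewrite -[RHS](@fsbig_set1 V 0 +%R I i F) [RHS](@fsbig_widen I V 0 +%R _ [set: I])//.
by move=> j [_ /= /eqP ji]; rewrite F0.
Qed.

Section Quotient.
Variables (K : fieldType) (V : lmodType K) (S : set V).

Definition lspan : {pred V} := fun v =>
  `[< exists (n : nat) (c : 'I_n -> K) (u : 'I_n -> V),
        (forall i, S (u i)) /\ v = \sum_i c i *: u i >].

Lemma lspan_submod : submod_closed lspan.
Proof.
split.
  apply/asboolP; exists 0%N, (fun=> 0), (fun=> 0).
  by split=> [[]//|]; rewrite big_ord0.
move=> a _ _ /asboolP[n [c [u [Su ->]]]] /asboolP[m [d [w [Sw ->]]]].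
apply/asboolP; exists (n + m)%N,
  (fun i => match fintype.split i with inl j => a * c j | inr j => d j end),
  (fun i => match fintype.split i with inl j => u j | inr j => w j end).
split=> [i|]; first by case: fintype.split.
rewrite big_split_ord /= scaler_sumr; congr (_ + _); apply: eq_bigr => i _.
  by rewrite (unsplitK (inl i)) scalerA.
by rewrite (unsplitK (inr i)).
Qed.

HB.instance Definition _ :=
  GRing.isSubmodClosed.Build K V lspan lspan_submod.

Definition lquot : Type := {ideal_quot lspan}.
HB.instance Definition _ := GRing.Zmodule.on lquot.

Definition lclass (v : V) : lquot := \pi_({ideal_quot lspan})%qT v.
Definition lrepr (x : lquot) : V :=
  @generic_quotient.repr V {ideal_quot lspan} x.

Lemma lreprK : cancel lrepr lclass.
Proof. exact: reprK. Qed.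

Lemma lclassE u v : (lclass u == lclass v) = (u - v \in lspan).
Proof. by rewrite /lclass Quotient.idealrBE. Qed.

Lemma lclassD : {morph lclass : u v / u + v}.
Proof. by move=> u v; rewrite /lclass piE. Qed.

Definition lquot_scale (c : K) (x : lquot) : lquot := lclass (c *: lrepr x).

Lemma lclassZ c v : lclass (c *: v) = lquot_scale c (lclass v).
Proof.
apply/eqP; rewrite lclassE -scalerBr rpredZ // -lclassE.
by rewrite lreprK.
Qed.

Let lquot_scaleA c d x : lquot_scale c (lquot_scale d x) = lquot_scale (c * d) x.
Proof. by rewrite -[x]lreprK -!lclassZ scalerA. Qed.
Let lquot_scale1 : left_id 1 lquot_scale.
Proof. by move=> x; rewrite -[x]lreprK -lclassZ scale1r. Qed.
Let lquot_scaleDr : right_distributive lquot_scale +%R.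
Proof.
by move=> c x y; rewrite -[x]lreprK -[y]lreprK -lclassD -!lclassZ scalerDr lclassD.
Qed.
Let lquot_scaleDl x : {morph lquot_scale^~ x : c d / c + d}.
Proof. by move=> c d; rewrite -[x]lreprK -!lclassZ scalerDl lclassD. Qed.

HB.instance Definition _ := GRing.Zmodule_isLmodule.Build K lquot
  lquot_scaleA lquot_scale1 lquot_scaleDr lquot_scaleDl.

Lemma lclass_linear : linear lclass.
Proof. by move=> c u v; rewrite lclassD lclassZ. Qed.

HB.instance Definition _ :=
  GRing.isLinear.Build K V lquot *:%R lclass lclass_linear.

End Quotient.

Section Tensor.
Variables (K : fieldType) (M W : lmodType K).

Local Notation freeMW := (finsupp (M * W)%type K^o).
Local Notation gen m w := (fsingle (m, w) (1 : K^o) : freeMW).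

Definition tensor_relations : set freeMW :=
  [set f | (exists c m m' w, f = gen (c *: m + m') w - (c *: gen m w + gen m' w)) \/
           (exists c m w w', f = gen m (c *: w + w') - (c *: gen m w + gen m w'))].

Definition tensor : Type := lquot tensor_relations.
HB.instance Definition _ := GRing.Lmodule.on tensor.

Definition tens (m : M) (w : W) : tensor := lclass tensor_relations (gen m w).

End Tensor.

Section LieAlgebra.
Variables (R : realType).
Local Notation C := R[i].
Variables (G : vectType C) (br : {bilinear G -> G -> G}) (form : {biscalar G}).

Definition lie_bracket : Prop :=
  (forall x, br x x = 0) /\
  (forall x y z, br x (br y z) + br y (br z x) + br z (br x y) = 0).

Definition lie_ideal (J : {vspace G}) : Prop :=
  forall x y, y \in J -> br x y \in J.

Definition simple_lie_algebra : Prop :=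
  [/\ lie_bracket, exists x y, br x y != 0 &
      forall J : {vspace G}, lie_ideal J -> J = 0%VS \/ J = fullv].

Definition invariant_form : Prop :=
  [/\ forall x y, form x y = form y x,
      forall x y z, form (br x y) z = form x (br y z) &
      forall x, (forall y, form x y = 0) -> x = 0].

(* For a complex semisimple Lie algebra: a maximal abelian subalgebra all of
   whose elements are ad-diagonalizable. *)
Definition cartan_subalgebra (h : {vspace G}) : Prop :=
  [/\ forall a b, a \in h -> b \in h -> br a b = 0,
      forall x, (forall a, a \in h -> br a x = 0) -> x \in h &
      forall a, a \in h -> exists2 X : seq G, basis_of fullv X &
        forall v, v \in X -> exists c : C, br a v = c *: v].

Variable h : {vspace G}.
Local Notation H := (subvs_of h).

Definition hform (a b : H) : C := form (vsval a) (vsval b).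

(* A root is an element beta of h, standing for the functional <-, beta>. *)
Definition root_vector (beta : H) (y : G) : Prop :=
  y != 0 /\ forall a : H, br (vsval a) y = hform a beta *: y.

Definition is_root (beta : H) : Prop :=
  beta != 0 /\ exists y, root_vector beta y.

Definition root_vector_choice (x : H -> G) : Prop :=
  forall beta, is_root beta ->
    root_vector beta (x beta) /\
    br (x beta) (x (- beta)) = form (x beta) (x (- beta)) *: vsval beta.

Definition structure_constants (x : H -> G) (eps : H -> H -> C) : Prop :=
  forall beta gamma, is_root beta -> is_root gamma -> is_root (beta + gamma) ->
    br (x beta) (x gamma) = eps beta gamma *: x (beta + gamma).

(* Dynkin diagrams on the nodes 0, ..., l-1: the chain of length l, and the
   chain 0, ..., l-2 with the node l-1 attached to the node p. *)
Definition chain_diagram (i j : nat) : bool := (j == i.+1) || (i == j.+1).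

Definition branched_diagram (l p i j : nat) : bool :=
  if (i == l.-1) || (j == l.-1) then
    ((i == l.-1) && (j == p)) || ((j == l.-1) && (i == p))
  else chain_diagram i j.

Variant ade_diagram (l : nat) : rel nat -> Prop :=
| TypeA of (1 <= l)%N : ade_diagram l chain_diagram
| TypeD of (4 <= l)%N : ade_diagram l (branched_diagram l (l - 3))
| TypeE of (6 <= l <= 8)%N : ade_diagram l (branched_diagram l 2).

Definition is_root_base (l : nat) (b : l.-tuple H) : Prop :=
  [/\ forall i : 'I_l, is_root (tnth b i), basis_of fullv b &
      forall beta, is_root beta -> exists n : 'I_l -> nat,
        beta = \sum_i (n i)%:R *: tnth b i \/
        beta = - \sum_i (n i)%:R *: tnth b i].

Definition type_ADE : Prop :=
  exists (l : nat) (e : rel nat) (b : l.-tuple H),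
    [/\ ade_diagram l e, is_root_base b &
        forall i j : 'I_l,
          2 * hform (tnth b i) (tnth b j) / hform (tnth b j) (tnth b j) =
          if i == j then 2 else if e i j then -1 else 0].

End LieAlgebra.

Section Toroidal.
Variables (R : realType) (N : nat).
Local Notation C := R[i].
Variables (G : vectType C) (br : {bilinear G -> G -> G}) (form : {biscalar G}).

(* Exponents (r_0, r) of the monomials t^{r_0} t^r. *)
Definition expo : Type := (int * 'rV[int]_N)%type.

Definition coord_expo (p : expo) (i : 'I_N.+1) : int :=
  if unlift ord0 i is Some j then p.2 0 j else p.1.

Definition Omega_A : lmodType C := finsupp (expo * 'I_N.+1)%type C^o.
Definition omega_k (p : expo) (i : 'I_N.+1) : Omega_A := fsingle (p, i) (1 : C^o).

Definition d_A : set Omega_A :=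
  [set \sum_i (coord_expo p i)%:~R *: omega_k p i | p in [set: expo]].

Definition center : lmodType C := lquot d_A.
Definition tk (p : expo) (i : 'I_N.+1) : center := lclass d_A (omega_k p i).

Definition loop : lmodType C := finsupp expo G.

Definition toroidal : lmodType C := (loop * center * 'rV[C]_N.+1)%type.

Definition tor_g (x : G) (p : expo) : toroidal := (fsingle p x, 0, 0).
Definition tor_k (p : expo) (i : 'I_N.+1) : toroidal := (0, tk p i, 0).
Definition tor_d (i : 'I_N.+1) : toroidal := (0, 0, delta_mx 0 i).

Definition weight (c : 'rV[C]_N.+1) (p : expo) : C :=
  \sum_i c 0 i * (coord_expo p i)%:~R.

Definition der_loop (c : 'rV[C]_N.+1) (f : loop) : loop := fweight (weight c) f.
Definition der_center (c : 'rV[C]_N.+1) (z : center) : center :=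
  lclass d_A (fweight (fun q => weight c q.1) (lrepr z)).

(* d_A is stable under the derivations, so that der_center is induced by them. *)
Lemma der_center_class (c : 'rV[C]_N.+1) (w : Omega_A) :
  der_center c (lclass d_A w) = lclass d_A (fweight (fun q => weight c q.1) w).
Proof.
apply/eqP; rewrite lclassE.
pose fw (u : Omega_A) := fweight (fun q => weight c q.1) u : Omega_A.
have fwB u v : fw u - fw v = fw (u - v).
  by apply: val_inj; apply/funext => j /=; rewrite /GRing.add /GRing.opp /= scalerBr.
rewrite -/(fw _) -/(fw w) fwB.
have : lrepr (lclass d_A w) - w \in lspan d_A by rewrite -lclassE lreprK.
move=> /asboolP[n [a [u [Su ->]]]]; apply/asboolP.
have /choice[p pE] i : exists p, u i = \sum_j (coord_expo p j)%:~R *: omega_k p j.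
  by have [p _ <-] := Su i; exists p.
exists n, (fun i => a i * weight c (p i)), u; split=> //.
apply: val_inj; apply/funext => q /=.
have vs m (f : 'I_m -> Omega_A) : (\sum_i f i) q = \sum_i f i q.
  exact: (big_morph (fun g : Omega_A => (g : _ -> C^o) q) (id1:=0) (op1:=+%R)).
have vz d (f : Omega_A) : (d *: f) q = d *: f q by [].
rewrite !vs scaler_sumr; apply: eq_bigr => i _; rewrite !vz !scalerA.
rewrite [X in X *: _]mulrC -!scalerA; congr (_ *: _).
rewrite pE !vs !scaler_sumr; apply: eq_bigr => j _; rewrite !vz /=.
by case: eqP => [->//|_]; rewrite !scaler0.
Qed.

Definition loop_br (f g : loop) : loop :=
  \sum_(p \in [set: expo]) \sum_(q \in [set: expo])
    fsingle (p + q) (br (f p) (g q)).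

Definition loop_cocycle (f g : loop) : center :=
  \sum_(p \in [set: expo]) \sum_(q \in [set: expo])
    form (f p) (g q) *: \sum_i (coord_expo p i)%:~R *: tk (p + q) i.

Lemma loop_br_single x y (p q : expo) :
  loop_br (fsingle p x) (fsingle q y) = fsingle (p + q) (br x y).
Proof.
rewrite /loop_br (fsbig_single (i := p)) ?(fsbig_single (i := q)) /= ?eqxx//.
- by move=> j /negPf ->; rewrite linear0r fsingle0.
- move=> j /negPf jp; rewrite (fsbig_single (i:=q)) /= jp => *; by rewrite linear0l fsingle0.
Qed.

Lemma loop_cocycle_single x y (p q : expo) :
  loop_cocycle (fsingle p x) (fsingle q y) =
  form x y *: \sum_i (coord_expo p i)%:~R *: tk (p + q) i.
Proof.
rewrite /loop_cocycle (fsbig_single (i := p)) ?(fsbig_single (i := q)) /= ?eqxx//.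
- by move=> j /negPf ->; rewrite linear0r scale0r.
- move=> j /negPf jp; rewrite (fsbig_single (i:=q)) /= jp => *; by rewrite linear0l scale0r.
Qed.

Definition tor_br (u v : toroidal) : toroidal :=
  let: (f, z, c) := u in let: (g, w, d) := v in
  (loop_br f g + der_loop c g - der_loop d f,
   loop_cocycle f g + der_center c w - der_center d z, 0).

End Toroidal.

(* A formal series sum_n A_n zeta^n of operators on W is represented by its
   coefficients n |-> A_n.  All the finitely supported sums taken below are
   genuinely finite, because the series are restricted (and, in series_mul,
   because its two factors commute). *)
Section Series.
Variables (K : fieldType) (W : lmodType K).
Implicit Types A B : int -> W -> W.

Definition restricted A : Prop :=
  forall w, exists n0 : int, forall n, n0 < n -> A n w = 0.

(* Coefficient of zeta^n in A(zeta) B(zeta). *)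
Definition series_mul A B (n : int) (w : W) : W :=
  \sum_(j \in [set: int]) A (n - j) (B j w).

Definition gbinomial (c : K) (p : nat) : K :=
  (\prod_(i < p) (c - i%:R)) / p`!%:R.

(* Coefficient of zeta1^a zeta2^b in
   (1 - zeta1 / zeta2)^c A(zeta1) B(zeta2). *)
Definition twisted_mul (c : K) A B (a b : int) (w : W) : W :=
  \sum_(p \in [set: nat])
    ((-1) ^+ p * gbinomial c p) *: A (a - p%:Z) (B (b + p%:Z) w).

(* Coefficients of zeta1^a zeta2^b in A(zeta2) delta(zeta1 / zeta2) and in
   A(zeta2) (D delta)(zeta1 / zeta2). *)
Definition mul_delta A (a b : int) (w : W) : W := A (a + b) w.
Definition mul_Ddelta A (a b : int) (w : W) : W := a%:~R *: A (a + b) w.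

(* Coefficient of x^n in exp (sum_(j > 0) S_j x^j). *)
Fixpoint series_pow (S : nat -> W -> W) (p n : nat) (w : W) : W :=
  if p is p'.+1 then \sum_(1 <= j < n.+1) S j (series_pow S p' (n - j) w)
  else if n == 0%N then w else 0.

Definition series_exp (S : nat -> W -> W) (n : nat) (w : W) : W :=
  \sum_(p < n.+1) (p`!%:R)^-1 *: series_pow S p n w.

End Series.

Section Modules.
Variables (R : realType) (N : nat).
Local Notation C := R[i].
Variables (G : vectType C) (br : {bilinear G -> G -> G}) (form : {biscalar G}).
Variables (h : {vspace G}) (x : subvs_of h -> G).
Variable eps : subvs_of h -> subvs_of h -> C.
Local Notation H := (subvs_of h).
Local Notation "<< a , b >>" := (hform form a b).
Local Notation root := (is_root br form).
Local Notation Zr := 'rV[int]_N.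

(* Zop b r n and kop i r n are the coefficients of zeta^n in Z(b, r, zeta) and
   k_i(r, zeta). *)
Record Z1_ops (W : lmodType C) : Type := {
  Zop : H -> Zr -> int -> {linear W -> W};
  kop : 'I_N.+1 -> Zr -> int -> {linear W -> W};
  hop : H -> {linear W -> W};
  dop : 'I_N.+1 -> {linear W -> W} }.

Section Relations.
Variables (W : lmodType C) (A : Z1_ops W).
Local Notation Z := (Zop A).
Local Notation k := (kop A).
Local Notation d := (dop A).

Definition comm_ops (f g : W -> W) (w : W) : W := f (g w) - g (f w).

(* Coefficient of zeta1^m zeta2^n. *)
Definition Z_commutator (b1 b2 : H) (r s : Zr) (m n : int) (w : W) : W :=
  twisted_mul <<b1, b2>> (Z b1 r) (Z b2 s) m n w -
  twisted_mul <<b1, b2>> (Z b2 s) (Z b1 r) n m w.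

Record Z1_module : Prop := {
  Z1_restrictedZ : forall (b : H) (r : Zr), root b -> restricted (Z b r);
  Z1_restrictedk : forall (i : 'I_N.+1) (r : Zr), restricted (k i r);
  Z1_hop_linear : forall (c : C) (a b : H) (w : W),
    hop A (c *: a + b) w = c *: hop A a w + hop A b w;
  Z1_Zk0 : forall (b : H) (r s : Zr) (n : int) (w : W),
    root b -> series_mul (Z b r) (k ord0 s) n w = Z b (r + s) n w;
  Z1_k0k : forall (i : 'I_N.+1) (r s : Zr) (n : int) (w : W),
    series_mul (k ord0 r) (k i s) n w = k i (r + s) n w;
  Z1_Dk : forall (r : Zr) (n : int) (w : W),
    \sum_(i < N) (r 0 i)%:~R *: k (lift ord0 i) r n w + n%:~R *: k ord0 r n w = 0;
  Z1_d0Z : forall (b : H) (r : Zr) (n : int) (w : W),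
    root b -> comm_ops (d ord0) (Z b r n) w = n%:~R *: Z b r n w;
  Z1_d0k : forall (i : 'I_N.+1) (r : Zr) (n : int) (w : W),
    comm_ops (d ord0) (k i r n) w = n%:~R *: k i r n w;
  Z1_dk : forall (i : 'I_N) (j : 'I_N.+1) (r : Zr) (n : int) (w : W),
    comm_ops (d (lift ord0 i)) (k j r n) w = (r 0 i)%:~R *: k j r n w;
  Z1_ZZ_root : forall (b1 b2 : H) (r s : Zr) (m n : int) (w : W),
    root b1 -> root b2 -> root (b1 + b2) ->
    Z_commutator b1 b2 r s m n w =
    eps b1 b2 *: mul_delta (Z (b1 + b2) (r + s)) m n w;
  Z1_ZZ_opp : forall (b1 b2 : H) (r s : Zr) (m n : int) (w : W),
    root b1 -> root b2 -> b1 + b2 = 0 ->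
    Z_commutator b1 b2 r s m n w =
    form (x b2) (x (- b2)) *:
      (- hop A b2 (mul_delta (k ord0 (r + s)) m n w)
       + \sum_(i < N) (r 0 i)%:~R *: mul_delta (k (lift ord0 i) (r + s)) m n w
       + mul_Ddelta (k ord0 (r + s)) m n w);
  Z1_ZZ_other : forall (b1 b2 : H) (r s : Zr) (m n : int) (w : W),
    root b1 -> root b2 ->
    ~ root (b1 + b2) -> b1 + b2 <> 0 -> Z_commutator b1 b2 r s m n w = 0;
  Z1_hZ : forall (a b : H) (r : Zr) (n : int) (w : W),
    root b -> comm_ops (hop A a) (Z b r n) w = <<a, b>> *: Z b r n w;
  Z1_kZ : forall (i : 'I_N.+1) (b : H) (r s : Zr) (m n : int) (w : W),
    root b -> comm_ops (k i r m) (Z b s n) w = 0;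
  Z1_kk : forall (i j : 'I_N.+1) (r s : Zr) (m n : int) (w : W),
    comm_ops (k i r m) (k j s n) w = 0;
  Z1_kh : forall (i : 'I_N.+1) (r : Zr) (n : int) (a : H) (w : W),
    comm_ops (k i r n) (hop A a) w = 0;
  Z1_dZ : forall (i : 'I_N) (b : H) (r : Zr) (n : int) (w : W),
    root b -> comm_ops (d (lift ord0 i)) (Z b r n) w = (r 0 i)%:~R *: Z b r n w;
  Z1_hh : forall (a b : H) (w : W), comm_ops (hop A a) (hop A b) w = 0;
  Z1_hd : forall (a : H) (i : 'I_N.+1) (w : W), comm_ops (hop A a) (d i) w = 0;
  Z1_dd : forall (i j : 'I_N.+1) (w : W), comm_ops (d i) (d j) w = 0 }.

Definition k0_acts_as_1 : Prop := forall w, k ord0 0 0 w = w.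

Definition center_acts_faithfully : Prop :=
  exists phi : center R N -> {linear W -> W},
    [/\ forall c u v w, phi (c *: u + v) w = c *: phi u w + phi v w,
        forall n r i, phi (tk R (n, r) i) =1 k i r n &
        forall u v, phi u =1 phi v -> u = v].

End Relations.

Record heisenberg_ops (M : lmodType C) : Type := {
  osc : H -> int -> {linear M -> M};
  deg : {linear M -> M};
  vac : M }.

(* These axioms, with k_0 = 1 substituted in the commutation relation,
   characterize the Fock module up to isomorphism: at level one the Verma module
   is irreducible. *)
Record level_one_fock (M : lmodType C) (F : heisenberg_ops M) : Prop := {
  osc_linear : forall c a b n v, osc F (c *: a + b) n v = c *: osc F a n v + osc F b n v;
  osc_comm : forall a b m n v,
    osc F a m (osc F b n v) - osc F b n (osc F a m v) =
    if m + n == 0 then (m%:~R * <<a, b>>) *: v else 0;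
  deg_osc : forall a n v,
    deg F (osc F a n v) - osc F a n (deg F v) = n%:~R *: osc F a n v;
  vac_neq0 : vac F != 0;
  osc_vac : forall a (n : int), 0 <= n -> osc F a n (vac F) = 0;
  deg_vac : deg F (vac F) = 0;
  vac_generates : forall P : M -> Prop,
    P (vac F) ->
    (forall c u v, P u -> P v -> P (c *: u + v)) ->
    (forall a n v, P v -> P (osc F a n v)) ->
    (forall v, P v -> P (deg F v)) ->
    forall v, P v }.

(* Coefficient of zeta^q in E^+(beta, zeta), and of zeta^(-p) in
   E^-(beta, zeta). *)
Definition Eplus (M : lmodType C) (F : heisenberg_ops M) (beta : H) (q : nat) :
    M -> M :=
  series_exp (fun j v => j%:R^-1 *: osc F beta j%:Z v) q.
Definition Eminus (M : lmodType C) (F : heisenberg_ops M) (beta : H) (p : nat) :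
    M -> M :=
  series_exp (fun j v => - (j%:R^-1 *: osc F beta (- j%:Z) v)) p.

Section Representation.
Variables (W M : lmodType C) (A : Z1_ops W) (F : heisenberg_ops M).
Variable rho : toroidal N G -> {linear tensor M W -> tensor M W}.

(* beta \otimes t(lift ord0 i) in beta(zeta), applied to m \otimes w. *)
Definition cartan_mode (beta : H) (i : int) (m : M) (w : W) : tensor M W :=
  if i == 0 then tens m (hop A beta w) else tens (osc F beta i m) w.

(* In act_root the coefficients of zeta^(-p) in E^-, of zeta^q in E^+ and of
   zeta^(n + p - q) in Z contribute to zeta^n. *)
Record vertex_action : Prop := {
  act_root : forall alpha r n m w, is_root br form alpha ->
    rho (tor_g (x alpha) (n, r)) (tens m w) =
    \sum_(pq \in [set: nat * nat])
      tens (Eminus F (- alpha) pq.1 (Eplus F (- alpha) pq.2 m))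
           (Zop A alpha r (n + pq.1%:Z - pq.2%:Z) w);
  act_cartan : forall beta r n m w,
    rho (tor_g (vsval beta) (n, r)) (tens m w) =
    \sum_(i \in [set: int]) cartan_mode beta i m (kop A ord0 r (n - i) w);
  act_center : forall i r n m w,
    rho (tor_k G (n, r) i) (tens m w) = tens m (kop A i r n w);
  act_d0 : forall m w,
    rho (tor_d G ord0) (tens m w) = tens (deg F m) w + tens m (dop A ord0 w);
  act_d : forall (i : 'I_N) m w,
    rho (tor_d G (lift ord0 i)) (tens m w) = tens m (dop A (lift ord0 i) w) }.

Definition lie_module : Prop :=
  (forall c u v z, rho (c *: u + v) z = c *: rho u z + rho v z) /\
  (forall u v z, rho (tor_br br form u v) z = rho u (rho v z) - rho v (rho u z)).

Definition faithful : Prop := forall u v, rho u =1 rho v -> u = v.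

End Representation.

End Modules.

(* Main.v *)
(* The module W lives on U[Q], with Q the root lattice and U a module on which only the central
   series act.  For a point m of Z^N the series k_0(r, zeta), k_j(r, zeta) specialize to zeta^(m.r)
   and - m_j zeta^(m.r); first-order deformations of these points over the dual numbers, together
   with a grading by Z^(N+1), make the resulting action of Omega_A / d_A faithful.  On e^g u the
   operator Z(alpha, r, n) is f(alpha, g) e^(g + alpha) k_0(r, n + <alpha, g> + 1) u, where f is a
   two-cocycle (-1)^B(alpha, g) rescaled by an explicit solution c of
   c_alpha c_beta (-1)^B(alpha, beta) = eps(alpha, beta) c_(alpha + beta), found by induction on heights.
   The Lie algebra relations on M(1) (x) W follow from
   E^+(alpha, z) E^-(beta, w) = (1 - z/w)^<alpha, beta> E^-(beta, w) E^+(alpha, z)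
   and the defining relations of the Z-algebra.  Faithfulness: the kernel is an ideal meeting the
   center trivially, and an ideal of the toroidal algebra containing a non-central element contains
   a nonzero central one, obtained by bracketing with root vectors. *)
Require Import Defs.
From HB Require Import structures.
From mathcomp Require Import all_boot all_order all_algebra.
From mathcomp Require Import generic_quotient ring_quotient complex.
From mathcomp Require Import boolp classical_sets functions cardinality fsbigop.
From mathcomp Require Import reals.
From mathcomp Require Import zify ring.

Set Implicit Arguments.
Unset Strict Implicit.
Unset Printing Implicit Defensive.

Import Order.TTheory GRing.Theory Num.Theory.
Local Open Scope classical_set_scope.
Local Open Scope ring_scope.

(** * Finitely supported sums *)

(** At an undeformed point only $\zeta^{m\cdot r}$ occurs in $k_i(r,\zeta)$, so the part of
    $\Omega_A/d_A$ of degree $(n,r)$ is invisible when $m\cdot r=n$ has no integer solution; for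
    instance $t^nk_j$ with $n\ne0$, $j\ge1$ is nonzero but would act as $0$. A point is a
    substitution $t_j\mapsto\phi_j=\zeta^{m_j}$, with $k_0(r)\mapsto\phi^r$ and
    $k_j(r)\mapsto-\phi^rD\phi_j/\phi_j$. Taking $\phi_j=\zeta^{m_j}(1+\varepsilon l_j\zeta^{-p})$,
    $\varepsilon^2=0$, reaches every degree. The root vectors come with an arbitrary scaling, so
    [eps] need not be a sign. Twisted by $(-1)^B$ it becomes a symmetric cocycle for the partial
    addition of roots, and $c$ exhibits it as a coboundary. Relation (7) reduces to scalars: on
    $U[Q]$ the commutator is governed by the difference of the two expansions of
    $(1-x)^{\langle\alpha,\beta\rangle}$. Between roots this exponent is $-2$ for opposite roots,
    $-1$ when the sum is a root and nonnegative otherwise, and the difference is of the type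
    $D\delta$, $\delta$ and $0$ respectively. *)

Section FSum.
Variable V : zmodType.

Definition fsupp (I : choiceType) (F : I -> V) := finite_set [set i | F i != 0].
(** Convertible with the sums used in the definitions, which take the value 0 on an infinite
    support. Additivity and exchange of sums therefore carry [fsupp] hypotheses, and much of the
    work on series consists in proving them. *)
Definition fsum (I : choiceType) (F : I -> V) := \sum_(i \in [set: I]) F i.

Lemma fsuppP (I : choiceType) (F : I -> V) :
  fsupp F <-> exists s : seq I, forall i, F i != 0 -> i \in s.
Proof.
split=> [/finite_seqP[s sE]|[s sE]].
  by exists s => i Fi; have : [set i | F i != 0] i by []; rewrite sE.
by apply: (sub_finite_set _ (finite_seq s)) => i /= /sE.
Qed.

Lemma fsumE (I : choiceType) (F : I -> V) (s : seq I) : uniq s ->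
  (forall i, F i != 0 -> i \in s) -> fsum F = \sum_(i <- s) F i.
Proof.
move=> us sE; rewrite /fsum [RHS]fsbig_seq//; apply/esym/fsbig_widen => //.
by move=> i [_ /= si]; apply/eqP; apply: contra_notT si => /sE.
Qed.

Lemma fsupp_seq (I : choiceType) (F : I -> V) : fsupp F ->
  exists2 s : seq I, uniq s & forall i, F i != 0 -> i \in s.
Proof.
move=> /fsuppP[s sE]; exists (undup s); first exact: undup_uniq.
by move=> i /sE; rewrite mem_undup.
Qed.

Lemma fsupp2_seq (I : choiceType) (F G : I -> V) : fsupp F -> fsupp G ->
  exists s : seq I, [/\ uniq s, (forall i, F i != 0 -> i \in s) &
                        (forall i, G i != 0 -> i \in s)].
Proof.
move=> /fsuppP[s sE] /fsuppP[t tE]; exists (undup (s ++ t)); split.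
- exact: undup_uniq.
- by move=> i /sE; rewrite mem_undup mem_cat => ->.
- by move=> i /tE; rewrite mem_undup mem_cat orbC => ->.
Qed.

Lemma eq_fsum (I : choiceType) (F G : I -> V) : F =1 G -> fsum F = fsum G.
Proof. by move=> FG; apply: eq_fsbigr => i _. Qed.

Lemma eq_fsupp (I : choiceType) (F G : I -> V) : F =1 G -> fsupp F -> fsupp G.
Proof. by move=> /funext->. Qed.

Lemma fsupp0 (I : choiceType) : fsupp (fun _ : I => 0 : V).
Proof. by apply/fsuppP; exists [::] => i; rewrite eqxx. Qed.

Lemma sub_fsupp (V' : zmodType) (I : choiceType) (F : I -> V) (G : I -> V') :
  (forall i, F i = 0 -> G i = 0) -> fsupp F -> finite_set [set i | G i != 0].
Proof.
move=> FG; apply: sub_finite_set => i /=; apply: contra_neq; exact: FG.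
Qed.

Lemma fsum0 (I : choiceType) (F : I -> V) : (forall i, F i = 0) -> fsum F = 0.
Proof. by move=> F0; apply: fsbig1 => i _. Qed.

Lemma fsum1 (I : choiceType) i0 (F : I -> V) :
  (forall i, i != i0 -> F i = 0) -> fsum F = F i0.
Proof. exact: fsbig_single. Qed.

Lemma fsupp_seqW (I : choiceType) (F : I -> V) (s : seq I) :
  (forall i, F i != 0 -> i \in s) -> fsupp F.
Proof. by move=> H; apply/fsuppP; exists s. Qed.

Lemma fsupp1 (I : choiceType) i0 (F : I -> V) :
  (forall i, i != i0 -> F i = 0) -> fsupp F.
Proof.
move=> F0; apply: (@fsupp_seqW _ _ [:: i0]) => i; rewrite inE.
by apply: contraNT => /F0 ->.
Qed.

Lemma fsuppD (I : choiceType) (F G : I -> V) :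
  fsupp F -> fsupp G -> fsupp (fun i => F i + G i).
Proof.
move=> fF fG; have [s [us sF sG]] := fsupp2_seq fF fG.
apply: (@fsupp_seqW _ _ s) => i; apply: contraNT => si.
have [->|/sF] := eqVneq (F i) 0; last by rewrite (negPf si).
by have [->|/sG] := eqVneq (G i) 0; rewrite ?addr0// (negPf si).
Qed.

Lemma fsumD (I : choiceType) (F G : I -> V) : fsupp F -> fsupp G ->
  fsum (fun i => F i + G i) = fsum F + fsum G.
Proof.
move=> fF fG; have [s [us sF sG]] := fsupp2_seq fF fG.
rewrite (fsumE us sF) (fsumE us sG) -big_split (fsumE us)// => i.
apply: contraNT => si.
have [->|/sF] := eqVneq (F i) 0; last by rewrite (negPf si).
by have [->|/sG] := eqVneq (G i) 0; rewrite ?addr0// (negPf si).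
Qed.

Lemma fsum_reindex (I J : choiceType) (h : I -> J) (F : J -> V) :
  injective h -> (forall j, F j != 0 -> exists i, j = h i) ->
  fsum F = fsum (F \o h).
Proof.
move=> hinj Fh; rewrite /fsum -[RHS](fsbig_image setT h F); last first.
  by move=> i j _ _ /hinj.
apply/esym/fsbig_widen => // j [_ /= hj]; apply/eqP.
by apply: contra_notT hj => /Fh[i ->]; exists i.
Qed.

Lemma fsum_bij (I J : choiceType) (h : I -> J) (g : J -> I) (F : J -> V) :
  cancel h g -> cancel g h -> fsum F = fsum (F \o h).
Proof. by move=> hg gh; apply: reindex_fsbigT; exists g. Qed.

Lemma fsupp_reindex (I J : choiceType) (h : I -> J) (F : J -> V) :
  injective h -> fsupp F -> fsupp (F \o h).
Proof.
move=> hinj fF; apply: (@finite_preimage _ _ [set j | F j != 0] h _ fF).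
by move=> x y _ _; apply: hinj.
Qed.

Lemma fsupp_bij (I J : choiceType) (h : I -> J) (g : J -> I) (F : J -> V) :
  cancel h g -> cancel g h -> fsupp (F \o h) -> fsupp F.
Proof.
move=> hg gh /(fsupp_reindex (can_inj gh)); apply: eq_fsupp => j /=.
by rewrite gh.
Qed.

(** Restricted series bound the indices of an iterated product one after the other, each bound
    depending on the indices already fixed; this lemma assembles such bounds. *)
Lemma fsupp_dep (I J : choiceType) (F : I * J -> V) (s : seq I) :
  (forall i j, F (i, j) != 0 -> i \in s) ->
  (forall i, fsupp (fun j => F (i, j))) -> fsupp F.
Proof.
move=> sF fF; have /choice[t tE] i : exists t : seq J, forall j, F (i, j) != 0 -> j \in t.
  by apply/fsuppP; apply: fF.
apply: (@fsupp_seqW _ _ (allpairs_dep pair s t)) => -[i j] Fij.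
by apply/allpairsPdep; exists i, j; split=> //; [apply: sF Fij|apply: tE].
Qed.

Lemma fsupp_fst (I J : choiceType) (F : I * J -> V) i :
  fsupp F -> fsupp (fun j => F (i, j)).
Proof. by apply: fsupp_reindex => j j' []. Qed.

Lemma fsum_pair (I J : choiceType) (F : I * J -> V) : fsupp F ->
  fsum F = fsum (fun i => fsum (fun j => F (i, j))).
Proof.
move=> /fsuppP[s sE].
pose s1 := undup (map fst s); pose s2 := undup (map snd s).
have us1 : uniq s1 by apply: undup_uniq.
have us2 : uniq s2 by apply: undup_uniq.
have m1 i j : F (i, j) != 0 -> i \in s1.
  by move=> /sE ijs; rewrite mem_undup; apply/mapP; exists (i, j).
have m2 i j : F (i, j) != 0 -> j \in s2.
  by move=> /sE ijs; rewrite mem_undup; apply/mapP; exists (i, j).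
rewrite (@fsumE _ _ [seq (i, j) | i <- s1, j <- s2]); last 2 first.
- by apply: allpairs_uniq => // -[a b] [c d] _ _.
- by move=> [i j] Fij; apply/allpairsP; exists (i, j); rewrite (m1 i j)// (m2 i j).
rewrite big_allpairs_dep (fsumE us1) => [|i].
  by apply: eq_bigr => i _; rewrite (fsumE us2) => // j; apply: m2.
apply: contraNT => i1; apply/eqP; apply: fsum0 => j; apply/eqP.
by apply: contraNT i1; apply: m1.
Qed.

Lemma fsupp_fsum (I J : choiceType) (F : I * J -> V) : fsupp F ->
  fsupp (fun i => fsum (fun j => F (i, j))).
Proof.
move=> /fsuppP[s sE]; apply: (@fsupp_seqW _ _ (map fst s)) => i.
apply: contraNT => i1; apply/eqP; apply: fsum0 => j; apply/eqP.
by apply: contraNT i1 => /sE ijs; apply/mapP; exists (i, j).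
Qed.

Lemma fsum_exchange (I J : choiceType) (F : I * J -> V) : fsupp F ->
  fsum (fun i => fsum (fun j => F (i, j))) = fsum (fun j => fsum (fun i => F (i, j))).
Proof.
move=> fF; rewrite -fsum_pair//.
pose sw (x : J * I) := (x.2, x.1); pose sw' (x : I * J) := (x.2, x.1).
rewrite (@fsum_bij _ _ sw sw'); [|by case|by case].
rewrite fsum_pair//; apply: (fsupp_reindex _ fF).
by move=> [a b] [c d] [-> ->].
Qed.

End FSum.

Lemma fsum_lin (V V' : zmodType) (I : choiceType) (L : V -> V') (F : I -> V) :
  L 0 = 0 -> {morph L : x y / x + y} -> fsupp F -> L (fsum F) = fsum (fun i => L (F i)).
Proof.
move=> L0 LD fF; have [s us sF] := fsupp_seq fF.
rewrite (fsumE us sF) (big_morph _ LD L0) (fsumE us)// => i.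
by apply: contraNT => /(contraNN (sF i)) /negPn/eqP ->; rewrite L0.
Qed.

Section FSumLinear.
Variables (K : fieldType) (V V' : lmodType K) (I : choiceType).
Lemma fsum_linear (L : {linear V -> V'}) (F : I -> V) :
  fsupp F -> L (fsum F) = fsum (fun i => L (F i)).
Proof. by apply: fsum_lin; [apply: linear0|apply: linearD]. Qed.

Lemma fsumZ (c : K) (F : I -> V) : fsupp F -> c *: fsum F = fsum (fun i => c *: F i).
Proof. by move=> fF; apply: fsum_lin => // [|x y]; rewrite ?scaler0 ?scalerDr. Qed.

Lemma fsuppZ (c : I -> K) (F : I -> V) : fsupp F -> fsupp (fun i => c i *: F i).
Proof. by apply: sub_fsupp => i ->; rewrite scaler0. Qed.

Lemma fsupp_linear (L : V -> V') (F : I -> V) : L 0 = 0 ->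
  fsupp F -> fsupp (fun i => L (F i)).
Proof. by move=> L0; apply: sub_fsupp => i ->. Qed.
End FSumLinear.

(** Maps are kept as bare functions with a proof of [linear]; bundling them on demand gives access
    to the lemmas on linear maps. *)
Definition mklin (K : fieldType) (U V : lmodType K) (f : U -> V) (Hf : linear f)
  : {linear U -> V} := HB.pack f (GRing.isLinear.Build K U V *:%R f Hf).

Lemma addr_of_sub (U : zmodType) (a b c : U) : a - b = c -> a = b + c.
Proof. by move=> <-; rewrite addrC subrK. Qed.

Section LinearFun.
Variables (K : fieldType) (U V : lmodType K) (f : U -> V).
Hypothesis lf : linear f.
Lemma lin0 : f 0 = 0. Proof. exact: (linear0 (mklin lf)). Qed.
Lemma linD : {morph f : u v / u + v}. Proof. exact: (linearD (mklin lf)). Qed.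
Lemma linN : {morph f : u / - u}. Proof. exact: (linearN (mklin lf)). Qed.
Lemma linB : {morph f : u v / u - v}. Proof. exact: (linearB (mklin lf)). Qed.
Lemma linZ c u : f (c *: u) = c *: f u. Proof. by have := lf c u 0; rewrite !addr0 lin0 addr0. Qed.
Lemma linsum (I : Type) (r : seq I) (P : pred I) (E : I -> U) :
  f (\sum_(i <- r | P i) E i) = \sum_(i <- r | P i) f (E i).
Proof. exact: (linear_sum (mklin lf)). Qed.
Lemma linfsum (I : choiceType) (F : I -> U) :
  fsupp F -> f (fsum F) = fsum (fun i => f (F i)).
Proof. exact: (fsum_linear (mklin lf)). Qed.
End LinearFun.

(** * Linear maps out of direct sums, quotients and tensor products *)

Section Fext.
Variables (K : fieldType) (I : choiceType) (V U : lmodType K).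
Implicit Types f g : finsupp I V.

Lemma finsupp_fsupp f : fsupp f.
Proof. by case: f => f /= /asboolP. Qed.

Lemma finsuppDE f g i : (f + g) i = f i + g i. Proof. by []. Qed.
Lemma finsuppZE c f i : (c *: f) i = c *: f i. Proof. by []. Qed.

Lemma fsingleD i u v : fsingle i (u + v) = fsingle i u + fsingle i v :> finsupp I V.
Proof. by apply: val_inj; apply/funext => j /=; rewrite /GRing.add /=; case: eqP; rewrite ?addr0. Qed.
Lemma fsingleZ i c v : fsingle i (c *: v) = c *: fsingle i v :> finsupp I V.
Proof. by apply: val_inj; apply/funext => j /=; rewrite /GRing.scale /=; case: eqP; rewrite ?scaler0. Qed.

Lemma finsuppE f (s : seq I) : uniq s -> (forall i, f i != 0 -> i \in s) ->
  f = \sum_(i <- s) fsingle i (f i).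
Proof.
move=> us sf; apply: val_inj; apply/funext => j.
have -> : val (\sum_(i <- s) fsingle i (f i)) j = \sum_(i <- s) val (fsingle i (f i)) j.
  exact: (big_morph (fun g : finsupp I V => (g : _ -> V) j) (id1:=0) (op1:=+%R)).
have [js|js] := boolP (j \in s).
  rewrite (bigD1_seq j)//= eqxx big1 ?addr0// => i /negPf; by rewrite eq_sym => ->.
rewrite big_seq big1 => [/=|i is_ /=].
  by apply/eqP; apply: contraNT js => /sf.
by case: eqP => // ji; rewrite ji is_ in js.
Qed.

Lemma finsupp_ind (P : finsupp I V -> Prop) : P 0 ->
  (forall f g, P f -> P g -> P (f + g)) -> (forall i v, P (fsingle i v)) -> forall f, P f.
Proof.
move=> P0 PD P1 f; have [s us sf] := fsupp_seq (finsupp_fsupp f).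
by rewrite (finsuppE us sf); elim/big_ind: _.
Qed.

(** Universal property of the direct sum: the map with components [T i]. All operators on the
    constructed modules have this form. *)
Definition fext (T : I -> V -> U) (f : finsupp I V) : U := fsum (fun i => T i (f i)).

Variable (T : I -> V -> U).
Hypothesis Tlin : forall i, linear (T i).
Let T0 i : T i 0 = 0. Proof. exact: (lin0 (Tlin i)). Qed.

Lemma fext_fsupp f : fsupp (fun i => T i (f i)).
Proof. by apply: (sub_fsupp _ (finsupp_fsupp f)) => i ->. Qed.

Lemma fext_linear : linear (fext T).
Proof.
move=> c f g; rewrite /fext; have ff := fext_fsupp f; have fg := fext_fsupp g.
rewrite fsumZ// -fsumD//; last exact: fsuppZ.
by apply: eq_fsum => i; rewrite finsuppDE finsuppZE Tlin.
Qed.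

Lemma fext1 i v : fext T (fsingle i v) = T i v.
Proof. by rewrite /fext (@fsum1 _ _ i) /= ?eqxx// => j /negPf ->. Qed.

End Fext.

Lemma finsupp_lin_ext (K : fieldType) (I : choiceType) (V U : lmodType K)
  (F G : finsupp I V -> U) : linear F -> linear G ->
  (forall i v, F (fsingle i v) = G (fsingle i v)) -> F =1 G.
Proof.
move=> lF lG FG; apply: finsupp_ind => //.
- by rewrite (lin0 lF) (lin0 lG).
- by move=> f g Ff Fg; rewrite (linD lF) (linD lG) /= Ff Fg.
Qed.

Lemma lspan_ker (K : fieldType) (V U : lmodType K) (S : set V) (L : V -> U) :
  linear L -> (forall s, S s -> L s = 0) -> forall v, v \in lspan S -> L v = 0.
Proof.
move=> lL LS v /asboolP[n [c [u [Su ->]]]].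
rewrite (linsum lL) big1// => i _; by rewrite (linZ lL) LS ?scaler0.
Qed.

Section QuotLift.
Variables (K : fieldType) (V U : lmodType K) (S : set V) (L : V -> U).
Hypotheses (lL : linear L) (LS : forall s, S s -> L s = 0).
Definition lquot_lift (x : lquot S) : U := L (lrepr x).
Lemma lquot_liftE v : lquot_lift (lclass S v) = L v.
Proof.
apply/eqP; rewrite -subr_eq0 -(linB lL).
by apply/eqP/(lspan_ker lL LS); rewrite -lclassE lreprK.
Qed.
Lemma lquot_lift_linear : linear lquot_lift.
Proof.
move=> c x y; rewrite -[x]lreprK -[y]lreprK.
by rewrite -(lclass_linear S) !lquot_liftE lL.
Qed.
End QuotLift.

Section TensorTheory.
Variables (K : fieldType) (M W : lmodType K).

Lemma tensD1 (m m' : M) (w : W) c : tens (c *: m + m') w = c *: tens m w + tens m' w.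
Proof.
rewrite /tens; apply/eqP; rewrite -(lclass_linear (@tensor_relations K M W)) lclassE.
apply/asboolP; exists 1%N, (fun=> 1), (fun => fsingle (c *: m + m', w) (1 : K^o) -
   (c *: fsingle (m, w) (1 : K^o) + fsingle (m', w) (1 : K^o))).
by split=> [_|]; [left; exists c, m, m', w|rewrite big_ord1 scale1r].
Qed.
Lemma tensD2 (m : M) (w w' : W) c : tens m (c *: w + w') = c *: tens m w + tens m w'.
Proof.
rewrite /tens; apply/eqP; rewrite -(lclass_linear (@tensor_relations K M W)) lclassE.
apply/asboolP; exists 1%N, (fun=> 1), (fun => fsingle (m, c *: w + w') (1 : K^o) -
   (c *: fsingle (m, w) (1 : K^o) + fsingle (m, w') (1 : K^o))).
by split=> [_|]; [right; exists c, m, w, w'|rewrite big_ord1 scale1r].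
Qed.

Lemma tensor_linl w : linear (fun m : M => tens m w : tensor M W).
Proof. by move=> c m m'; apply: tensD1. Qed.
Lemma tensor_linr m : linear (@tens K M W m).
Proof. by move=> c m' m''; apply: tensD2. Qed.

Section Lift.
Variables (V : lmodType K) (b : M -> W -> V).
Hypotheses (bl : forall w, linear (b^~ w)) (br : forall m, linear (b m)).

Let T (mw : M * W) (c : K^o) : V := c *: b mw.1 mw.2.
Let Tlin mw : linear (T mw).
Proof. by move=> a c d; rewrite /T scalerDl scalerA. Qed.
Let Tker f : @tensor_relations K M W f -> fext T f = 0.
Proof.
have H := fext_linear Tlin.
case=> -[c [m [m' [w ->]]]]; rewrite (linB H) (linD H) (linZ H) !fext1 //.
  by rewrite /T /= !scale1r bl subrr.
by rewrite /T /= !scale1r br subrr.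
Qed.
Definition tensor_lift : {linear tensor M W -> V} :=
  mklin (lquot_lift_linear (fext_linear Tlin) Tker).
Lemma tensor_liftE m w : tensor_lift (tens m w) = b m w.
Proof. by rewrite /tensor_lift /= lquot_liftE ?fext1 /T ?scale1r//; apply: fext_linear. Qed.
End Lift.

Lemma tensor_ind (P : tensor M W -> Prop) :
  (forall c u v, P u -> P v -> P (c *: u + v)) -> (forall m w, P (tens m w)) ->
  forall x, P x.
Proof.
move=> PD P1 x; rewrite -[x]lreprK.
have P0 : P 0 by rewrite -(lin0 (tensor_linl 0)).
elim/finsupp_ind: (lrepr x) => [|f g Pf Pg|[m w] c].
- by rewrite (lin0 (lclass_linear _)).
- by rewrite lclassD -[lclass _ f]scale1r; apply: PD.
have -> : lclass (@tensor_relations K M W) (fsingle (m, w) c) = (c : K) *: (tens m w : tensor M W).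
  by rewrite /tens -(linZ (@lclass_linear K _ _)) -fsingleZ /GRing.scale /= mulr1.
by rewrite -[_ *: _]addr0; apply: PD.
Qed.

End TensorTheory.

(* The universal property is recorded for an abstract space T, so that unification never
   unfolds the operations of the concrete quotient. *)
Record tensor_like (K : fieldType) (M W T : lmodType K) (tn : M -> W -> T) : Prop := {
  tlike_l : forall w, linear (tn^~ w);
  tlike_r : forall m, linear (tn m);
  tlike_ind : forall P : T -> Prop,
    (forall c u v, P u -> P v -> P (c *: u + v)) -> (forall m w, P (tn m w)) -> forall x, P x;
  tlike_lift : forall (V : lmodType K) (b : M -> W -> V),
    (forall w, linear (b^~ w)) -> (forall m, linear (b m)) ->
    exists L : {linear T -> V}, forall m w, L (tn m w) = b m w }.

Lemma tensor_tensor_like (K : fieldType) (M W : lmodType K) : tensor_like (@tens K M W).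
Proof.
split; [exact: tensor_linl|exact: tensor_linr|exact: tensor_ind|].
by move=> V b bl br; exists (tensor_lift bl br); apply: tensor_liftE.
Qed.

Section TensorLike.
Variables (K : fieldType) (M W T : lmodType K) (tn : M -> W -> T).
Hypothesis HT : tensor_like tn.
Let linl := tlike_l HT.
Let linr := tlike_r HT.

Lemma tens0l w : tn 0 w = 0. Proof. exact: (lin0 (linl w)). Qed.
Lemma tens0r m : tn m 0 = 0. Proof. exact: (lin0 (linr m)). Qed.
Lemma tensDl m m' w : tn (m + m') w = tn m w + tn m' w. Proof. exact: (linD (linl w)). Qed.
Lemma tensDr m w w' : tn m (w + w') = tn m w + tn m w'. Proof. exact: (linD (linr m)). Qed.
Lemma tensBl m m' w : tn (m - m') w = tn m w - tn m' w. Proof. exact: (linB (linl w)). Qed.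
Lemma tensBr m w w' : tn m (w - w') = tn m w - tn m w'. Proof. exact: (linB (linr m)). Qed.
Lemma tensZl c m w : tn (c *: m) w = c *: tn m w. Proof. exact: (linZ (linl w)). Qed.
Lemma tensZr c m w : tn m (c *: w) = c *: tn m w. Proof. exact: (linZ (linr m)). Qed.

Lemma eq_tensor (V : lmodType K) (F G : T -> V) : linear F -> linear G ->
  (forall m w, F (tn m w) = G (tn m w)) -> F =1 G.
Proof. by move=> lF lG FG; apply: (tlike_ind HT) => // c u v Fu Fv; rewrite lF lG Fu Fv. Qed.

Section Map.
Variables (f : {linear M -> M}) (g : {linear W -> W}).
Let fgl w : linear (fun m => tn (f m) (g w)).
Proof. by move=> c u v; rewrite linearP linl. Qed.
Let fgr m : linear (fun w => tn (f m) (g w)).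
Proof. by move=> c u v; rewrite linearP linr. Qed.
Definition tmap : {linear T -> T} := sval (cid (tlike_lift HT fgl fgr)).
Lemma tmapE m w : tmap (tn m w) = tn (f m) (g w).
Proof. by rewrite /tmap; case: cid. Qed.
End Map.

Definition trestricted (A : int -> T -> T) :=
  forall v, exists n0 : int, forall n, n0 < n -> A n v = 0.
Lemma trestrictedP (A : int -> T -> T) : (forall n, linear (A n)) ->
  (forall m w, exists n0 : int, forall n, n0 < n -> A n (tn m w) = 0) -> trestricted A.
Proof.
move=> Al Am; apply: (tlike_ind HT) => //.
move=> c u v [a Ha] [b Hb]; exists (Num.max a b) => n.
by rewrite gt_max => /andP[an bn]; rewrite Al Ha// Hb// scaler0 addr0.
Qed.

Lemma fsupp_tensorP (I : choiceType) (A : I -> T -> T) :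
  (forall i, linear (A i)) -> (forall m w, fsupp (fun i => A i (tn m w))) ->
  forall v, fsupp (fun i => A i v).
Proof.
move=> Al Am; apply: (tlike_ind HT (P := fun v => fsupp (fun i => A i v))) => //.
move=> c u v Hu Hv; have E : (fun i => A i (c *: u + v)) = (fun i => c *: A i u + A i v).
  by apply/funext => i; rewrite Al.
rewrite E; exact: (fsuppD (fsuppZ (fun=> c) Hu) Hv).
Qed.
End TensorLike.

Definition idlin (K : fieldType) (U : lmodType K) : {linear U -> U} :=
  mklin (f := fun u => u) (fun c u v => erefl (c *: u + v)).

(** * Operator exponentials *)

Definition int_range (a b : int) : seq int := [seq a + (n%:Z) | n <- iota 0 (`|b - a|.+1)].
Lemma mem_int_range a b k : a <= k -> k <= b -> k \in int_range a b.
Proof.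
move=> ak kb; apply/mapP; exists (`|k - a|%N); first by rewrite mem_iota; lia.
by lia.
Qed.

Section IntSupp.
Variable V : zmodType.
Lemma fsupp_int (F : int -> V) (a b : int) :
  (forall k, F k != 0 -> a <= k /\ k <= b) -> fsupp F.
Proof. by move=> H; apply: (@fsupp_seqW _ _ _ (int_range a b)) => k /H[]; apply: mem_int_range. Qed.
Lemma fsupp_int_dep (J : choiceType) (F : int * J -> V) (a b : int) :
  (forall k j, F (k, j) != 0 -> a <= k /\ k <= b) ->
  (forall k, fsupp (fun j => F (k, j))) -> fsupp F.
Proof. by move=> H; apply: (@fsupp_dep _ _ _ _ (int_range a b)) => k j /H[]; apply: mem_int_range. Qed.
End IntSupp.

(* E(x) = sum_q E_q x^q with x E'(x) = T(x) E(x), E_0 = 1, i.e. E(x) = exp (sum_j T_j x^j / j) *)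
Record exp_series (K : numFieldType) (M : lmodType K) (T E : int -> M -> M) : Prop := {
  exs_T_lin : forall j, linear (T j);
  exs_E_lin : forall j, linear (E j);
  exs_T_neg : forall j v, j <= 0 -> T j v = 0;
  exs_E_neg : forall j v, j < 0 -> E j v = 0;
  exs_E_0 : forall v, E 0 v = v;
  exs_rec : forall q v, q%:~R *: E q v = fsum (fun j => T j (E (q - j) v)) }.

(** Coefficients are indexed by all integers and vanish at negative ones, so a strong induction on
    the nonnegative indices is enough. *)
Lemma int_ind_up (P : int -> Prop) : (forall q, q < 0 -> P q) ->
  (forall q, 0 <= q -> (forall k, k < q -> P k) -> P q) -> forall q, P q.
Proof.
move=> Pneg Pq q; have [n] := ubnP `|q|%N; elim: n q => // n IH q qn.
have [/Pneg//|q0] := ltP q 0; apply: Pq => // k kq.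
have [/Pneg//|k0] := ltP k 0; apply: IH; lia.
Qed.

Section ExpSeries.
Variables (K : numFieldType) (M : lmodType K) (T E : int -> M -> M).
Hypothesis ES : exp_series T E.
Let Tl := exs_T_lin ES.
Let El := exs_E_lin ES.

Lemma exs_supp (F : M -> M) q v : F 0 = 0 -> fsupp (fun j => T j (E (q - j) (F v))).
Proof.
move=> F0; apply: (@fsupp_int _ _ 0 q) => k kT.
have [k0|k0] := leP k 0; first by rewrite (exs_T_neg ES)// eqxx in kT.
split; first exact: ltW; rewrite leNgt; apply: contra_neqN kT => qk.
by rewrite (exs_E_neg ES) ?(lin0 (Tl _))// subr_lt0.
Qed.

Lemma exs_recS q v : fsupp (fun j => T j (E (q - j) v)).
Proof. exact: (@exs_supp id). Qed.

Lemma exs_cancel (u v : M) q : (q%:~R : K) *: u = q%:~R *: v -> q != 0 -> u = v.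
Proof.
move=> /eqP; rewrite -subr_eq0 -scalerBr scaler_eq0 intr_eq0 => + q0.
by rewrite (negPf q0) /= subr_eq0 => /eqP.
Qed.

(** Since $[L,T_i]=c$ is a scalar and [L] commutes with the other modes, formally
    $[L,E(x)]=(c/i)x^iE(x)$. Both sides satisfy the recursion [exs_rec]; the split $q=(q-i)+i$
    produces the extra term. *)
Lemma exs_derivation (L : M -> M) (i : int) (c : K) :
  linear L -> 0 < i ->
  (forall j v, 0 < j -> L (T j v) = T j (L v) + if j == i then c *: v else 0) ->
  forall q v, L (E q v) = E q (L v) + (c / i%:~R) *: E (q - i) v.
Proof.
move=> Ll i0 LT; elim/int_ind_up => [q q0 v|q q0 IH v].
  rewrite !(exs_E_neg ES) ?(lin0 Ll)//; last by lia.
  by rewrite scaler0 addr0.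
have [->|qn0] := eqVneq q 0.
  by rewrite !(exs_E_0 ES) (exs_E_neg ES) ?scaler0 ?addr0// sub0r oppr_lt0.
apply: (exs_cancel _ qn0); rewrite -(linZ Ll) (exs_rec ES) (linfsum Ll); last exact: exs_recS.
have iR : i%:~R != 0 :> K by rewrite intr_eq0; lia.
transitivity (fsum (fun j => T j (E (q - j) (L v))
  + ((c / i%:~R) *: T j (E (q - i - j) v)
     + if j == i then c *: E (q - i) v else 0))).
  apply: eq_fsum => j; have [j0|j0] := leP j 0.
    rewrite !(exs_T_neg ES)// (lin0 Ll) scaler0 !add0r.
    by case: eqP => // ji; move: i0; rewrite -ji ltNge j0.
  rewrite LT// IH ?(linD (Tl _)) ?(linZ (Tl _)); last by lia.
  by rewrite -!addrA; congr (_ + (_ *: T j (E _ v) + _)); [lia|case: eqP => [->|]].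
have f1 := @exs_recS q (L v); have f2 := @exs_recS (q - i) v.
have f3 : fsupp (fun j => if j == i then c *: E (q - i) v else 0).
  by apply: (@fsupp1 _ _ i) => j /negPf ->.
rewrite !fsumD//; try (by apply: fsuppD => //; apply: fsuppZ); try exact: fsuppZ.
rewrite -fsumZ// -!(exs_rec ES) (@fsum1 _ _ i); last by move=> j /negPf ->.
rewrite eqxx scalerDr; congr (_ + _); rewrite !scalerA -scalerDl; congr (_ *: _).
by rewrite rmorphB /=; field.
Qed.

Lemma exs_comm (L : M -> M) : linear L ->
  (forall j v, 0 < j -> L (T j v) = T j (L v)) ->
  forall q v, L (E q v) = E q (L v).
Proof.
move=> Ll LT q v; rewrite (@exs_derivation L 1 0)// ?mul0r ?scale0r ?addr0// => j w j0.
by rewrite LT// scale0r; case: eqP; rewrite addr0.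
Qed.

(** Here [L] acts on $T(x)$ by commutator as the Euler operator $s\,x\,d/dx$, hence on $E(x)$ as
    well. *)
Lemma exs_grading (L : M -> M) (s : K) : linear L ->
  (forall j v, 0 < j -> L (T j v) = T j (L v) + (s * j%:~R) *: T j v) ->
  forall q v, L (E q v) = E q (L v) + (s * q%:~R) *: E q v.
Proof.
move=> Ll LT; elim/int_ind_up => [q q0 v|q q0 IH v].
  by rewrite !(exs_E_neg ES) ?(lin0 Ll)// scaler0 addr0.
have [->|qn0] := eqVneq q 0.
  by rewrite !(exs_E_0 ES) mulr0 scale0r addr0.
apply: (exs_cancel _ qn0); rewrite -(linZ Ll) (exs_rec ES) (linfsum Ll); last exact: exs_recS.
transitivity (fsum (fun j => T j (E (q - j) (L v)) + (s * q%:~R) *: T j (E (q - j) v))).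
  apply: eq_fsum => j; have [j0|j0] := leP j 0.
    by rewrite !(exs_T_neg ES)// (lin0 Ll) scaler0 addr0.
  rewrite LT// IH ?(linD (Tl _)) ?(linZ (Tl _)); last by lia.
  by rewrite -addrA -scalerDl rmorphB /=; congr (_ + _ *: _); ring.
have f1 := @exs_recS q (L v); have f2 := @exs_recS q v.
rewrite fsumD//; last exact: fsuppZ.
rewrite -fsumZ// -!(exs_rec ES) scalerDr; congr (_ + _).
by rewrite !scalerA mulrC.
Qed.

(** In characteristic 0 the equation $xE'(x)=T(x)E(x)$ with $E_0=1$ determines every coefficient.
    Products of exponentials are identified in this way, without manipulating the exponential
    series. *)
Lemma exs_unique E' : exp_series T E' -> forall q v, E q v = E' q v.
Proof.
move=> ES'; elim/int_ind_up => [q q0 v|q q0 IH v].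
  by rewrite (exs_E_neg ES)// (exs_E_neg ES').
have [->|qn0] := eqVneq q 0; first by rewrite (exs_E_0 ES) (exs_E_0 ES').
apply: (exs_cancel _ qn0); rewrite (exs_rec ES) (exs_rec ES').
apply: eq_fsum => j; have [j0|j0] := leP j 0; first by rewrite !(exs_T_neg ES).
by rewrite IH//; lia.
Qed.

End ExpSeries.

Lemma exs_const (K : numFieldType) (M : lmodType K) :
  exp_series (fun _ (_ : M) => 0) (fun q v => if q == 0 then v else 0).
Proof.
split=> //.
- by move=> j c u v; rewrite scaler0 addr0.
- by move=> j c u v; case: ifP => //; rewrite scaler0 addr0.
- by move=> j v; case: eqP => // ->.
- by move=> q v; rewrite fsum0//; case: eqP => [->|]; rewrite ?scale0r ?scaler0.
Qed.

(** * Products of commuting exponentials *)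

Section ExpProduct.
Variables (K : numFieldType) (M : lmodType K) (T E T' E' : int -> M -> M).
Hypotheses (ES : exp_series T E) (ES' : exp_series T' E').
Hypothesis comm : forall i j v, T i (T' j v) = T' j (T i v).
Let Tl := exs_T_lin ES. Let El := exs_E_lin ES.
Let Tl' := exs_T_lin ES'. Let El' := exs_E_lin ES'.

Definition exs_mul n v := fsum (fun i => E i (E' (n - i) v)).

Lemma exs_mul_supp (L : int -> M -> M) n v : (forall i, L i 0 = 0) ->
  fsupp (fun i => L i (E i (E' (n - i) v))).
Proof.
move=> L0; apply: (@fsupp_int _ _ 0 n) => i H; split; rewrite leNgt; apply: contra_neqN H => H.
  by rewrite (exs_E_neg ES).
by rewrite (exs_E_neg ES') ?(lin0 (El _))//; lia.
Qed.

(** The Euler operator applied to the left factor alone brings out $T(x)$ in front of the product.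
    Besides serving the product rule, this is what later recovers Heisenberg modes from a product of
    inverse exponentials. *)
Lemma exs_mul_deriv n v :
  fsum (fun i => i%:~R *: E i (E' (n - i) v)) = fsum (fun j => T j (exs_mul (n - j) v)).
Proof.
pose F1 (x : int * int) := T x.2 (E (x.1 - x.2) (E' (n - x.1) v)).
have fF1 : fsupp F1.
  apply: (@fsupp_int_dep _ _ _ 0 n) => [i j|i]; rewrite /F1 /=; last exact: (exs_recS ES).
  have [->|H] := eqVneq (E' (n - i) v) 0; first by rewrite (lin0 (El _)) (lin0 (Tl _)) eqxx.
  have [/(exs_T_neg ES) ->|j0] := leP j 0; first by rewrite eqxx.
  have [H'|H'] := ltP (i - j) 0; first by rewrite (exs_E_neg ES)// (lin0 (Tl _)) eqxx.
  split; first by lia.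
  by rewrite leNgt; apply: contra_neqN H => H; rewrite (exs_E_neg ES')//; lia.
transitivity (fsum (fun i => fsum (fun j => F1 (i, j)))).
  by apply: eq_fsum => i; rewrite (exs_rec ES).
rewrite fsum_exchange//; apply: eq_fsum => j.
rewrite /exs_mul (linfsum (Tl j)); last exact: (@exs_mul_supp (fun _ => id)).
rewrite (@fsum_bij _ _ _ (fun i => i + j) (fun i => i - j)); last 2 first.
- by move=> i; rewrite addrK.
- by move=> i; rewrite subrK.
by apply: eq_fsum => i; rewrite /F1 /= addrK; congr (T _ (E _ (E' _ _))); lia.
Qed.

(** For the right factor the mode $T'_j$ has to be carried past $E$, which is where the commutation
    of the two families enters. *)
Lemma exs_mul_deriv2 n v :
  fsum (fun i => (n - i)%:~R *: E i (E' (n - i) v)) = fsum (fun j => T' j (exs_mul (n - j) v)).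
Proof.
pose F2 (x : int * int) := T' x.2 (E x.1 (E' (n - x.1 - x.2) v)).
have ET' i j w : E i (T' j w) = T' j (E i w).
  by symmetry; apply: (exs_comm ES) => [|k u _]; [exact: Tl'|rewrite comm].
have fF2 : fsupp F2.
  apply: (@fsupp_int_dep _ _ _ 0 n) => [i j|i]; rewrite /F2 /=.
    have [H|H] := ltP i 0; first by rewrite (exs_E_neg ES)// (lin0 (Tl' _)) eqxx.
    have [/(exs_T_neg ES') ->|j0] := leP j 0; first by rewrite eqxx.
    have [H'|H'] := ltP (n - i - j) 0; last by split=> //; lia.
    by rewrite (exs_E_neg ES')// (lin0 (El _)) (lin0 (Tl' _)) eqxx.
  have := fsupp_linear (lin0 (El i)) (exs_recS ES' (n - i) v).
  by apply: eq_fsupp => j; rewrite ET'.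
transitivity (fsum (fun i => fsum (fun j => F2 (i, j)))).
  apply: eq_fsum => i; rewrite -(linZ (El i)) (exs_rec ES') (linfsum (El i)).
    by apply: eq_fsum => j; rewrite ET'.
  exact: (exs_recS ES').
rewrite fsum_exchange//; apply: eq_fsum => j.
rewrite /exs_mul (linfsum (Tl' j)); last exact: (@exs_mul_supp (fun _ => id)).
by apply: eq_fsum => i; rewrite /F2 /=; congr (T' _ (E _ (E' _ _))); lia.
Qed.

Lemma exs_mul_linear n : linear (exs_mul n).
Proof.
move=> c u v; have s w := @exs_mul_supp (fun _ => id) n w (fun=> erefl).
rewrite /exs_mul fsumZ -?fsumD; [|exact: fsuppZ|exact: s..].
by apply: eq_fsum => i; rewrite El' El.
Qed.

Lemma exs_mul_neg n v : n < 0 -> exs_mul n v = 0.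
Proof.
move=> n0; apply: fsum0 => i; have [i0|i0] := ltP i 0; first by rewrite (exs_E_neg ES).
by rewrite (exs_E_neg ES') ?(lin0 (El _))//; lia.
Qed.

Lemma exs_mul_exp : exp_series (fun j v => T j v + T' j v) exs_mul.
Proof.
split.
- by move=> j c u v; rewrite Tl Tl' scalerDr !addrA; congr (_ + _); rewrite addrAC.
- exact: exs_mul_linear.
- by move=> j v j0; rewrite (exs_T_neg ES)// (exs_T_neg ES')// addr0.
- exact: exs_mul_neg.
- move=> v; rewrite /exs_mul (@fsum1 _ _ 0) => [|i i0]; first by rewrite subr0 (exs_E_0 ES) (exs_E_0 ES').
  have [i1|i1] := ltP i 0; first by rewrite (exs_E_neg ES).
  by rewrite (exs_E_neg ES') ?(lin0 (El _))//; lia.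
move=> n v; have s0 := @exs_mul_supp (fun _ => id) n v (fun=> erefl).
have sT (T0 : int -> M -> M) : (forall j, linear (T0 j)) ->
    (forall j w, j <= 0 -> T0 j w = 0) -> fsupp (fun j => T0 j (exs_mul (n - j) v)).
  move=> T0l T00; apply: (@fsupp_int _ _ 0 n) => j; have [j0|j0] := leP j 0.
    by rewrite T00// eqxx.
  have [nj|nj] := leP j n; first by split=> //; exact: ltW.
  by rewrite exs_mul_neg ?(lin0 (T0l _)) ?eqxx//; lia.
rewrite fsumD; [|exact: (sT _ Tl (exs_T_neg ES))|exact: (sT _ Tl' (exs_T_neg ES'))].
rewrite -exs_mul_deriv -exs_mul_deriv2 -fsumD; [|exact: fsuppZ..].
rewrite /exs_mul fsumZ//; apply: eq_fsum => i.
by rewrite -scalerDl -rmorphD /= subrKC.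
Qed.

End ExpProduct.

(* int_binom m k is the coefficient of x^k in (1 - x)^m *)
Definition int_binom (K : fieldType) (m : K) (k : int) : K :=
  if k is Posz p then (-1) ^+ p * gbinomial m p else 0.

(** * The binomial series and the exchange of two exponentials *)

Section Exchange.
Variables (K : numFieldType).

Lemma gbinomialS (m : K) p : (p.+1)%:R * gbinomial m p.+1 = (m - p%:R) * gbinomial m p.
Proof.
rewrite /gbinomial big_ord_recr /= factS natrM.
have : p.+1%:R != 0 :> K by rewrite pnatr_eq0.
have : p`!%:R != 0 :> K by rewrite pnatr_eq0 -lt0n fact_gt0.
by move=> f1; rewrite -add1n natrD => f2; field; apply/andP.
Qed.

Lemma int_binom_supp (m : K) k : fsupp (fun j : int => if 0 < j then int_binom m (k - j) else 0).
Proof.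
apply: (@fsupp_int _ _ 0 k) => j; case: ifP => [j0|_]; last by rewrite eqxx.
by case E: (k - j) => [p|p]; rewrite /= ?eqxx//; lia.
Qed.

(** Coefficient form of $xf'=-m\,\frac{x}{1-x}f$ for $f=(1-x)^m$. *)
Lemma int_binom_rec (m : K) k :
  k%:~R * int_binom m k = - m * fsum (fun j : int => if 0 < j then int_binom m (k - j) else 0).
Proof.
have neg q : q <= 0 -> fsum (fun j : int => if 0 < j then int_binom m (q - j) else 0) = 0.
  move=> q0; apply: fsum0 => j; case: ifP => // j0.
  by case E: (q - j) => [p|p] //; lia.
case: k => [p|p]; last by rewrite neg ?mulr0.
elim: p => [|p IH]; first by rewrite neg // mulr0 mul0r.
rewrite (@fsum_bij _ _ _ (fun i : int => i + 1) (fun i => i - 1)); last 2 first.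
- by move=> i; rewrite addrK.
- by move=> i; rewrite subrK.
transitivity (- m * fsum (fun j : int => (if 0 < j then int_binom m (p%:Z - j) else 0)
   + if j == 0 then int_binom m p else 0)).
  rewrite fsumD; last 2 first.
  - exact: int_binom_supp.
  - by apply: (@fsupp1 _ _ 0) => j /negPf ->.
  rewrite (@fsum1 _ _ 0 (fun j => if j == 0 then _ else _)); last by move=> j /negPf ->.
  rewrite eqxx mulrDr -IH /=.
  have := gbinomialS m p; rewrite exprS -!pmulrn => E.
  rewrite mulrCA -mulrA E; ring.
congr (_ * _); apply: eq_fsum => j; rewrite /comp; have [->|j0] := eqVneq j 0.
  by rewrite ltxx !add0r ltr01; congr (int_binom _ _); lia.
have -> : (0 < j + 1) = (0 < j) by lia.
by case: ifP => _; rewrite addr0//; congr (int_binom _ _); lia.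
Qed.

Lemma int_binom0 (m : K) : int_binom m 0 = 1.
Proof. by rewrite /= expr0 mul1r /gbinomial big_ord0 fact0 divr1. Qed.

Variables (M : lmodType K) (T E T' E' : int -> M -> M) (m : K).
Hypotheses (ES : exp_series T E) (ES' : exp_series T' E').
Hypothesis commTT : forall i j v, T i (T j v) = T j (T i v).
Hypothesis comm : forall i j v, 0 < i -> 0 < j ->
  T i (T' j v) = T' j (T i v) + if j == i then (- (m * i%:~R)) *: v else 0.
Let Tl := exs_T_lin ES. Let El := exs_E_lin ES.
Let Tl' := exs_T_lin ES'. Let El' := exs_E_lin ES'.

Lemma exs_exchange_supp (L : int -> M -> M) q p v : (forall k, L k 0 = 0) ->
  fsupp (fun k => L k (int_binom m k *: E' (p - k) (E (q - k) v))).
Proof.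
move=> L0; apply: (@fsupp_int _ _ 0 q) => k H; split; rewrite leNgt; apply: contra_neqN H => H.
  by case: k H => // k _; rewrite scale0r.
by rewrite (exs_E_neg ES) ?(lin0 (El' _)) ?scaler0//; lia.
Qed.

(** The identity $E(z)E'(w)=(1-zw)^mE'(w)E(z)$. It is proved by induction on the power of $z$:
    [exs_rec] extracts a mode $T_i$, and carrying $T_i$ past $E'(w)$ costs $-m\,w^iE'(w)$. *)
Lemma exs_exchange q p v :
  E q (E' p v) = fsum (fun k => int_binom m k *: E' (p - k) (E (q - k) v)).
Proof.
elim/int_ind_up: q p v => [q q0 p v|q q0 IH p v].
  rewrite (exs_E_neg ES)// fsum0// => k; case: k => [k|k]; last by rewrite scale0r.
  by rewrite (exs_E_neg ES) ?(lin0 (El' _)) ?scaler0//; lia.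
have [->|qn0] := eqVneq q 0.
  rewrite (@fsum1 _ _ 0) ?subr0 ?int_binom0 ?scale1r ?(exs_E_0 ES)// => -[k|k] k0.
    by rewrite (exs_E_neg ES) ?(lin0 (El' _)) ?scaler0//; lia.
  by rewrite scale0r.
have TE' i w n : 0 < i -> T i (E' n w) = E' n (T i w) - m *: E' (n - i) w.
  move=> i0; rewrite (@exs_derivation _ _ _ _ ES' (T i) i (- (m * i%:~R)))//; last first.
    by move=> j u j0; rewrite comm.
  congr (_ + _); rewrite -scaleNr; congr (_ *: _).
  have iR : i%:~R != 0 :> K by rewrite intr_eq0; lia.
  by field.
have TEc i w n : T i (E n w) = E n (T i w) by apply: (exs_comm ES).
apply: (exs_cancel _ qn0).
pose F1 (x : int * int) := int_binom m x.1 *: E' (p - x.1) (T x.2 (E (q - x.1 - x.2) v)).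
pose F2 (x : int * int) := if 0 < x.2 then
  (- m * int_binom m (x.1 - x.2)) *: E' (p - x.1) (E (q - x.1) v) else 0.
have fF1 : fsupp F1.
  apply: (@fsupp_int_dep _ _ _ 0 q) => [i j|i]; rewrite /F1 /=.
    case: i => [i|i]; last by rewrite scale0r eqxx.
    have [/(exs_T_neg ES) ->|j0] := leP j 0; first by rewrite (lin0 (El' _)) scaler0 eqxx.
    have [H'|H'] := ltP (q - i%:Z - j) 0; last by move=> _; split=> //; lia.
    by rewrite (exs_E_neg ES)// (lin0 (Tl _)) (lin0 (El' _)) scaler0 eqxx.
  apply: (@fsuppZ _ _ _ (fun=> int_binom m i)); apply: fsupp_linear; last exact: (exs_recS ES).
  exact: lin0.
have fF2 : fsupp F2.
  apply: (@fsupp_int_dep _ _ _ 0 q) => [i j|i]; rewrite /F2 /=.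
    case: ifP => [j0|_]; last by rewrite eqxx.
    case E1 : (i - j) => [k|k]; last by rewrite mulr0 scale0r eqxx.
    have [H'|H'] := ltP (q - i) 0; last by move=> _; split=> //; lia.
    by rewrite (exs_E_neg ES)// (lin0 (El' _)) scaler0 eqxx.
  apply: (@fsupp_int _ _ 0 i) => j; case: ifP => [j0|_]; last by rewrite eqxx.
  by case E1 : (i - j) => [k|k]; [lia|rewrite mulr0 scale0r eqxx].
(* The factor $q$ is split as $(q-k)+k$ under the sum: [F1] comes from the recursion for $E$ at
   $q-k$, [F2] from the recursion for the binomial coefficient at $k$. *)
transitivity (fsum (fun i => fsum (fun j => F1 (i, j))) + fsum (fun i => fsum (fun j => F2 (i, j)))); last first.
  have s0 := @exs_exchange_supp (fun _ => id) q p v (fun=> erefl).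
  rewrite fsumZ; last exact: s0.
  rewrite -(fsumD (fsupp_fsum fF1) (fsupp_fsum fF2)).
  apply: eq_fsum => k; rewrite /F1 /F2 /=.
  rewrite -fsumZ; last first.
    apply: (@fsupp_linear _ _ _ _ (E' (p - k))); first exact: lin0.
    exact: (exs_recS ES).
  rewrite -(linfsum (El' _)); last exact: (exs_recS ES).
  rewrite -(exs_rec ES) (linZ (El' _)) !scalerA.
  transitivity ((int_binom m k * (q - k)%:~R) *: E' (p - k) (E (q - k) v) +
    (k%:~R * int_binom m k) *: E' (p - k) (E (q - k) v)).
    congr (_ + _); rewrite int_binom_rec.
    pose Y := E' (p - k) (E (q - k) v).
    have lY : linear (fun c : K^o => (- m * c) *: Y).
      by move=> a b c; rewrite scalerA -scalerDl mulrDr mulrCA.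
    rewrite [RHS](linfsum lY); last exact: int_binom_supp.
    by apply: eq_fsum => j; case: ifP; rewrite ?mulr0 ?scale0r.
  by rewrite -scalerDl; congr (_ *: _); rewrite rmorphB /=; ring.
rewrite !fsum_exchange// (exs_rec ES).
have sw (F : int * int -> M) : fsupp F -> fsupp (fun j => fsum (fun i => F (i, j))).
  move=> fF; apply: (@fsupp_fsum _ _ _ (fun x => F (x.2, x.1))).
  by apply: (fsupp_reindex _ fF) => -[a b] [c d] [-> ->].
rewrite -(fsumD (sw _ fF1) (sw _ fF2)); apply: eq_fsum => j.
have [j0|j0] := leP j 0.
  rewrite (exs_T_neg ES)// !fsum0 ?addr0// => i; rewrite /F2 /F1 /=; first by rewrite ltNge j0.
  by rewrite (exs_T_neg ES)// (lin0 (El' _)) scaler0.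
rewrite TEc TE'// (linB (El _)) (linZ (El _)) !IH; try lia.
congr (_ + _).
  by apply: eq_fsum => k; rewrite /F1 /= TEc; congr (_ *: E' _ (E _ _)); lia.
have s0 := @exs_exchange_supp (fun _ => id) (q - j) (p - j) v (fun=> erefl).
rewrite -scaleNr fsumZ; last exact: s0.
rewrite [RHS](@fsum_bij _ _ _ (fun i => i + j) (fun i => i - j)); last 2 first.
- by move=> i; rewrite addrK.
- by move=> i; rewrite subrK.
apply: eq_fsum => k; rewrite /F2 /comp /= j0 addrK scalerA.
by congr (_ *: E' _ (E _ _)); lia.
Qed.
End Exchange.

Lemma twisted_mulE (K : fieldType) (W : lmodType K) c (A B : int -> W -> W) a b w :
  twisted_mul c A B a b w = fsum (fun k : int => int_binom c k *: A (a - k) (B (b + k) w)).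
Proof.
rewrite (@fsum_reindex _ _ _ (fun p : nat => p%:Z)) //; first by move=> i j [].
by case=> [p|p]; [exists p|rewrite scale0r eqxx].
Qed.

Lemma exchange_big_triangle (V : nmodType) n (F : nat -> nat -> V) :
  \sum_(1 <= j < n.+1) \sum_(1 <= i < (n - j).+1) F j i =
  \sum_(1 <= i < n.+1) \sum_(1 <= j < (n - i).+1) F j i.
Proof.
have H (G : nat -> nat -> V) : \sum_(1 <= j < n.+1) \sum_(1 <= i < (n - j).+1) G j i =
  \sum_(1 <= j < n.+1) \sum_(1 <= i < n.+1) if (i + j <= n)%N then G j i else 0.
  apply: eq_big_nat => j /andP[j1 jn].
  rewrite (@big_nat_widen _ _ _ _ _ n.+1) ?big_mkcond; last by lia.
  by apply: eq_bigr => i _; congr (if _ then _ else _); rewrite /=; lia.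
rewrite H exchange_big_nat (H (fun i j => F j i)); apply: eq_bigr => i _.
by apply: eq_bigr => j _; rewrite addnC.
Qed.

(** * The exponential series of the statement as solutions of the recursion *)

Section SeriesExp.
Variables (K : numFieldType) (M : lmodType K) (S : nat -> M -> M).
Hypothesis Sl : forall j, linear (S j).
Hypothesis Sc : forall i j v, S i (S j v) = S j (S i v).

Lemma series_pow_linear p n : linear (series_pow S p n).
Proof.
elim: p n => [|p IH] n c u v /=; first by case: ifP => // _; rewrite scaler0 addr0.
by rewrite scaler_sumr -big_split /=; apply: eq_bigr => j _; rewrite IH Sl.
Qed.

Lemma series_pow_gt p n v : (n < p)%N -> series_pow S p n v = 0.
Proof.
elim: p n => // p IH n np /=; rewrite big_nat big1// => j /andP[j1 jn].
by rewrite IH ?(lin0 (Sl _))//; lia.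
Qed.

(** Coefficient form of $x(S^{p+1})'=(p+1)(xS')S^p$; it needs the coefficients of $S$ to commute. *)
Lemma series_pow_rec p n v : n%:R *: series_pow S p.+1 n v =
  p.+1%:R *: \sum_(1 <= j < n.+1) j%:R *: S j (series_pow S p (n - j) v).
Proof.
elim: p n => [|p IH] n.
  rewrite /= scaler_sumr scale1r; apply: eq_big_nat => j /andP[j1 jn].
  have [->//|nj] := eqVneq n j; have -> : (n - j == 0)%N = false by lia.
  by rewrite (lin0 (Sl _)) !scaler0.
have -> : series_pow S p.+2 n v = \sum_(1 <= j < n.+1) S j (series_pow S p.+1 (n - j) v) by [].
rewrite [LHS]scaler_sumr.
transitivity (\sum_(1 <= j < n.+1) (j%:R *: S j (series_pow S p.+1 (n - j) v)
   + p.+1%:R *: \sum_(1 <= i < (n - j).+1) i%:R *: S i (S j (series_pow S p (n - j - i) v)))).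
  apply: eq_big_nat => j /andP[j1 jn].
  have -> : n%:R = j%:R + (n - j)%:R :> K by rewrite -natrD subnKC.
  rewrite scalerDl; congr (_ + _); rewrite -(linZ (Sl _)) IH (linZ (Sl _)) (linsum (Sl _)).
  by congr (_ *: _); apply: eq_bigr => i _; rewrite (linZ (Sl _)) Sc.
rewrite big_split /= -scaler_sumr exchange_big_triangle.
rewrite -[p.+2]add1n natrD scalerDl scale1r; congr (_ + _ *: _).
apply: eq_big_nat => i /andP[i1 ni]; rewrite (linsum (Sl _)) scaler_sumr.
by apply: eq_bigr => j _; rewrite subnAC.
Qed.

Lemma series_exp_linear n : linear (series_exp S n).
Proof.
move=> c u v; rewrite /series_exp scaler_sumr -big_split /=; apply: eq_bigr => p _.
by rewrite (series_pow_linear p n) scalerDr !scalerA mulrC.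
Qed.

(** $S^p$ has no terms of degree below $p$, so one truncation bound serves for all coefficients up
    to it. *)
Lemma series_expE n B v : (n <= B)%N ->
  series_exp S n v = \sum_(p < B.+1) (p`!%:R)^-1 *: series_pow S p n v.
Proof.
move=> nB; rewrite /series_exp (big_ord_widen B.+1 (fun p => (p`!%:R)^-1 *: series_pow S p n v))//.
rewrite big_mkcond; apply: eq_bigr => p _; case: ltnP => // np.
by rewrite series_pow_gt ?scaler0.
Qed.

Lemma series_exp_rec n v : n%:R *: series_exp S n v =
  \sum_(1 <= j < n.+1) j%:R *: S j (series_exp S (n - j) v).
Proof.
rewrite (@series_expE n n.+1)// big_ord_recl scalerDr.
have -> : n%:R *: ((0`!%:R)^-1 *: series_pow S 0 n v) = 0.
  by rewrite /=; case: eqP => [->|_]; rewrite ?scale0r ?scaler0.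
rewrite add0r scaler_sumr.
transitivity (\sum_(i < n.+1) \sum_(1 <= j < n.+1) (i`!%:R)^-1 *: (j%:R *: S j (series_pow S i (n - j) v))).
  apply: eq_bigr => i _; rewrite lift0 scalerA mulrC -scalerA series_pow_rec.
  rewrite scalerA -scaler_sumr; congr (_ *: _); rewrite factS natrM.
  have : i.+1%:R != 0 :> K by rewrite pnatr_eq0.
  have : i`!%:R != 0 :> K by rewrite pnatr_eq0 -lt0n fact_gt0.
  by move=> f1; rewrite -add1n natrD => f2; field; apply/andP.
rewrite exchange_big /=; apply: eq_big_nat => j /andP[j1 jn].
rewrite (@series_expE (n - j) n) ?leq_subr// (linsum (Sl _)) scaler_sumr.
by apply: eq_bigr => i _; rewrite (linZ (Sl _)) !scalerA mulrC.
Qed.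

Definition int_coef (E : nat -> M -> M) (q : int) (v : M) : M :=
  if q is Posz n then E n v else 0.
Definition exp_modes (j : int) (v : M) : M :=
  if j is Posz n.+1 then n.+1%:R *: S n.+1 v else 0.

Lemma series_exp_exs : exp_series exp_modes (int_coef (series_exp S)).
Proof.
split.
- case=> [[|n]|n] c u v /=; try by rewrite scaler0 addr0.
  by rewrite Sl scalerDr !scalerA mulrC.
- by case=> [n|n] c u v /=; [rewrite series_exp_linear|rewrite scaler0 addr0].
- by case=> [[|n]|n].
- by case.
- by move=> v; rewrite /= /series_exp big_ord1 /= fact0 invr1 scale1r.
case=> [n|n] v; last first.
  by rewrite /= scaler0 fsum0// => -[[|j]|j] //=; rewrite (lin0 (Sl _)) scaler0.
rewrite [LHS]series_exp_rec (@fsumE _ _ _ (map Posz (index_iota 1 n.+1))).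
- rewrite big_map; apply: eq_big_nat => j /andP[j1 jn].
  by case: j j1 jn => // j _ jn; rewrite subzn.
- by rewrite map_inj_uniq ?iota_uniq// => i j [].
case=> [[|j]|j] /=; rewrite ?eqxx//.
have [jn _|jn] := leqP j.+1 n; first by rewrite map_f// mem_index_iota.
suff -> : int_coef (series_exp S) (n%:Z - j.+1%:Z) v = 0.
  by rewrite (lin0 (Sl _)) scaler0 eqxx.
by case E: (n%:Z - j.+1%:Z) => [k|k] //; lia.
Qed.

End SeriesExp.

(** * Vertex operators on the Fock module *)

Section Fock.
Variables (R : realType).
Local Notation C := R[i].
Variables (G : vectType C) (form : {biscalar G}) (h : {vspace G}).
Local Notation H := (subvs_of h).
Local Notation "<< a , b >>" := (hform form a b).
Variables (M : lmodType C) (F : heisenberg_ops h M).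
Hypothesis HF : level_one_fock form F.
Hypothesis form_sym : forall a b : H, <<a, b>> = <<b, a>>.

Definition plus_modes (a : H) (j : int) (v : M) : M := if 0 < j then osc F a j v else 0.
Definition minus_modes (a : H) (j : int) (v : M) : M := if 0 < j then - osc F a (- j) v else 0.
Definition Ep (a : H) : int -> M -> M := int_coef (Eplus F a).
Definition Em (a : H) : int -> M -> M := int_coef (Eminus F a).

Lemma osc_comm0 a b m n v : m + n != 0 ->
  osc F a m (osc F b n v) = osc F b n (osc F a m v).
Proof.
move=> mn; apply/eqP; rewrite -subr_eq0 (osc_comm HF) (negPf mn); exact/eqP.
Qed.

Lemma osc_commE a b m n v : osc F a m (osc F b n v) =
  osc F b n (osc F a m v) + if m + n == 0 then (m%:~R * <<a, b>>) *: v else 0.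
Proof. by rewrite -(osc_comm HF) addrC subrK. Qed.

Lemma hform0r (a : H) : <<a, 0>> = 0.
Proof. by rewrite /hform linear0. Qed.
Lemma hformNr (a b : H) : <<a, - b>> = - <<a, b>>.
Proof. by rewrite /hform !linearN. Qed.
Lemma hformNl (a b : H) : << - a, b>> = - <<a, b>>.
Proof. by rewrite /hform linearN linearNl. Qed.

Lemma osc_scale_lin (c : C) a n : linear (fun v => c *: osc F a n v).
Proof. by move=> d u v; rewrite linearP scalerDr !scalerA mulrC. Qed.

Lemma Ep_exs a : exp_series (plus_modes a) (Ep a).
Proof.
have -> : plus_modes a = exp_modes (fun j v => j%:R^-1 *: osc F a j%:Z v).
  apply/funext => -[[|j]|j]; apply/funext => v //=.
  by rewrite /plus_modes /= scalerA mulfV ?scale1r// pnatr_eq0.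
apply: series_exp_exs => [j|i j v]; first exact: osc_scale_lin.
rewrite !linearZ /= !scalerA mulrC; congr (_ *: _).
have [->//|] := eqVneq i j; move=> ij.
have [i0|i0] := eqVneq (i%:Z + j%:Z) 0; last exact: osc_comm0.
by exfalso; lia.
Qed.

Lemma Em_exs a : exp_series (minus_modes a) (Em a).
Proof.
have -> : minus_modes a = exp_modes (fun j v => - (j%:R^-1 *: osc F a (- j%:Z) v)).
  apply/funext => -[[|j]|j]; apply/funext => v //=.
  by rewrite /minus_modes /= scalerN scalerA mulfV ?scale1r// pnatr_eq0.
apply: series_exp_exs => [j|i j v].
  by move=> d u v; rewrite linearP scalerDr !scalerA mulrC -scalerA opprD scalerN.
rewrite !linearN !linearZ /= !scalerN !opprK !scalerA mulrC; congr (_ *: _).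
have [->//|] := eqVneq i j; move=> ij.
have [i0|i0] := eqVneq (- i%:Z - j%:Z) 0; last exact: osc_comm0.
by exfalso; lia.
Qed.

Lemma Ep_lin a q : linear (Ep a q). Proof. exact: exs_E_lin (Ep_exs a) q. Qed.
Lemma Em_lin a q : linear (Em a q). Proof. exact: exs_E_lin (Em_exs a) q. Qed.
Lemma Ep_neg a q v : q < 0 -> Ep a q v = 0. Proof. exact: exs_E_neg (Ep_exs a) _ _. Qed.
Lemma Em_neg a q v : q < 0 -> Em a q v = 0. Proof. exact: exs_E_neg (Em_exs a) _ _. Qed.

Lemma osc_Ep_nneg b a q n v : 0 <= n -> osc F b n (Ep a q v) = Ep a q (osc F b n v).
Proof.
move=> n0; apply: (exs_comm (Ep_exs a)) => [|j w j0]; first exact: linearP.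
by rewrite /plus_modes j0 osc_comm0//; lia.
Qed.

Lemma osc_Em_npos b a q n v : n <= 0 -> osc F b n (Em a q v) = Em a q (osc F b n v).
Proof.
move=> n0; apply: (exs_comm (Em_exs a)) => [|j w j0]; first exact: linearP.
by rewrite /minus_modes j0 linearN osc_comm0//; lia.
Qed.

Lemma osc_Ep_neg b a q n v : n < 0 ->
  osc F b n (Ep a q v) = Ep a q (osc F b n v) - <<b, a>> *: Ep a (q + n) v.
Proof.
move=> n0; rewrite (@exs_derivation _ _ _ _ (Ep_exs a) _ (- n) (n%:~R * <<b, a>>)).
- rewrite opprK rmorphN /= invrN mulrN scaleNr.
  by rewrite mulrAC mulfV ?mul1r// intr_eq0; lia.
- exact: linearP.
- by lia.
move=> j w j0; rewrite /plus_modes j0.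
by rewrite osc_commE; have -> : (n + j == 0) = (j == - n) by lia.
Qed.

Lemma osc_Em_pos b a q n v : 0 < n ->
  osc F b n (Em a q v) = Em a q (osc F b n v) - <<b, a>> *: Em a (q - n) v.
Proof.
move=> n0; rewrite (@exs_derivation _ _ _ _ (Em_exs a) _ n (- (n%:~R * <<b, a>>))).
- by rewrite -[RHS]/(_ - _) mulNr scaleNr mulrAC mulfV ?mul1r// intr_eq0; lia.
- exact: linearP.
- by lia.
move=> j w j0; rewrite /minus_modes j0 linearN [in LHS]osc_commE opprD; congr (_ + _).
have -> : (n - j == 0) = (j == n) by lia.
by case: eqP => _; rewrite ?scaleNr ?oppr0.
Qed.

Lemma osc_EmEp b a n p q v :
  osc F b n (Em a p (Ep a q v)) = Em a p (Ep a q (osc F b n v))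
   - (if 0 < n then <<b, a>> *: Em a (p - n) (Ep a q v) else 0)
   - (if n < 0 then <<b, a>> *: Em a p (Ep a (q + n) v) else 0).
Proof.
case: (ltgtP n 0) => [n0|n0|->]; rewrite ?subr0.
- rewrite osc_Em_npos ?(ltW n0)// osc_Ep_neg// (linB (Em_lin _ _)).
  by rewrite (linZ (Em_lin _ _)).
- by rewrite osc_Em_pos// osc_Ep_nneg// ltW.
- by rewrite osc_Em_npos// osc_Ep_nneg.
Qed.

(** The vacuum is killed by the positive coefficients of $E^+$. The property spreads to the whole
    module: annihilation modes commute with $E^+$, a creation mode of degree $n<0$ moves the bound
    by $-n$, and [deg] only rescales coefficients. *)
Lemma Ep_restricted a v : exists B : int, forall q, B < q -> Ep a q v = 0.
Proof.
apply: (vac_generates HF (P := fun v => exists B : int, forall q, B < q -> Ep a q v = 0)).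
- exists 0 => q q0; have qn0 : q != 0 by lia.
  apply: (exs_cancel (K := C) _ qn0); rewrite scaler0 (exs_rec (Ep_exs a)) fsum0// => j.
  rewrite /plus_modes; case: ifP => // j0.
  by rewrite osc_Ep_nneg ?(ltW j0)// (osc_vac HF) ?(ltW j0)// (lin0 (Ep_lin _ _)).
- move=> c u w [Bu Hu] [Bw Hw]; exists (Num.max Bu Bw) => q; rewrite gt_max => /andP[qu qw].
  by rewrite Ep_lin Hu// Hw// scaler0 addr0.
- move=> b n w [B HB]; have [n0|n0] := leP 0 n.
    by exists B => q qB; rewrite -osc_Ep_nneg// HB// linear0.
  exists (B - n) => q qB; have := osc_Ep_neg b a q w n0.
  have -> : Ep a q w = 0 by apply: HB; lia.
  have -> : Ep a (q + n) w = 0 by apply: HB; lia.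
  by rewrite linear0 scaler0 subr0.
- move=> w [B HB]; exists B => q qB.
  have := exs_grading (L := deg F) (s := 1) (Ep_exs a) (linearP _) _ q w.
  rewrite HB// linear0 scaler0 addr0 => <- // j u j0.
  rewrite /plus_modes j0 mul1r -(deg_osc HF); by rewrite addrC subrK.
Qed.

Lemma osc_restricted a v : exists B : int, forall n, B < n -> osc F a n v = 0.
Proof.
apply: (vac_generates HF (P := fun v => exists B : int, forall n, B < n -> osc F a n v = 0)).
- by exists 0 => n n0; rewrite (osc_vac HF)// ltW.
- move=> c u w [Bu Hu] [Bw Hw]; exists (Num.max Bu Bw) => q; rewrite gt_max => /andP[qu qw].
  by rewrite linearP Hu// Hw// scaler0 addr0.
- move=> b n w [B HB]; exists (Num.max B (- n)) => q; rewrite gt_max => /andP[qu qw].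
  by rewrite osc_comm0 ?HB ?linear0//; lia.
- move=> w [B HB]; exists B => q qB; have := deg_osc HF a q w.
  by rewrite HB// linear0 scaler0 sub0r => /eqP; rewrite oppr_eq0 => /eqP.
Qed.

Lemma deg_Ep a q v : deg F (Ep a q v) = Ep a q (deg F v) + q%:~R *: Ep a q v.
Proof.
rewrite (exs_grading (L := deg F) (s := 1) (Ep_exs a)) ?mul1r//; first exact: linearP.
by move=> j u j0; rewrite /plus_modes j0 mul1r -(deg_osc HF) addrC subrK.
Qed.

Lemma deg_Em a q v : deg F (Em a q v) = Em a q (deg F v) - q%:~R *: Em a q v.
Proof.
rewrite (exs_grading (L := deg F) (s := -1) (Em_exs a)) ?mulN1r ?scaleNr//; first exact: linearP.
move=> j u j0; rewrite /minus_modes j0 mulN1r scalerN scaleNr opprK linearN.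
have := deg_osc HF a (- j) u; rewrite rmorphN /= scaleNr => /eqP.
by rewrite subr_eq => /eqP ->; rewrite opprD opprK addrC.
Qed.

Lemma Em_Em a b p q v : Em a p (Em b q v) = Em b q (Em a p v).
Proof.
apply: (exs_comm (Em_exs b)) => [|j w j0]; first exact: Em_lin.
by rewrite /minus_modes j0 (linN (Em_lin _ _)) osc_Em_npos//; lia.
Qed.

Lemma Ep_Ep a b p q v : Ep a p (Ep b q v) = Ep b q (Ep a p v).
Proof.
apply: (exs_comm (Ep_exs b)) => [|j w j0]; first exact: Ep_lin.
by rewrite /plus_modes j0 osc_Ep_nneg//; lia.
Qed.

(** The index of [Em] counts negative powers of its variable $w$, so the factor $(1-zw)^m$ of
    [exs_exchange] becomes $(1-z/w)^{\langle a,b\rangle}$. *)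
Lemma Ep_Em a b q p v : Ep a q (Em b p v) =
  fsum (fun k => int_binom <<a, b>> k *: Em b (p - k) (Ep a (q - k) v)).
Proof.
apply: (exs_exchange (Ep_exs a) (Em_exs b)) => [i j w|i j w i0 j0].
  rewrite /plus_modes; case: ifP => i0; case: ifP => j0; rewrite ?linear0//.
  by rewrite osc_comm0//; lia.
rewrite /plus_modes /minus_modes i0 j0 linearN [in LHS]osc_commE opprD; congr (_ + _).
have -> : (i - j == 0) = (j == i) by lia.
by case: eqP => _; rewrite ?oppr0// scaleNr mulrC.
Qed.

Lemma plus_modesD a b : (fun j v => plus_modes a j v + plus_modes b j v) = plus_modes (a + b).
Proof.
apply/funext => j; apply/funext => v; rewrite /plus_modes; case: ifP => _; rewrite ?addr0//.
by have := osc_linear HF 1 a b j v; rewrite !scale1r.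
Qed.

Lemma minus_modesD a b : (fun j v => minus_modes a j v + minus_modes b j v) = minus_modes (a + b).
Proof.
apply/funext => j; apply/funext => v; rewrite /minus_modes; case: ifP => _; rewrite ?addr0//.
by have := osc_linear HF 1 a b (- j) v; rewrite !scale1r => ->; rewrite opprD.
Qed.

Lemma plus_modes_comm a b i j v :
  plus_modes a i (plus_modes b j v) = plus_modes b j (plus_modes a i v).
Proof.
rewrite /plus_modes; case: ifP => i0; case: ifP => j0; rewrite ?linear0//.
by rewrite osc_comm0//; lia.
Qed.

Lemma minus_modes_comm a b i j v :
  minus_modes a i (minus_modes b j v) = minus_modes b j (minus_modes a i v).
Proof.
rewrite /minus_modes; case: ifP => i0; case: ifP => j0; rewrite ?linear0 ?oppr0//.
by rewrite !linearN osc_comm0//; lia.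
Qed.

Lemma Ep_mul a b n v : exs_mul (Ep a) (Ep b) n v = Ep (a + b) n v.
Proof.
have := exs_mul_exp (Ep_exs a) (Ep_exs b) (plus_modes_comm a b).
by rewrite plus_modesD => /exs_unique; apply; apply: Ep_exs.
Qed.

Lemma Em_mul a b n v : exs_mul (Em a) (Em b) n v = Em (a + b) n v.
Proof.
have := exs_mul_exp (Em_exs a) (Em_exs b) (minus_modes_comm a b).
by rewrite minus_modesD => /exs_unique; apply; apply: Em_exs.
Qed.

Lemma osc0 n v : osc F 0 n v = 0.
Proof. by have := osc_linear HF (-1) 0 0 n v; rewrite scaler0 addr0 scaleN1r addNr. Qed.

Lemma Ep0 n v : Ep 0 n v = if n == 0 then v else 0.
Proof.
apply: (exs_unique (Ep_exs 0) (E' := fun q v => if q == 0 then v else 0)).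
suff -> : plus_modes 0 = (fun _ _ => 0) by apply: exs_const.
by apply/funext => j; apply/funext => w; rewrite /plus_modes osc0; case: ifP.
Qed.

Lemma Em0 n v : Em 0 n v = if n == 0 then v else 0.
Proof.
apply: (exs_unique (Em_exs 0) (E' := fun q v => if q == 0 then v else 0)).
suff -> : minus_modes 0 = (fun _ _ => 0) by apply: exs_const.
by apply/funext => j; apply/funext => w; rewrite /minus_modes osc0 oppr0; case: ifP.
Qed.

(** With $b=-a$ the product of the exponentials is 1, so the derivative of the left factor leaves
    its positive modes. These are the positive modes of $\alpha(\zeta)$ in the commutator of
    opposite roots. *)
Lemma Ep_mul_deriv a b n v : a + b = 0 ->
  fsum (fun i => i%:~R *: Ep a i (Ep b (n - i) v)) = plus_modes a n v.
Proof.
move=> ab; rewrite (exs_mul_deriv (Ep_exs a) (Ep_exs b)).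
rewrite (@fsum1 _ _ n) => [|j jn]; rewrite Ep_mul ab Ep0 ?subrr ?eqxx//.
have -> : (n - j == 0) = false by lia.
by rewrite /plus_modes linear0; case: ifP.
Qed.

Lemma Em_mul_deriv a b n v : a + b = 0 ->
  fsum (fun i => i%:~R *: Em a i (Em b (n - i) v)) = minus_modes a n v.
Proof.
move=> ab; rewrite (exs_mul_deriv (Em_exs a) (Em_exs b)).
rewrite (@fsum1 _ _ n) => [|j jn]; rewrite Em_mul ab Em0 ?subrr ?eqxx//.
have -> : (n - j == 0) = false by lia.
by rewrite /minus_modes linear0 oppr0; case: ifP.
Qed.

End Fock.

Section FSumComp.
Variables (K : fieldType) (T : lmodType K) (I J : choiceType).
Variables (Phi : I -> T -> T) (psi : J -> T).
Hypotheses (Pl : forall i, linear (Phi i)) (Ps : forall u, fsupp (fun i => Phi i u)).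
Hypothesis ps : fsupp psi.
Lemma fsupp_comp : fsupp (fun x : J * I => Phi x.2 (psi x.1)).
Proof.
have [s us sE] := fsupp_seq ps; apply: (@fsupp_dep _ _ _ _ s) => [j i|j] /=; last exact: Ps.
by move=> H; apply: sE; apply: contra_neq H => ->; rewrite (lin0 (Pl i)).
Qed.
Lemma fsum_comp : fsum (fun i => Phi i (fsum psi)) = fsum (fun x : J * I => Phi x.2 (psi x.1)).
Proof.
rewrite (fsum_pair fsupp_comp) (fsum_exchange fsupp_comp); apply: eq_fsum => i.
exact: (linfsum (Pl i)).
Qed.
Lemma fsum_comp_linear : linear (fun u => fsum (fun i => Phi i u)).
Proof.
move=> c u v; rewrite fsumZ// -fsumD//; last exact: fsuppZ.
by apply: eq_fsum => i; rewrite Pl.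
Qed.
End FSumComp.

(** * Commutation relations of the operators on $M(1)\otimes W$ *)

Section Vertex.
Variables (R : realType) (N : nat).
Local Notation C := R[i].
Variables (G : vectType C) (br : {bilinear G -> G -> G}) (form : {biscalar G}).
Variables (h : {vspace G}) (x : subvs_of h -> G).
Variable eps : subvs_of h -> subvs_of h -> C.
Local Notation H := (subvs_of h).
Local Notation "<< a , b >>" := (hform form a b).
Local Notation root := (is_root br form).
Local Notation Zr := 'rV[int]_N.
Variables (W : lmodType C) (A : Z1_ops N h W).
Hypothesis HZ : Z1_module br form x eps A.
Variables (M : lmodType C) (F : heisenberg_ops h M).
Hypothesis HF : level_one_fock form F.
Hypothesis form_sym : forall a b : H, <<a, b>> = <<b, a>>.
Variables (T : lmodType C) (tens : M -> W -> T).
Hypothesis HT : tensor_like tens.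
Local Notation tens0l := (tens0l HT).
Local Notation tens0r := (tens0r HT).
Local Notation tensDl := (tensDl HT).
Local Notation tensDr := (tensDr HT).
Local Notation tensBl := (tensBl HT).
Local Notation tensBr := (tensBr HT).
Local Notation tensZl := (tensZl HT).
Local Notation tensZr := (tensZr HT).
Local Notation tmap := (tmap HT).
Local Notation eq_tensor := (eq_tensor HT).
Local Notation fsupp_tensorP := (fsupp_tensorP HT).
Local Notation trestrictedP := (trestrictedP HT).
Local Notation Ep := (Ep F).
Local Notation Em := (Em F).

Lemma EE_lin a q p : linear (fun m => Em a p (Ep a q m)).
Proof. by move=> c u v; rewrite (Ep_lin HF) (Em_lin HF). Qed.
Definition EE a q p : {linear M -> M} := mklin (EE_lin a q p).

(* The contribution of zeta^(-p) in E^- and zeta^q in E^+ to the coefficient of zeta^n in x_al(r, zeta). *)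
Definition vterm (al : H) (r : Zr) (n : int) (qp : int * int) (v : T) : T :=
  tmap (EE (- al) qp.1 qp.2) (Zop A al r (n + qp.2 - qp.1)) v.
Lemma vterm_lin al r n qp : linear (vterm al r n qp).
Proof. exact: linearP. Qed.
(** The sum runs over pairs of integers rather than naturals; negative indices contribute 0, and
    index shifts become bijections. *)
Definition vop al r n (v : T) : T := fsum (fun qp => vterm al r n qp v).

Lemma vtermE al r n q p m w : vterm al r n (q, p) (tens m w) =
  tens (Em (- al) p (Ep (- al) q m)) (Zop A al r (n + p - q) w).
Proof. exact: tmapE. Qed.

Lemma Ep_supp a m : exists B : int, forall q, Ep a q m != 0 -> 0 <= q /\ q <= B.
Proof.
have [B HB] := Ep_restricted HF a m; exists B => k; split.
  by rewrite leNgt; apply: contra_neqN H => k0; rewrite (Ep_neg HF).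
by rewrite leNgt; apply: contra_neqN H => k0; rewrite HB.
Qed.

Lemma vterm_supp al r n v : root al -> fsupp (fun qp => vterm al r n qp v).
Proof.
move=> ra; move: v; apply: fsupp_tensorP => [i|m w]; first exact: vterm_lin.
have [B HB] := Ep_supp (- al) m; have [n0 Hn] := Z1_restrictedZ HZ r ra w.
apply: (@fsupp_int_dep _ _ _ 0 B) => [q p|q]; first rewrite vtermE.
  move=> H; apply: HB; apply: contra_neq H => ->.
  by rewrite (lin0 (Em_lin HF _ _)) tens0l.
apply: (@fsupp_int _ _ 0 (n0 - n + q)) => p; rewrite vtermE => H.
have [p0|p0] := ltP p 0; first by rewrite (Em_neg HF)// tens0l eqxx in H.
split=> //; rewrite leNgt; apply: contra_neqN H => H.
by rewrite Hn ?tens0r//; lia.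
Qed.

Lemma vop_lin al r n : root al -> linear (vop al r n).
Proof. by move=> ra; apply: fsum_comp_linear => [i|u]; [exact: vterm_lin|exact: vterm_supp]. Qed.

Lemma vop_restricted al r : root al -> trestricted (vop al r).
Proof.
move=> ra; apply: trestrictedP => [n|m w]; first exact: vop_lin.
have [B HB] := Ep_supp (- al) m; have [n0 Hn] := Z1_restrictedZ HZ r ra w.
exists (n0 + B) => n nB; apply: fsum0 => -[q p]; rewrite vtermE.
have [->|/HB[q0 qB]] := eqVneq (Ep (- al) q m) 0.
  by rewrite (lin0 (Em_lin HF _ _)) tens0l.
have [p0|p0] := ltP p 0; first by rewrite (Em_neg HF)// tens0l.
by rewrite Hn ?tens0r//; lia.
Qed.

Definition kT i r n (v : T) : T := tmap (idlin M) (kop A i r n) v.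
Definition oT (be : H) (i : int) (v : T) : T :=
  if i == 0 then tmap (idlin M) (hop A be) v else tmap (osc F be i) (idlin W) v.
Definition d0T (v : T) : T := tmap (deg F) (idlin W) v + tmap (idlin M) (dop A ord0) v.
Definition dT (i : 'I_N) (v : T) : T := tmap (idlin M) (dop A (lift ord0 i)) v.
Definition hterm be r n i v := oT be i (kT ord0 r (n - i) v).
Definition hopT be r n (v : T) : T := fsum (fun i => hterm be r n i v).

Lemma kT_lin i r n : linear (kT i r n). Proof. exact: linearP. Qed.
Lemma oT_lin be i : linear (oT be i).
Proof. by rewrite /oT; case: eqP => _ c u v; rewrite linearP. Qed.
Lemma dT_lin i : linear (dT i). Proof. exact: linearP. Qed.
Lemma kTE i r n m w : kT i r n (tens m w) = tens m (kop A i r n w).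
Proof. exact: tmapE. Qed.
Lemma oT0E be m w : oT be 0 (tens m w) = tens m (hop A be w).
Proof. by rewrite /oT eqxx tmapE. Qed.
Lemma oTE be i m w : i != 0 -> oT be i (tens m w) = tens (osc F be i m) w.
Proof. by move=> /negPf i0; rewrite /oT i0 tmapE. Qed.
Lemma d0TE m w : d0T (tens m w) = tens (deg F m) w + tens m (dop A ord0 w).
Proof. by rewrite /d0T !tmapE. Qed.
Lemma dTE i m w : dT i (tens m w) = tens m (dop A (lift ord0 i) w).
Proof. exact: tmapE. Qed.

Lemma d0T_lin : linear d0T.
Proof. by move=> c u v; rewrite /d0T !linearP scalerDr !addrA; congr (_ + _); rewrite addrAC. Qed.

Lemma scale_linP (U : lmodType C) c d (a b : U) : d *: (c *: a + b) = c *: (d *: a) + d *: b.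
Proof. by rewrite scalerDr !scalerA mulrC. Qed.
Lemma lin_addP (U : lmodType C) c (a a' b b' : U) :
  c *: a + b + (c *: a' + b') = c *: (a + a') + (b + b').
Proof. by rewrite scalerDr !addrA; congr (_ + _); rewrite addrAC. Qed.

(** Discharges the linearity of both sides when an identity is checked on pure tensors only. *)
Ltac tlin L := move=> ? ? ?; rewrite ?(kT_lin, oT_lin, dT_lin, d0T_lin, L) ?scale_linP; first [done | exact: lin_addP].

Lemma kT_restricted i r : trestricted (kT i r).
Proof.
apply: trestrictedP => [n|m w]; first exact: kT_lin.
have [n0 Hn] := Z1_restrictedk HZ i r w; exists n0 => n nn.
by rewrite kTE Hn ?tens0r.
Qed.

Lemma oT_restricted be : trestricted (oT be).
Proof.
apply: trestrictedP => [n|m w]; first exact: oT_lin.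
have [n0 Hn] := osc_restricted HF be m; exists (Num.max n0 0) => n.
rewrite gt_max => /andP[nn n1]; rewrite oTE ?Hn ?tens0l//; lia.
Qed.

Lemma comm_opsP (U : zmodType) (a b : U) : a - b = 0 -> a = b.
Proof. by move=> /eqP; rewrite subr_eq0 => /eqP. Qed.

Lemma kkT i j r s m n v : kT i r m (kT j s n v) = kT j s n (kT i r m v).
Proof.
move: v; apply: eq_tensor; [tlin d0T_lin..|move=> u w].
by rewrite !kTE (comm_opsP (Z1_kk HZ i j r s m n w)).
Qed.

Lemma koT i r n be j v : kT i r n (oT be j v) = oT be j (kT i r n v).
Proof.
move: v; apply: eq_tensor; [tlin d0T_lin..|move=> u w].
have [->|j0] := eqVneq j 0; last by rewrite kTE !oTE// kTE.
by rewrite !oT0E !kTE oT0E (comm_opsP (Z1_kh HZ i r n be w)).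
Qed.

Lemma kvT i r n al s m v : root al -> kT i r n (vop al s m v) = vop al s m (kT i r n v).
Proof.
move=> ra; move: v; apply: eq_tensor; [tlin (vop_lin s m ra)..|].
move=> u w; rewrite /vop (linfsum (kT_lin i r n)); last exact: vterm_supp.
apply: eq_fsum => -[q p]; rewrite kTE !vtermE kTE.
by rewrite (comm_opsP (Z1_kZ HZ _ _ _ _ _ _ ra)).
Qed.

Lemma hterm_supp be r n v : fsupp (fun i => hterm be r n i v).
Proof.
have [n0 Hn] := kT_restricted ord0 r v; have [n1 Hn1] := oT_restricted be v.
apply: (@fsupp_int _ _ (n - n0) n1) => i H; split; rewrite leNgt; apply: contra_neqN H => H.
  by rewrite /hterm Hn ?(lin0 (oT_lin _ _))//; lia.
by rewrite /hterm -koT Hn1 ?(lin0 (kT_lin _ _ _)).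
Qed.

Lemma hterm_lin be r n i : linear (hterm be r n i).
Proof. by move=> c u v; rewrite /hterm kT_lin oT_lin. Qed.

Lemma hopT_lin be r n : linear (hopT be r n).
Proof. by apply: fsum_comp_linear => [i|u]; [exact: hterm_lin|exact: hterm_supp]. Qed.

Lemma khT i r n be s m v : kT i r n (hopT be s m v) = hopT be s m (kT i r n v).
Proof.
rewrite /hopT (linfsum (kT_lin i r n)); last exact: hterm_supp.
by apply: eq_fsum => j; rewrite /hterm koT kkT.
Qed.

Lemma kT_mul i r s n v : fsum (fun j => kT ord0 r (n - j) (kT i s j v)) = kT i (r + s) n v.
Proof.
have sup u : fsupp (fun j => kT ord0 r (n - j) (kT i s j u)).
  have [n0 Hn] := kT_restricted ord0 r u; have [n1 Hn1] := kT_restricted i s u.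
  apply: (@fsupp_int _ _ (n - n0) n1) => j H; split; rewrite leNgt; apply: contra_neqN H => H.
    by rewrite kkT Hn ?(lin0 (kT_lin _ _ _))//; lia.
  by rewrite Hn1 ?(lin0 (kT_lin _ _ _)).
move: v; apply: eq_tensor.
- by apply: fsum_comp_linear => // j; tlin d0T_lin.
- exact: kT_lin.
move=> m w; rewrite kTE -(Z1_k0k HZ) /series_mul.
have [n0 Hn] := Z1_restrictedk HZ ord0 r w; have [n1 Hn1] := Z1_restrictedk HZ i s w.
rewrite -/(fsum _) (linfsum (tlike_r HT m)).
  by apply: eq_fsum => j; rewrite !kTE.
apply: (@fsupp_int _ _ (n - n0) n1) => j H; split; rewrite leNgt; apply: contra_neqN H => H.
  by rewrite (comm_opsP (Z1_kk HZ ord0 i r s (n - j) j w)) Hn ?linear0//; lia.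
by rewrite Hn1 ?linear0.
Qed.

Lemma kT_D (r : Zr) n v :
  \sum_(i < N) (r 0 i)%:~R *: kT (lift ord0 i) r n v = (- n%:~R) *: kT ord0 r n v.
Proof.
move: v; apply: eq_tensor.
- move=> c u v; rewrite scaler_sumr -big_split; apply: eq_bigr => i _ /=.
  by rewrite kT_lin scalerDr !scalerA mulrC.
- tlin d0T_lin.
move=> m w; have := Z1_Dk HZ r n w => /eqP; rewrite addr_eq0 => /eqP E.
rewrite kTE -tensZr scaleNr -E (linsum (tlike_r HT m)).
by apply: eq_bigr => i _; rewrite kTE tensZr.
Qed.

Lemma vop_mul al r s n v : root al ->
  fsum (fun j => vop al r (n - j) (kT ord0 s j v)) = vop al (r + s) n v.
Proof.
move=> ra; have sup u : fsupp (fun j => vop al r (n - j) (kT ord0 s j u)).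
  have [n0 Hn] := vop_restricted r ra u; have [n1 Hn1] := kT_restricted ord0 s u.
  apply: (@fsupp_int _ _ (n - n0) n1) => j H; split; rewrite leNgt; apply: contra_neqN H => H.
    by rewrite -kvT// Hn ?(lin0 (kT_lin _ _ _))//; lia.
  by rewrite Hn1 ?(lin0 (vop_lin _ _ _)).
move: v; apply: eq_tensor.
- apply: fsum_comp_linear => // j; tlin (vop_lin r (n - j) ra).
- exact: vop_lin.
move=> m w; pose Fn (y : (int * int) * int) := vterm al r (n - y.2) y.1 (kT ord0 s y.2 (tens m w)).
have [B HB] := Ep_supp (- al) m; have [n0 Hn] := Z1_restrictedZ HZ r ra w.
have [n1 Hn1] := Z1_restrictedk HZ ord0 s w.
have zk i j : Zop A al r i (kop A ord0 s j w) = kop A ord0 s j (Zop A al r i w).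
  by rewrite (comm_opsP (Z1_kZ HZ _ _ _ _ _ _ ra)).
(* Since $k_0$ commutes with $Z$, either factor may be applied to [w] first; this bounds the inner
   index on both sides. *)
have sZ a : fsupp (fun j => Zop A al r (a - j) (kop A ord0 s j w)).
  apply: (@fsupp_int _ _ (a - n0) n1) => j H; split; rewrite leNgt; apply: contra_neqN H => H.
    by rewrite zk Hn ?linear0//; lia.
  by rewrite Hn1 ?linear0.
have sF : fsupp Fn.
  have key q p j : Fn (q, p, j) != 0 -> [/\ 0 <= q <= B, 0 <= p, j <= n1 & n - j + p - q <= n0].
    rewrite /Fn /= kTE vtermE => H0; split.
    - have [] // := HB q; last by move=> -> ->.
      by apply: contra_neq H0 => ->; rewrite (lin0 (Em_lin HF _ _)) tens0l.
    - by rewrite leNgt; apply: contra_neqN H0 => p0; rewrite (Em_neg HF)// tens0l.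
    - by rewrite leNgt; apply: contra_neqN H0 => j1; rewrite Hn1// linear0 tens0r.
    - by rewrite leNgt; apply: contra_neqN H0 => j1; rewrite zk Hn// linear0 tens0r.
  apply: (@fsupp_dep _ _ _ _ (allpairs pair (int_range 0 B) (int_range 0 (n0 + n1 - n + B)))).
    move=> [q p] j /key[/andP[q0 qB] p0 j1 jn]; apply/allpairsP; exists (q, p); split => //=.
      exact: mem_int_range.
    by apply: mem_int_range => //; lia.
  move=> [q p]; apply: (@fsupp_int _ _ (n - q + p - n0) n1) => j /key[_ _ j1 j2]; split=> //; lia.
transitivity (fsum (fun j => fsum (fun qp => Fn (qp, j)))); first by [].
rewrite -fsum_exchange//; apply: eq_fsum => -[q p].
rewrite vtermE -(Z1_Zk0 HZ)// /series_mul -/(fsum _) (linfsum (tlike_r HT _)) //.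
apply: eq_fsum => j; rewrite /Fn /= kTE vtermE.
by congr (tens _ (Zop A al r _ _)); lia.
Qed.

(** The mode $\beta\otimes t^i$ meets exactly one factor of the vertex operator: $Z$ if $i=0$, $E^-$
    if $i>0$, $E^+$ if $i<0$. The resulting shift of $p$ or $q$ is compensated by the argument of
    $Z$, so that the three answers agree. *)
Lemma o_vopT be al s b i v : root al ->
  oT be i (vop al s b v) = vop al s b (oT be i v) + <<be, al>> *: vop al s (b + i) v.
Proof.
move=> ra; move: v; apply: eq_tensor.
- tlin (vop_lin s b ra).
- tlin (vop_lin s b ra, vop_lin s (b + i) ra).
move=> m w; rewrite /vop (linfsum (oT_lin be i)); last exact: vterm_supp.
have [i0|i0] := eqVneq i 0.
  rewrite i0 addr0 fsumZ; last exact: vterm_supp.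
  rewrite -fsumD; last 2 first.
  - exact: vterm_supp.
  - by apply: fsuppZ; apply: vterm_supp.
  apply: eq_fsum => -[q p]; rewrite !vtermE !oT0E vtermE -tensZr -tensDr; congr tens.
  by have := Z1_hZ HZ be s (b + p - q) w ra; rewrite /comm_ops => /addr_of_sub.
rewrite oTE// fsumZ; last exact: vterm_supp.
(* The index of $E^-$ is shifted for $i>0$ and that of $E^+$ for $i<0$, following the two cases of
   [osc_EmEp]. *)
pose sh (y : int * int) : int * int := if 0 < i then (y.1, y.2 - i) else (y.1 + i, y.2).
pose sh' (y : int * int) : int * int := if 0 < i then (y.1, y.2 + i) else (y.1 - i, y.2).
have shK : cancel sh sh' by move=> [q p]; rewrite /sh /sh'; case: (0 < i); rewrite /= ?subrK ?addrK.
have shK' : cancel sh' sh by move=> [q p]; rewrite /sh /sh'; case: (0 < i); rewrite /= ?subrK ?addrK.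
rewrite [X in _ = _ + X](fsum_bij _ shK shK') -fsumD; last 2 first.
- exact: vterm_supp.
- by apply: (fsupp_reindex (can_inj shK)); apply: fsuppZ; apply: vterm_supp.
apply: eq_fsum => -[q p]; rewrite vtermE oTE// (osc_EmEp HF) vtermE /comp /sh.
rewrite !tensBl -!addrA; congr (_ + _).
case: (ltgtP i 0) => [i1|i1|/eqP]; last by rewrite (negPf i0).
- rewrite vtermE tens0l oppr0 add0r -(linN (tlike_l HT _)) hformNr scaleNr opprK.
  by rewrite tensZl; congr (_ *: tens _ (Zop A al s _ _)); rewrite /=; lia.
- rewrite vtermE tens0l oppr0 addr0 -(linN (tlike_l HT _)) hformNr scaleNr opprK.
  by rewrite tensZl; congr (_ *: tens _ (Zop A al s _ _)); rewrite /=; lia.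
Qed.

Lemma h_vopT be r a al s b v : root al ->
  hopT be r a (vop al s b v) - vop al s b (hopT be r a v) = <<be, al>> *: vop al (r + s) (a + b) v.
Proof.
move=> ra; rewrite /hopT (linfsum (vop_lin s b ra)); last exact: hterm_supp.
have E i : hterm be r a i (vop al s b v) = vop al s b (hterm be r a i v) +
   <<be, al>> *: vop al s (b + i) (kT ord0 r (a - i) v).
  by rewrite /hterm kvT// o_vopT.
have f1 : fsupp (fun i => vop al s b (hterm be r a i v)).
  by apply: fsupp_linear; [exact: lin0 (vop_lin _ _ _)|exact: hterm_supp].
have f2 : fsupp (fun i => vop al s (b + i) (kT ord0 r (a - i) v)).
  have [n0 Hn] := vop_restricted s ra v; have [n1 Hn1] := kT_restricted ord0 r v.
  apply: (@fsupp_int _ _ (a - n1) (n0 - b)) => j H; split; rewrite leNgt; apply: contra_neqN H => H.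
    by rewrite Hn1 ?(lin0 (vop_lin _ _ _))//; lia.
  by rewrite -kvT// Hn ?(lin0 (kT_lin _ _ _))//; lia.
rewrite (eq_fsum E) fsumD//; last exact: fsuppZ.
rewrite addrC addKr -fsumZ//; congr (_ *: _); rewrite addrC -vop_mul//.
rewrite (@fsum_bij _ _ _ (fun j => a - j) (fun j => a - j)); last 2 first.
- by move=> j; rewrite opprB addrC subrK.
- by move=> j; rewrite opprB addrC subrK.
apply: eq_fsum => j; rewrite /comp.
have -> : a - (a - j) = j by lia.
by have -> : b + (a - j) = a + b - j by lia.
Qed.

Lemma o_oT be ga i j v : oT be i (oT ga j v) = oT ga j (oT be i v) +
  if i + j == 0 then (i%:~R * <<be, ga>>) *: v else 0.
Proof.
move: v; apply: eq_tensor.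
- tlin d0T_lin.
- case: (i + j == 0) => c u v; rewrite !oT_lin ?addr0//.
  by rewrite (scale_linP c (i%:~R * <<be, ga>>) u v) lin_addP.
move=> m w; have [i0|i0] := eqVneq i 0; have [j0|j0] := eqVneq j 0.
- rewrite i0 j0 !oT0E addr0 eqxx mul0r scale0r addr0.
  by rewrite (comm_opsP (Z1_hh HZ be ga w)).
- by rewrite i0 add0r (negPf j0) addr0 (oTE ga _ _ j0) !oT0E (oTE ga _ _ j0).
- by rewrite j0 addr0 (negPf i0) addr0 (oTE be _ _ i0) !oT0E (oTE be _ _ i0).
by rewrite !oTE// (osc_commE HF) tensDl; case: ifP => _; rewrite ?tensZl ?tens0l.
Qed.

(** Only modes $i$ and $-i$ fail to commute, leaving $\langle\beta,\gamma\rangle\sum_i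
    i\,k_0(r)_{a-i}k_0(s)_{b+i}$. With $i=a-j$ the part $a$ gives $a\,k_0(r+s)$, and the part $-j$
    is $-Dk_0(r)$, which relation (3) turns into $\sum_l r_lk_l$. *)
Lemma h_hT be r a ga s b v :
  hopT be r a (hopT ga s b v) - hopT ga s b (hopT be r a v) =
  <<be, ga>> *: (a%:~R *: kT ord0 (r + s) (a + b) v
                 + \sum_(i < N) (r 0 i)%:~R *: kT (lift ord0 i) (r + s) (a + b) v).
Proof.
have f1 := fsupp_comp (hterm_lin be r a) (hterm_supp be r a) (hterm_supp ga s b v).
have f2 := fsupp_comp (hterm_lin ga s b) (hterm_supp ga s b) (hterm_supp be r a v).
rewrite {1 3}/hopT (fsum_comp (hterm_lin _ _ _) (hterm_supp _ _ _) (hterm_supp _ _ _ _)).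
rewrite (fsum_comp (hterm_lin _ _ _) (hterm_supp _ _ _) (hterm_supp _ _ _ _)).
pose sw (x : int * int) := (x.2, x.1); have swK : cancel sw sw by case.
rewrite [X in _ - X](fsum_bij _ swK swK) -[- fsum _]scaleN1r fsumZ; last first.
  exact: (fsupp_reindex (can_inj swK)).
rewrite -fsumD//; last first.
  by apply: fsuppZ; exact: (fsupp_reindex (can_inj swK)).
pose D (y : int * int) := if y.2 + y.1 == 0 then
  (y.2%:~R * <<be, ga>>) *: kT ord0 r (a - y.2) (kT ord0 s (b - y.1) v) else 0.
have HD j i : hterm be r a i (hterm ga s b j v) + -1 *: hterm ga s b j (hterm be r a i v) = D (j, i).
  rewrite /D /hterm /= !koT o_oT (kkT ord0 ord0 s r (b - j) (a - i) v).
  by rewrite addrAC scaleN1r subrr add0r.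
have fD : fsupp D.
  have := fsuppD f1 (fsuppZ (fun=> -1) (fsupp_reindex (can_inj swK) f2)).
  by apply: eq_fsupp => -[j i]; apply: HD.
transitivity (fsum D); first by apply: eq_fsum => -[j i]; apply: HD.
rewrite (@fsum_reindex _ _ _ (fun i : int => (- i, i))); last 2 first.
- by move=> i j [].
- move=> [j i]; rewrite /D /=; case: (i + j =P 0) => [ij _|_]; last by rewrite eqxx.
  by exists i; congr pair; lia.
have sK i (r1 r2 : Zr) n : fsupp (fun j => kT ord0 r1 (n - j) (kT i r2 j v)).
  have [n0 Hn] := kT_restricted ord0 r1 v; have [n1 Hn1] := kT_restricted i r2 v.
  apply: (@fsupp_int _ _ (n - n0) n1) => j H; split; rewrite leNgt; apply: contra_neqN H => H.
    by rewrite kkT Hn ?(lin0 (kT_lin _ _ _))//; lia.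
  by rewrite Hn1 ?(lin0 (kT_lin _ _ _)).
rewrite (@fsum_bij _ _ _ (fun j => a - j) (fun j => a - j)); last 2 first.
- by move=> j; rewrite opprB addrC subrK.
- by move=> j; rewrite opprB addrC subrK.
rewrite -[r + s]addrC -[a + b]addrC -kT_mul.
have -> : \sum_(i < N) (r 0 i)%:~R *: kT (lift ord0 i) (s + r) (b + a) v =
   - fsum (fun j => j%:~R *: kT ord0 s (b + a - j) (kT ord0 r j v)).
  transitivity (\sum_(i < N) fsum (fun j => (r 0 i)%:~R *: kT ord0 s (b + a - j) (kT (lift ord0 i) r j v))).
    by apply: eq_bigr => i _; rewrite -kT_mul fsumZ.
  rewrite -[- fsum _]scaleN1r fsumZ; last exact: fsuppZ.
  have Hs (I : seq 'I_N) : \sum_(i <- I) fsum (fun j => (r 0 i)%:~R *: kT ord0 s (b + a - j) (kT (lift ord0 i) r j v))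
     = fsum (fun j => \sum_(i <- I) (r 0 i)%:~R *: kT ord0 s (b + a - j) (kT (lift ord0 i) r j v))
     /\ fsupp (fun j => \sum_(i <- I) (r 0 i)%:~R *: kT ord0 s (b + a - j) (kT (lift ord0 i) r j v)).
    elim: I => [|i I [IH1 IH2]].
      rewrite big_nil; split.
        by rewrite fsum0// => j; rewrite big_nil.
      by apply: eq_fsupp (fsupp0 _ _) => j; rewrite big_nil.
    split.
      rewrite big_cons IH1 -fsumD//; last exact: fsuppZ.
      by apply: eq_fsum => j; rewrite big_cons.
    by have := fsuppD (fsuppZ (fun=> (r 0 i)%:~R) (sK (lift ord0 i) s r (b + a))) IH2;
       apply: eq_fsupp => j; rewrite big_cons.
  rewrite (Hs _).1; apply: eq_fsum => j.
  transitivity (kT ord0 s (b + a - j) (\sum_(i < N) (r 0 i)%:~R *: kT (lift ord0 i) r j v)).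
    by rewrite (linsum (kT_lin _ _ _)); apply: eq_bigr => i _; rewrite (linZ (kT_lin _ _ _)).
  by rewrite kT_D (linZ (kT_lin _ _ _)) scalerA mulN1r.
rewrite fsumZ// -[- fsum _]scaleN1r fsumZ; last exact: fsuppZ.
rewrite -fsumD; [|exact: fsuppZ|by do 2! apply: fsuppZ].
rewrite fsumZ; last by apply: fsuppD; [|apply: fsuppZ]; apply: fsuppZ.
apply: eq_fsum => j; rewrite /D /comp /= addrN eqxx.
have -> : a - (a - j) = j by lia.
have -> : b - - (a - j) = b + a - j by lia.
by rewrite (kkT ord0 ord0 r s j (b + a - j) v) scaleN1r -scalerBl scalerA rmorphB mulrC.
Qed.

Lemma d0_kT i r n v : d0T (kT i r n v) = kT i r n (d0T v) + n%:~R *: kT i r n v.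
Proof.
move: v; apply: eq_tensor.
- tlin d0T_lin.
- tlin d0T_lin.
move=> m w; rewrite kTE !d0TE (linD (kT_lin _ _ _)) !kTE -addrA -tensZr -tensDr; congr (_ + tens _ _).
by have := Z1_d0k HZ i r n w; rewrite /comm_ops => /addr_of_sub.
Qed.

Lemma d_kT l i r n v : dT l (kT i r n v) = kT i r n (dT l v) + (r 0 l)%:~R *: kT i r n v.
Proof.
move: v; apply: eq_tensor.
- tlin d0T_lin.
- tlin d0T_lin.
move=> m w; rewrite !(kTE, dTE) -tensZr -tensDr; congr (tens _ _).
by have := Z1_dk HZ l i r n w; rewrite /comm_ops => /addr_of_sub.
Qed.

Lemma d0_oT be i v : d0T (oT be i v) = oT be i (d0T v) + i%:~R *: oT be i v.
Proof.
move: v; apply: eq_tensor.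
- tlin d0T_lin.
- tlin d0T_lin.
move=> m w; have [->|i0] := eqVneq i 0.
  rewrite scale0r addr0 oT0E !d0TE (linD (oT_lin _ _)) !oT0E; congr (_ + tens _ _).
  by rewrite -(comm_opsP (Z1_hd HZ be ord0 w)).
rewrite oTE// !d0TE (linD (oT_lin _ _)) !oTE// addrAC; congr (_ + _).
rewrite -tensZl -tensDl; congr tens; by have := deg_osc HF be i m => /addr_of_sub.
Qed.

Lemma d_oT l be i v : dT l (oT be i v) = oT be i (dT l v).
Proof.
move: v; apply: eq_tensor; [tlin d0T_lin..|move=> m w].
have [->|i0] := eqVneq i 0; last by rewrite dTE !oTE// dTE.
by rewrite !(oT0E, dTE) (comm_opsP (Z1_hd HZ be (lift ord0 l) w)).
Qed.

Lemma d0_hT be r n v : d0T (hopT be r n v) = hopT be r n (d0T v) + n%:~R *: hopT be r n v.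
Proof.
rewrite /hopT (linfsum d0T_lin); last exact: hterm_supp.
rewrite fsumZ; last exact: hterm_supp.
rewrite -fsumD; last 2 first.
- exact: hterm_supp.
- by apply: fsuppZ; apply: hterm_supp.
apply: eq_fsum => i; rewrite /hterm d0_oT d0_kT (linD (oT_lin _ _)) (linZ (oT_lin _ _)) -addrA -scalerDl.
by rewrite rmorphB /= subrK.
Qed.

Lemma d_hT l be r n v : dT l (hopT be r n v) = hopT be r n (dT l v) + (r 0 l)%:~R *: hopT be r n v.
Proof.
rewrite /hopT (linfsum (dT_lin l)); last exact: hterm_supp.
rewrite fsumZ; last exact: hterm_supp.
rewrite -fsumD; last 2 first.
- exact: hterm_supp.
- by apply: fsuppZ; apply: hterm_supp.
by apply: eq_fsum => i; rewrite /hterm d_oT d_kT (linD (oT_lin _ _)) (linZ (oT_lin _ _)).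
Qed.

Lemma d0_vopT al r n v : root al ->
  d0T (vop al r n v) = vop al r n (d0T v) + n%:~R *: vop al r n v.
Proof.
move=> ra; move: v; apply: eq_tensor.
- tlin (d0T_lin, vop_lin r n ra).
- tlin (d0T_lin, vop_lin r n ra).
move=> m w; rewrite /vop (linfsum d0T_lin); last exact: vterm_supp.
rewrite fsumZ; last exact: vterm_supp.
rewrite -fsumD; last 2 first.
- exact: vterm_supp.
- by apply: fsuppZ; apply: vterm_supp.
apply: eq_fsum => -[q p]; rewrite d0TE (linD (vterm_lin _ _ _ _)) !vtermE d0TE.
rewrite (deg_Em HF) (deg_Ep HF) (linD (Em_lin HF _ _)) (linZ (Em_lin HF _ _)).
have := Z1_d0Z HZ r (n + p - q) w ra; rewrite /comm_ops => /addr_of_sub ->.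
rewrite tensDr tensBl tensDl !tensZl tensZr -[X in X + _ = _]addrA addrACA -scalerBl -scalerDl.
by congr (_ + _ *: _); rewrite rmorphB rmorphD /=; ring.
Qed.

Lemma d_vopT l al r n v : root al ->
  dT l (vop al r n v) = vop al r n (dT l v) + (r 0 l)%:~R *: vop al r n v.
Proof.
move=> ra; move: v; apply: eq_tensor.
- tlin (d0T_lin, vop_lin r n ra).
- tlin (d0T_lin, vop_lin r n ra).
move=> m w; rewrite /vop (linfsum (dT_lin l)); last exact: vterm_supp.
rewrite fsumZ; last exact: vterm_supp.
rewrite -fsumD; last 2 first.
- exact: vterm_supp.
- by apply: fsuppZ; apply: vterm_supp.
apply: eq_fsum => -[q p]; rewrite dTE !vtermE dTE -tensZr -tensDr; congr tens.
by have := Z1_dZ HZ l r (n + p - q) w ra; rewrite /comm_ops => /addr_of_sub.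
Qed.

Lemma d_dT l l' v : dT l (dT l' v) = dT l' (dT l v).
Proof.
move: v; apply: eq_tensor; [tlin d0T_lin..|move=> m w].
by rewrite !dTE (comm_opsP (Z1_dd HZ (lift ord0 l) (lift ord0 l') w)).
Qed.

Lemma d0_dT l v : d0T (dT l v) = dT l (d0T v).
Proof.
move: v; apply: eq_tensor; [tlin d0T_lin..|].
move=> m w; rewrite dTE !d0TE (linD (dT_lin _)) !dTE; congr (_ + tens _ _).
by rewrite (comm_opsP (Z1_dd HZ ord0 (lift ord0 l) w)).
Qed.

Lemma twisted_supp c al be r s a b w : root be ->
  fsupp (fun k : int => int_binom c k *: Zop A al r (a - k) (Zop A be s (b + k) w)).
Proof.
move=> rb; have [n0 Hn] := Z1_restrictedZ HZ s rb w.
apply: (@fsupp_int _ _ 0 (n0 - b)) => k; case: k => [k|k]; last by rewrite scale0r eqxx.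
move=> H; split=> //; rewrite leNgt; apply: contra_neqN H => H.
by rewrite Hn ?linear0 ?scaler0//; lia.
Qed.

(** A coefficient of the normally ordered product $E^-E^-E^+E^+$, which does not depend on the order
    of the two vertex operators. *)
Definition nterm al be (P P' Q Q' : int) (m : M) : M :=
  Em (- al) P (Em (- be) P' (Ep (- al) Q (Ep (- be) Q' m))).

(** The indices are nested as $(((Q',Q),P'),P)$: in this order each is bounded once the earlier ones
    are known, as [fsupp_dep] requires. *)
Let quad : Type := (((int * int) * int) * int)%type.

(** Normal ordering costs $(1-\zeta_1/\zeta_2)^{\langle\alpha,\beta\rangle}$. Moved onto the $Z$
    factors, this scalar series makes the product the twisted one of relation (7). *)
Lemma vop_vopE al be r s a b m w : root al -> root be ->
  let f (u : quad) := tens (nterm al be u.2 u.1.2 u.1.1.2 u.1.1.1 m)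
    (twisted_mul <<al, be>> (Zop A al r) (Zop A be s) (a + u.2 - u.1.1.2) (b + u.1.2 - u.1.1.1) w) in
  fsupp f /\ vop al r a (vop be s b (tens m w)) = fsum f.
Proof.
move=> ra rb f.
pose Hf (y : quad * int) := int_binom <<al, be>> y.1.2 *:
  tens (nterm al be y.2 y.1.1.2 y.1.1.1.2 y.1.1.1.1 m)
  (Zop A al r (a + y.2 - y.1.1.1.2 - y.1.2) (Zop A be s (b + y.1.1.2 - y.1.1.1.1 + y.1.2) w)).
have fHf : fsupp Hf.
  have [B1 HB1] := Ep_supp (- be) m; have [n0 Hn] := Z1_restrictedZ HZ s rb w.
  have key Q' Q P' k P : Hf ((((Q', Q), P'), k), P) != 0 ->
    [/\ 0 <= Q' <= B1, Ep (- al) Q (Ep (- be) Q' m) != 0, 0 <= P', 0 <= k &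
        b + P' - Q' + k <= n0] /\ 0 <= P /\
        Zop A al r (a + P - Q - k) (Zop A be s (b + P' - Q' + k) w) != 0.
    rewrite /Hf /nterm /=; case: k => [k|k]; last by rewrite scale0r eqxx.
    move=> H0; split; first (split=> //).
    - have [] // := HB1 Q'; last by move=> -> ->.
      apply: contra_neq H0 => ->.
      by rewrite (lin0 (Ep_lin HF _ _)) !(lin0 (Em_lin HF _ _)) tens0l scaler0.
    - by apply: contra_neq H0 => ->; rewrite !(lin0 (Em_lin HF _ _)) tens0l scaler0.
    - rewrite leNgt; apply: contra_neqN H0 => p0.
      by rewrite (Em_neg HF (- be))// (lin0 (Em_lin HF _ _)) tens0l scaler0.
    - by rewrite leNgt; apply: contra_neqN H0 => p0; rewrite Hn// linear0 tens0r scaler0.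
    split; first by rewrite leNgt; apply: contra_neqN H0 => p0; rewrite (Em_neg HF)// tens0l scaler0.
    by apply: contra_neq H0 => ->; rewrite tens0r scaler0.
  have /choice[B2 HB2] Q' : exists B, forall Q, Ep (- al) Q (Ep (- be) Q' m) != 0 -> 0 <= Q /\ Q <= B.
    exact: Ep_supp.
  pose s1 := int_range 0 B1; pose s2 := allpairs_dep pair s1 (fun Q' => int_range 0 (B2 Q')).
  pose s3 := allpairs_dep pair s2 (fun z => int_range 0 (n0 - b + z.1)).
  pose s4 := allpairs_dep pair s3 (fun z => int_range 0 (n0 - b + z.1.1 - z.2)).
  apply: (@fsupp_dep _ _ _ _ s4) => [[[[Q' Q] P'] k] P /key|[[[Q' Q] P'] k]].
    case=> -[/andP[a1 a2] /HB2[b1 b2] c1 d1 d2] _.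
    apply/allpairsPdep; exists ((Q', Q), P'), k; split=> //.
      apply/allpairsPdep; exists (Q', Q), P'; split=> //.
        by apply/allpairsPdep; exists Q', Q; split=> //; apply: mem_int_range.
      by apply: mem_int_range => //=; lia.
    by apply: mem_int_range => //=; lia.
  have [n1 Hn1] := Z1_restrictedZ HZ r ra (Zop A be s (b + P' - Q' + k) w).
  apply: (@fsupp_int _ _ 0 (n1 - a + Q + k)) => P /key[_ [P0 H0]]; split=> //.
  rewrite leNgt; apply: contra_neqN H0 => p0; rewrite Hn1 //; lia.
(* The exchange index $k$ lowers the indices of the inner $E^+$ and $E^-$. The substitution makes
   $Q$ and $P'$ the lowered indices, so that $k$ is left in the arguments of $Z$ only. *)
pose phi (y : (int * int) * (int * int) * int) : quad * int :=
  ((((y.1.1.1, y.1.2.1 - y.2), y.1.1.2 - y.2), y.2), y.1.2.2).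
pose phi' (y : quad * int) : (int * int) * (int * int) * int :=
  (((y.1.1.1.1, y.1.1.2 + y.1.2), (y.1.1.1.2 + y.1.2, y.2)), y.1.2).
have phiK : cancel phi phi' by move=> [[[q' p'] [q p]] k]; rewrite /phi /phi' /= !subrK.
have phiK' : cancel phi' phi by move=> [[[[q' p'] q] p] k]; rewrite /phi /phi' /= !addrK.
pose psi (y : quad * int) : quad * int := (((y.1.1, y.2)), y.1.2).
have psiK : cancel psi psi by case=> [[[[? ?] ?] ?] ?].
have fpsi := fsupp_reindex (can_inj psiK) fHf.
have fE u : f u = fsum (fun k => (Hf \o psi) (u, k)).
  rewrite /f twisted_mulE (linfsum (tlike_r HT _)); last exact: twisted_supp.
  by apply: eq_fsum => k; rewrite tensZr /Hf /psi.
split; first by apply: (eq_fsupp _ (fsupp_fsum fpsi)) => u; rewrite fE.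
rewrite /vop (fsum_comp (vterm_lin al r a)); last 2 first.
- by move=> u; apply: vterm_supp.
- exact: vterm_supp.
transitivity (fsum (fun x => fsum (fun k => (Hf \o phi) (x, k)))).
  apply: eq_fsum => -[[q' p'] [q p]]; rewrite !vtermE (Ep_Em HF).
  have sE := @exs_exchange_supp _ _ _ _ _ _ <<- al, - be>> (Ep_exs HF (- al)) (Em_exs HF (- be))
    (fun _ => id) q p' (Ep (- be) q' m) (fun=> erefl).
  rewrite (linfsum (Em_lin HF _ _)); last exact: sE.
  rewrite (linfsum (tlike_l HT _)); last first.
    by apply: fsupp_linear; [exact: lin0 (Em_lin HF _ _)|exact: sE].
  apply: eq_fsum => k; rewrite /Hf /phi /nterm /= (linZ (Em_lin HF _ _)) tensZl.
  rewrite hformNl hformNr opprK; congr (_ *: tens _ _).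
  have -> : a + p - (q - k) - k = a + p - q by lia.
  by have -> : b + (p' - k) - q' + k = b + p' - q' by lia.
rewrite -fsum_pair; last exact: (fsupp_reindex (can_inj phiK)).
rewrite -(fsum_bij _ phiK phiK') (fsum_bij _ psiK psiK) fsum_pair//.
by apply: eq_fsum => u; rewrite fE.
Qed.

(** Both orders of multiplication have the same normally ordered exponentials, so their difference
    puts [Z_commutator] in the second tensor factor. *)
Lemma vop_commE al be r s a b m w : root al -> root be ->
  let f (u : quad) := tens (nterm al be u.2 u.1.2 u.1.1.2 u.1.1.1 m)
    (Z_commutator form A al be r s (a + u.2 - u.1.1.2) (b + u.1.2 - u.1.1.1) w) in
  vop al r a (vop be s b (tens m w)) - vop be s b (vop al r a (tens m w)) = fsum f.
Proof.
move=> ra rb f; have [f1 ->] := vop_vopE r s a b m w ra rb.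
have [f2 ->] := vop_vopE s r b a m w rb ra.
pose sw (u : quad) : quad := (((u.1.1.2, u.1.1.1), u.2), u.1.2).
have swK : cancel sw sw by case=> [[[? ?] ?] ?].
rewrite [X in _ - X](fsum_bij _ swK swK) -scaleN1r fsumZ; last exact: (fsupp_reindex (can_inj swK)).
rewrite -fsumD//; last by apply: fsuppZ; apply: (fsupp_reindex (can_inj swK) f2).
apply: eq_fsum => -[[[Q' Q] P'] P]; rewrite scaleN1r /f /sw /= /Z_commutator tensBr form_sym.
congr (_ - tens _ _); rewrite /nterm (Ep_Ep HF (- be)) //.
by rewrite (Em_Em HF (- be)).
Qed.

(** When the second factor depends only on $(P+P')-(Q+Q')$, the sum regroups by these two totals and
    the kernels are convolved. The kernels are left general so that they may carry a weight $P$ or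
    $Q$, as the $D\delta$ term demands. *)
Lemma normal_sum (Km Kp : int -> int -> M -> M) (Y : int -> W) (c : int) (m : M) :
  (forall P P', linear (Km P P')) ->
  (forall P P' v, P < 0 \/ P' < 0 -> Km P P' v = 0) ->
  fsupp (fun z : int * int => Kp z.2 z.1 m) ->
  (exists n0, forall n, n0 < n -> Y n = 0) ->
  let f (u : quad) := tens (Km u.2 u.1.2 (Kp u.1.1.2 u.1.1.1 m)) (Y (c + (u.2 + u.1.2) - (u.1.1.2 + u.1.1.1))) in
  fsupp f /\
  fsum f = fsum (fun qp : int * int => tens (fsum (fun P => Km P (qp.2 - P)
     (fsum (fun Q => Kp Q (qp.1 - Q) m)))) (Y (c + qp.2 - qp.1))).
Proof.
move=> Kl K0 fK [n0 Hn] f.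
have ff : fsupp f.
  have [s us sE] := fsupp_seq fK.
  have key Q' Q P' P : f (((Q', Q), P'), P) != 0 ->
    [/\ (Q', Q) \in s, 0 <= P', 0 <= P & c + (P + P') - (Q + Q') <= n0].
    rewrite /f /= => H; split.
    - by apply: sE => /=; apply: contra_neq H => ->; rewrite (lin0 (Kl _ _)) tens0l.
    - by rewrite leNgt; apply: contra_neqN H => H; rewrite K0 ?tens0l//; right.
    - by rewrite leNgt; apply: contra_neqN H => H; rewrite K0 ?tens0l//; left.
    - by rewrite leNgt; apply: contra_neqN H => H; rewrite Hn ?tens0r.
  pose s3 := allpairs_dep pair s (fun z => int_range 0 (n0 - c + z.1 + z.2)).
  apply: (@fsupp_dep _ _ _ _ s3) => [[[Q' Q] P'] P /key[H1 H2 H3 H4]|[[Q' Q] P']].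
    apply/allpairsPdep; exists (Q', Q), P'; split=> //.
    by apply: mem_int_range => //=; lia.
  apply: (@fsupp_int _ _ 0 (n0 - c + Q + Q' - P')) => P /key[_ _ H1 H2]; split=> //; lia.
split=> //.
pose th (y : (int * int) * (int * int)) : quad :=
  (((y.1.1 - y.2.2, y.2.2), y.1.2 - y.2.1), y.2.1).
pose th' (u : quad) : (int * int) * (int * int) :=
  ((u.1.1.1 + u.1.1.2, u.1.2 + u.2), (u.2, u.1.1.2)).
have thK : cancel th th' by move=> [[q p] [P Q]]; rewrite /th /th' /= !subrK.
have thK' : cancel th' th by move=> [[[Q' Q] P'] P]; rewrite /th /th' /= !addrK.
have fth := fsupp_reindex (can_inj thK) ff.
rewrite (fsum_bij _ thK thK') fsum_pair//; apply: eq_fsum => -[q p] /=.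
rewrite fsum_pair; last exact: (fsupp_fst _ fth).
have fQ : fsupp (fun Q => Kp Q (q - Q) m).
  have iQ : injective (fun Q : int => (q - Q, Q)) by move=> Q1 Q2 [].
  exact: (fsupp_reindex iQ fK).
have fP v : fsupp (fun P => Km P (p - P) v).
  apply: (@fsupp_int _ _ 0 p) => P H; split; rewrite leNgt; apply: contra_neqN H => H.
    by rewrite K0//; left.
  by rewrite K0//; right; lia.
rewrite (linfsum (tlike_l HT _)); last exact: fP.
apply: eq_fsum => P; rewrite (linfsum (Kl _ _))//.
rewrite (linfsum (tlike_l HT _)); last first.
  by apply: fsupp_linear; [exact: lin0 (Kl _ _)|].
apply: eq_fsum => Q; rewrite /comp /f /th /=; congr (tens _ (Y _)).
by rewrite !subrKC.
Qed.

Lemma EpEp_supp al be m : fsupp (fun z : int * int => Ep al z.2 (Ep be z.1 m)).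
Proof.
have [B HB] := Ep_supp be m; apply: (@fsupp_int_dep _ _ _ 0 B) => [Q' Q|Q'] /=.
  move=> H; apply: HB; apply: contra_neq H => ->; exact: lin0 (Ep_lin HF _ _).
by have [B2 HB2] := Ep_supp al (Ep be Q' m); apply: (@fsupp_int _ _ 0 B2).
Qed.

Lemma EmEm_lin al be P P' : linear (fun v => Em al P (Em be P' v)).
Proof. by move=> c u v; rewrite !(Em_lin HF). Qed.
Lemma EmEm_neg al be P P' v : P < 0 \/ P' < 0 -> Em al P (Em be P' v) = 0.
Proof.
case=> H; first by rewrite (Em_neg HF).
have -> : Em be P' v = 0 by apply: (Em_neg HF).
exact: lin0 (Em_lin HF _ _).
Qed.

Lemma normal_sum1 al be (Y : int -> W) (c : int) (m : M) :
  (exists n0, forall n, n0 < n -> Y n = 0) ->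
  let f (u : quad) := tens (nterm al be u.2 u.1.2 u.1.1.2 u.1.1.1 m) (Y (c + (u.2 + u.1.2) - (u.1.1.2 + u.1.1.1))) in
  fsupp f /\ fsum f = fsum (fun qp : int * int =>
    tens (Em (- (al + be)) qp.2 (Ep (- (al + be)) qp.1 m)) (Y (c + qp.2 - qp.1))).
Proof.
move=> HY f.
have [ff fE] := @normal_sum (fun P P' v => Em (- al) P (Em (- be) P' v))
  (fun Q Q' v => Ep (- al) Q (Ep (- be) Q' v)) Y c m (EmEm_lin (- al) (- be))
  (@EmEm_neg (- al) (- be)) (EpEp_supp (- al) (- be) m) HY.
split=> //; rewrite [LHS]fE; apply: eq_fsum => -[q p] /=; congr tens.
rewrite -/(exs_mul (Ep (- al)) (Ep (- be)) q m) (Ep_mul HF) -opprD.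
by rewrite -/(exs_mul (Em (- al)) (Em (- be)) p _) (Em_mul HF) -opprD.
Qed.

Lemma vop_comm_root al be r s a b v : root al -> root be -> root (al + be) ->
  vop al r a (vop be s b v) - vop be s b (vop al r a v) = eps al be *: vop (al + be) (r + s) (a + b) v.
Proof.
move=> ra rb rab; move: v; apply: eq_tensor.
- by move=> c u v; rewrite !(vop_lin _ _ ra, vop_lin _ _ rb) opprD addrACA -scalerBr.
- by move=> c u v; rewrite (vop_lin _ _ rab) scale_linP.
move=> m w; rewrite vop_commE//.
pose Y n := eps al be *: Zop A (al + be) (r + s) n w.
have HY : exists n0, forall n, n0 < n -> Y n = 0.
  have [n0 Hn] := Z1_restrictedZ HZ (r + s) rab w; exists n0 => n /Hn E.
  by rewrite /Y E scaler0.
have [ff fE] := @normal_sum1 al be Y (a + b) m HY.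
transitivity (fsum (fun u : quad => tens (nterm al be u.2 u.1.2 u.1.1.2 u.1.1.1 m)
    (Y (a + b + (u.2 + u.1.2) - (u.1.1.2 + u.1.1.1))))).
  apply: eq_fsum => -[[[Q' Q] P'] P]; congr tens; rewrite (Z1_ZZ_root HZ)//= /mul_delta /Y.
  by congr (_ *: Zop A _ _ _ _); lia.
rewrite fE /vop fsumZ; last exact: vterm_supp.
by apply: eq_fsum => -[q p]; rewrite vtermE /Y tensZr.
Qed.

Lemma vop_comm_other al be r s a b v : root al -> root be -> ~ root (al + be) -> al + be <> 0 ->
  vop al r a (vop be s b v) - vop be s b (vop al r a v) = 0.
Proof.
move=> ra rb nrab nab; move: v; apply: eq_tensor.
- by move=> c u v; rewrite !(vop_lin _ _ ra, vop_lin _ _ rb) opprD addrACA -scalerBr.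
- by move=> c u v; rewrite scaler0 addr0.
move=> m w; rewrite vop_commE// fsum0// => u.
by rewrite (Z1_ZZ_other HZ)// tens0r.
Qed.

(** The exponentials for $\alpha$ and $-\alpha$ cancel. The $D\delta$ term has weight $a+P-Q$: the
    part $a$ stays, the weights $P$ and $Q$ differentiate $E^-$ and $E^+$ and release the negative
    and positive modes of $\alpha(\zeta)$, and the term with $\alpha\in\underline h$ supplies the
    zero mode. *)
Lemma vop_comm_opp al r s a b v : root al -> root (- al) ->
  vop al r a (vop (- al) s b v) - vop (- al) s b (vop al r a v) =
  form (x (- al)) (x al) *: (hopT al (r + s) (a + b) v + a%:~R *: kT ord0 (r + s) (a + b) v
    + \sum_(i < N) (r 0 i)%:~R *: kT (lift ord0 i) (r + s) (a + b) v).
Proof.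
move=> ra rb; set ka := form _ _; move: v; apply: eq_tensor.
- by move=> c u v; rewrite !(vop_lin _ _ ra, vop_lin _ _ rb) opprD addrACA -scalerBr.
- move=> c u v; rewrite (hopT_lin _ _ _) kT_lin.
  have -> : \sum_(i < N) (r 0 i)%:~R *: kT (lift ord0 i) (r + s) (a + b) (c *: u + v) =
    c *: (\sum_(i < N) (r 0 i)%:~R *: kT (lift ord0 i) (r + s) (a + b) u) +
    \sum_(i < N) (r 0 i)%:~R *: kT (lift ord0 i) (r + s) (a + b) v.
    rewrite scaler_sumr -big_split; apply: eq_bigr => i _.
    by rewrite kT_lin scale_linP.
  by rewrite !(scale_linP c a%:~R) !lin_addP scale_linP.
move=> m w; rewrite vop_commE//.
pose k0 n := kop A ord0 (r + s) n w.
have Hk0 : exists n0, forall n, n0 < n -> k0 n = 0 by apply: (Z1_restrictedk HZ).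
pose Y n := ka *: (hop A al (k0 n) + \sum_(i < N) (r 0 i)%:~R *: kop A (lift ord0 i) (r + s) n w + a%:~R *: k0 n).
have HY : exists n0, forall n, n0 < n -> Y n = 0.
  have [n0 Hn] := Hk0.
  have /choice[B HB] (i : 'I_N) : exists B, forall n, B < n -> kop A (lift ord0 i) (r + s) n w = 0.
    exact: (Z1_restrictedk HZ).
  exists (\sum_(i < N) `|B i| + `|n0|) => n nB; rewrite /Y Hn ?linear0 ?scaler0 ?addr0; last first.
    apply: le_lt_trans nB; rewrite (le_trans (ler_norm _))// lerDr.
    by apply: sumr_ge0 => i _.
  rewrite add0r big1 ?scaler0// => i _; rewrite HB ?scaler0//.
  apply: le_lt_trans nB; rewrite (le_trans (ler_norm _))// (bigD1 i)//= -addrA lerDl addr_ge0//.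
  by apply: sumr_ge0 => j _.
have Y0 : exists n0, forall n, n0 < n -> ka *: k0 n = 0.
  by have [n0 Hn] := Hk0; exists n0 => n /Hn ->; rewrite scaler0.
have xE : x (- - al) = x al by rewrite opprK.
have a'a : - al + - - al = 0 by rewrite opprK addNr.
have [f1 E1] := @normal_sum1 al (- al) Y (a + b) m HY.
have Kl P P' : linear (fun v => P%:~R *: Em (- al) P (Em (- - al) P' v)).
  by move=> c u v; rewrite !(Em_lin HF) scale_linP.
have K0 P P' v : P < 0 \/ P' < 0 -> P%:~R *: Em (- al) P (Em (- - al) P' v) = 0 :> M.
  by move=> /EmEm_neg ->; rewrite scaler0.
have [f2 E2] := @normal_sum (fun P P' v => P%:~R *: Em (- al) P (Em (- - al) P' v))
  (fun Q Q' v => Ep (- al) Q (Ep (- - al) Q' v)) _ (a + b) m Kl K0 (EpEp_supp (- al) (- - al) m) Y0.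
have fQ : fsupp (fun z : int * int => z.2%:~R *: Ep (- al) z.2 (Ep (- - al) z.1 m)).
  exact: fsuppZ (EpEp_supp (- al) (- - al) m).
have [f3 E3] := @normal_sum (fun P P' v => Em (- al) P (Em (- - al) P' v)) (fun Q Q' m => Q%:~R *: Ep (- al) Q (Ep (- - al) Q' m)) _ (a + b) m
   (EmEm_lin (- al) (- - al)) (@EmEm_neg (- al) (- - al)) fQ Y0.
(* Splitting by the weight $a+P-Q$: the unweighted terms are collected in [Y], the weight $P$ is put
   on $E^-$ and the weight $-Q$ on $E^+$. *)
transitivity (fsum (fun u : quad => tens (nterm al (- al) u.2 u.1.2 u.1.1.2 u.1.1.1 m)
    (Y (a + b + (u.2 + u.1.2) - (u.1.1.2 + u.1.1.1))) +
  (tens (u.2%:~R *: nterm al (- al) u.2 u.1.2 u.1.1.2 u.1.1.1 m)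
    (ka *: k0 (a + b + (u.2 + u.1.2) - (u.1.1.2 + u.1.1.1))) +
   -1 *: tens (Em (- al) u.2 (Em (- - al) u.1.2 (u.1.1.2%:~R *: Ep (- al) u.1.1.2 (Ep (- - al) u.1.1.1 m))))
    (ka *: k0 (a + b + (u.2 + u.1.2) - (u.1.1.2 + u.1.1.1)))))).
  apply: eq_fsum => -[[[Q' Q] P'] P] /=; rewrite (Z1_ZZ_opp HZ) ?subrr// xE -/ka.
  rewrite /mul_delta /mul_Ddelta.
  have -> : a + P - Q + (b + P' - Q') = a + b + (P + P') - (Q + Q') by lia.
  rewrite !(linZ (Em_lin HF _ _)) -/(nterm al (- al) P P' Q Q' m) !tensZl -!tensZr.
  rewrite -!tensDr; congr tens; rewrite /Y -/(k0 _).
  set kk := k0 _; have hN : hop A (- al) kk = - hop A al kk.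
    have h0 := Z1_hop_linear HZ (-1) al 0 kk; have h1 := Z1_hop_linear HZ (-1) 0 0 kk.
    move: h1 h0; rewrite scaler0 addr0 scaleN1r addNr => ->.
    by rewrite !scaleN1r !addr0.
  rewrite hN opprK rmorphB rmorphD /= !scalerDl !scalerDr !scaleNr !scalerN !scalerA mul1r.
  by rewrite ![ka * _]mulrC -!addrA.
rewrite fsumD; [|exact: f1|by apply: fsuppD; [exact: f2|apply: fsuppZ; exact: f3]].
rewrite fsumD; [|exact: f2|by apply: fsuppZ; exact: f3].
rewrite -fsumZ; last exact: f3.
rewrite E1 [X in _ + (X + _)]E2 [X in _ + (_ + -1 *: X)]E3.
rewrite (@fsum1 _ _ (0, 0)); last first.
  move=> [q p] qp /=; rewrite subrr oppr0 (Ep0 HF) (Em0 HF).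
  by move: qp; rewrite xpair_eqE; case: eqP => //= _; case: eqP => //= _ _; rewrite ?(lin0 (Em_lin HF _ _)) ?tens0l// if_same tens0l.
have zz : - (al - al) = 0 by rewrite subrr oppr0.
have -> : a + b + (0 : int, 0 : int).2 - (0 : int, 0 : int).1 = a + b by rewrite addr0 subr0.
rewrite zz (Ep0 HF) (Em0 HF) !eqxx.
pose U p := tens (minus_modes F (- al) p m) (ka *: k0 (a + b + p)).
pose V q := tens (plus_modes F (- al) q m) (ka *: k0 (a + b - q)).
pose EQ q := fsum (fun Q => Ep (- al) Q (Ep (- - al) (q - Q) m)).
have EQE q : EQ q = if q == 0 then m else 0.
  by rewrite /EQ -/(exs_mul (Ep (- al)) (Ep (- - al)) q m) (Ep_mul HF) a'a (Ep0 HF).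
have U2 : fsum (fun qp : int * int => tens
     (fsum (fun P => P%:~R *: Em (- al) P (Em (- - al) (qp.2 - P) (EQ qp.1))))
     (ka *: k0 (a + b + qp.2 - qp.1))) = fsum U.
  rewrite (@fsum_reindex _ _ _ (fun p : int => (0, p))); last 2 first.
  - by move=> p p' [].
  - move=> [q p] /=; rewrite (Em_mul_deriv HF)// EQE; case: (q =P 0) => [-> _|_]; first by exists p.
    by rewrite /minus_modes linear0 oppr0 if_same tens0l eqxx.
  by apply: eq_fsum => p; rewrite /= (Em_mul_deriv HF)// EQE eqxx subr0.
have V2 : fsum (fun qp : int * int => tens
     (fsum (fun P => Em (- al) P (Em (- - al) (qp.2 - P)
        (fsum (fun Q => Q%:~R *: Ep (- al) Q (Ep (- - al) (qp.1 - Q) m))))))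
     (ka *: k0 (a + b + qp.2 - qp.1))) = fsum V.
  have EE3 p v : fsum (fun P => Em (- al) P (Em (- - al) (p - P) v)) = if p == 0 then v else 0.
    by rewrite -/(exs_mul (Em (- al)) (Em (- - al)) p v) (Em_mul HF) a'a (Em0 HF).
  rewrite (@fsum_reindex _ _ _ (fun q : int => (q, 0))); last 2 first.
  - by move=> p p' [].
  - move=> [q p] /=; rewrite EE3; case: (p =P 0) => [-> _|_]; first by exists q.
    by rewrite tens0l eqxx.
  by apply: eq_fsum => q; rewrite /= EE3 (Ep_mul_deriv HF)// addr0.
rewrite U2 V2.
have oN i v : osc F (- al) i v = - osc F al i v.
  have h0 := osc_linear HF (-1) al 0 i v.
  by move: h0; rewrite (osc0 HF) !addr0 !scaleN1r.
have fU : fsupp U.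
  have [n0 Hn] := Hk0; apply: (@fsupp_int _ _ 0 (n0 - a - b)) => p H.
  have [p0|p0] := leP p 0; first by rewrite /U /minus_modes ltNge p0 tens0l eqxx in H.
  split; first exact: ltW; rewrite leNgt; apply: contra_neqN H => H.
  by rewrite /U Hn ?scaler0 ?tens0r//; lia.
have fV : fsupp V.
  have [n0 Hn] := osc_restricted HF (- al) m; apply: (@fsupp_int _ _ 0 n0) => p H.
  have [p0|p0] := leP p 0; first by rewrite /V /plus_modes ltNge p0 tens0l eqxx in H.
  split; first exact: ltW; rewrite leNgt; apply: contra_neqN H => H.
  by rewrite /V /plus_modes Hn ?if_same ?tens0l//; lia.
(* Modes of $\alpha(\zeta)$ by sign: [U] is the negative half after $i=-p$, [V] is minus the
   positive half, and the zero mode acts on $W$. *)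
have hE : ka *: hopT al (r + s) (a + b) (tens m w) =
   tens m (ka *: hop A al (k0 (a + b))) + (fsum U + -1 *: fsum V).
  rewrite /hopT fsumZ; last exact: hterm_supp.
  rewrite [fsum U](@fsum_bij _ _ _ (fun i => - i) (fun i => - i)); [|exact: opprK..].
  pose O i := if i == 0 :> int then tens m (ka *: hop A al (k0 (a + b))) else 0.
  have fO : fsupp O by apply: (@fsupp1 _ _ 0) => i /negPf; rewrite /O => ->.
  have fU' : fsupp (U \o (fun i => - i)) by apply: fsupp_reindex => //; exact: oppr_inj.
  have <- : fsum O = tens m (ka *: hop A al (k0 (a + b))).
    by rewrite (@fsum1 _ _ 0) /O ?eqxx// => i /negPf ->.
  rewrite fsumZ// -[fsum _ + fsum _]fsumD//; last exact: fsuppZ.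
  rewrite -fsumD//; last by apply: fsuppD => //; apply: fsuppZ.
  apply: eq_fsum => i; rewrite /hterm /O /U /V /comp kTE -/(k0 _).
  rewrite /minus_modes /plus_modes !oN !opprK oppr_gt0.
  case: (ltgtP i 0) => [i0|i0|->].
  - by rewrite oTE ?lt_eqF// tens0l scaler0 add0r addr0 tensZr.
  - by rewrite oTE ?gt_eqF// !tens0l !add0r -[-1 *: _]tensZl scaleN1r opprK tensZr.
  - by rewrite oT0E !tens0l scaler0 !addr0 ?subr0 tensZr.
have kS : \sum_(i < N) (r 0 i)%:~R *: kT (lift ord0 i) (r + s) (a + b) (tens m w) =
    tens m (\sum_(i < N) (r 0 i)%:~R *: kop A (lift ord0 i) (r + s) (a + b) w).
  by rewrite (linsum (tlike_r HT m)); apply: eq_bigr => i _; rewrite kTE tensZr.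
rewrite kS kTE -!tensZr -!addrA -tensDr [RHS]scalerDr hE /Y -tensZr.
set UV := _ + _ *: _; set S := \sum_(i < N) _; rewrite -/(k0 _).
rewrite -addrA [ka *: (hop A al _ + _)]scalerDr tensDr -!addrA; congr (_ + _).
by rewrite [LHS]addrC [S + _]addrC /UV -addrA.
Qed.

End Vertex.

(** * Root combinatorics *)

Section LatticeForm.
Variables (l : nat) (A : 'M[int]_l).
Implicit Types u v w : 'rV[int]_l.
Definition qform (u v : 'rV[int]_l) : int := \sum_j (u *m A) 0 j * v 0 j.
Lemma qformDl u v w : qform (u + v) w = qform u w + qform v w.
Proof. by rewrite -big_split; apply: eq_bigr => j _; rewrite mulmxDl mxE mulrDl. Qed.
Lemma qformDr u v w : qform u (v + w) = qform u v + qform u w.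
Proof. by rewrite -big_split; apply: eq_bigr => j _; rewrite [(v + w) _ _]mxE mulrDr. Qed.
Lemma qformNl u w : qform (- u) w = - qform u w.
Proof. by rewrite -sumrN; apply: eq_bigr => j _; rewrite mulNmx mxE mulNr. Qed.
Lemma qformNr u w : qform u (- w) = - qform u w.
Proof. by rewrite -sumrN; apply: eq_bigr => j _; rewrite [(- w) _ _]mxE mulrN. Qed.
Lemma qform0r u : qform u 0 = 0.
Proof. by rewrite /qform big1// => j _; rewrite [X in _ * X]mxE mulr0. Qed.
Lemma qform_sum u v : qform u v = \sum_i \sum_j u 0 i * A i j * v 0 j.
Proof.
rewrite exchange_big; apply: eq_bigr => j _; rewrite mxE mulr_suml.
by apply: eq_bigr.
Qed.
Lemma qformE u : qform u u = \sum_i u 0 i * qform u (delta_mx 0 i).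
Proof.
apply: eq_bigr => i _; rewrite mulrC; congr (_ * _); rewrite /qform (bigD1 i)//=.
rewrite [X in _ * X + _]mxE !eqxx mulr1 big1 ?addr0// => j ji.
by rewrite [X in _ * X]mxE (negPf ji) andbF mulr0.
Qed.
End LatticeForm.

Lemma qformC l (A : 'M[int]_l) u v : A^T = A -> qform A u v = qform A v u.
Proof.
move=> AT; rewrite !qform_sum exchange_big; apply: eq_bigr => i _; apply: eq_bigr => j _.
by rewrite -[in LHS]AT mxE; ring.
Qed.

(** * Solving for the rescaling of root vectors *)

Section Cocycle.
Variables (K : fieldType) (l : nat) (A : 'M[int]_l).
Notation q := (qform A).
Notation dl i := (delta_mx 0 i : 'rV[int]_l).
(** Roots in coordinates with respect to a base. [s] will be the structure constants twisted by
    $(-1)^B$ and [r] the value $-\langle x_u,x_{-u}\rangle$; the hypotheses on them come from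
    antisymmetry, the Jacobi identity and invariance of the form. *)
Variables (rt : 'rV[int]_l -> Prop) (s : 'rV[int]_l -> 'rV[int]_l -> K) (r : 'rV[int]_l -> K).
Hypothesis qC : forall u v, q u v = q v u.
Hypothesis rt2 : forall u, rt u -> q u u = 2.
Hypothesis rtN : forall u, rt u -> rt (- u).
Hypothesis rtD : forall u v, rt u -> rt v -> q u v = -1 -> rt (u + v).
Hypothesis rt_le2 : forall u v, rt u -> rt v -> q u v <= 2.
Hypothesis rt_eq2 : forall u v, rt u -> rt v -> q u v = 2 -> u = v.
Hypothesis rt_base : forall i, rt (dl i).
Hypothesis q_base : forall i j, i != j -> q (dl i) (dl j) = 0 \/ q (dl i) (dl j) = -1.
Hypothesis rt_sign : forall u, rt u -> (forall i, 0 <= u 0 i) \/ (forall i, u 0 i <= 0).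
Hypothesis s0 : forall u v, rt u -> rt v -> q u v = -1 -> s u v != 0.
Hypothesis r0 : forall u, rt u -> r u != 0.
Hypothesis rN : forall u, rt u -> r (- u) = r u.
Hypothesis sC : forall u v, rt u -> rt v -> q u v = -1 -> s u v = s v u.
Hypothesis sT : forall u v w, rt u -> rt v -> rt w -> q u v = -1 -> q v w = -1 -> q u w = 0 ->
  s u v * s (u + v) w = s v w * s u (v + w).
Hypothesis sR : forall u v, rt u -> rt v -> q u v = -1 -> s u v * s (u + v) (- v) = r v.
Hypothesis sr : forall u v, rt u -> rt v -> q u v = -1 ->
  s u v * r (u + v) = s v (- (u + v)) * r u.

Let qDl := qformDl A.
Let qDr := qformDr A.
Let qNl := qformNl A.
Let qNr := qformNr A.

Lemma rtB u v : rt u -> rt v -> q u v = 1 -> rt (u - v).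
Proof. by move=> ru rv uv; apply: rtD => //; [exact: rtN|rewrite qNr uv]. Qed.

Definition ht (u : 'rV[int]_l) : int := \sum_i u 0 i.
Lemma htD u v : ht (u + v) = ht u + ht v.
Proof. by rewrite -big_split; apply: eq_bigr => i _; rewrite mxE. Qed.
Lemma htN u : ht (- u) = - ht u.
Proof. by rewrite -sumrN; apply: eq_bigr => i _; rewrite mxE. Qed.
Lemma htdl i : ht (dl i) = 1.
Proof.
rewrite /ht (bigD1 i)//= mxE !eqxx big1 ?addr0// => j ji.
by rewrite mxE (negPf ji) andbF.
Qed.

Lemma rt_ht u : rt u -> ht u != 0.
Proof.
move=> ru; apply/eqP => h0; have := rt2 ru; suff -> : u = 0 by rewrite qform0r.
have [u0|u0] := rt_sign ru.
  apply/rowP => i; rewrite mxE; move/eqP: h0; rewrite psumr_eq0// => /allP/(_ i).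
  by rewrite mem_index_enum => /(_ isT)/eqP.
apply/rowP => i; rewrite mxE; move/eqP: h0; rewrite -oppr_eq0 -htN psumr_eq0 => [/allP/(_ i)|j _].
  by rewrite mem_index_enum mxE oppr_eq0 => /(_ isT)/eqP.
by rewrite mxE oppr_ge0.
Qed.

(** If [u] paired nonpositively with every simple root, $q(u,u)=\sum_iu_iq(u,\alpha_i)$ would be
    $\le0$ instead of 2. A positive pairing is 1, as 2 would force $u=\alpha_i$, of height 1. *)
Lemma rt_descent u : rt u -> 1 < ht u -> exists i, rt (u - dl i).
Proof.
move=> ru hu; apply: contrapT => H.
have q0 i : q u (dl i) <= 0.
  rewrite leNgt; apply/negP => qi; have q2 := rt_le2 ru (rt_base i).
  have [q1|q1] := eqVneq (q u (dl i)) 1; first by apply: H; exists i; apply: rtB.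
  have := rt_eq2 ru (rt_base i); have -> : q u (dl i) = 2 by lia.
  by move=> /(_ erefl) E; move: hu; rewrite E htdl.
have u0 : forall i, 0 <= u 0 i.
  case: (rt_sign ru) => // u0; have hu0 : ht u <= 0 by apply: sumr_le0.
  by move: (le_lt_trans hu0 (lt_trans ltr01 hu)); rewrite ltxx.
have := rt2 ru; rewrite qformE => E.
have : \sum_i u 0 i * q u (dl i) <= 0 by apply: sumr_le0 => i _; apply: mulr_ge0_le0.
by rewrite E.
Qed.

(** The value is forced once the simple roots get 1: strip a simple root and divide by [s]. The
    simple root is picked arbitrarily, and [coc_pos_simple] shows that the choice is immaterial. The
    fuel is the height minus one. *)
Fixpoint coc_rec (n : nat) (u : 'rV[int]_l) : K :=
  if n is n'.+1 then
    if [pick i | `[< rt (u - dl i) >]] is Some i then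
      coc_rec n' (u - dl i) / s (u - dl i) (dl i) else 1
  else 1.
Definition coc_pos u := coc_rec `|ht u|.-1 u.

Lemma coc_simple i : coc_pos (dl i) = 1.
Proof. by rewrite /coc_pos htdl. Qed.

Lemma coc_posE u : rt u -> 1 < ht u ->
  exists2 i, rt (u - dl i) & coc_pos u = coc_pos (u - dl i) / s (u - dl i) (dl i).
Proof.
move=> ru hu; rewrite {1}/coc_pos.
have -> : `|ht u|.-1 = (`|ht u|.-2).+1 by lia.
rewrite /=; case: pickP => [i /asboolP ri|H].
  exists i => //; congr (_ / _); rewrite /coc_pos htD htN htdl; congr (coc_rec _ _).
  by lia.
by have [i ri] := rt_descent ru hu; move: (H i) => /asboolP.
Qed.

Lemma q_of_rtD u v : rt u -> rt v -> rt (u + v) -> q u v = -1.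
Proof.
move=> ru rv /rt2; rewrite !qDl !qDr rt2// (rt2 rv) [q v u]qC; lia.
Qed.
Lemma q_of_rtB u v : rt u -> rt v -> rt (u - v) -> q u v = 1.
Proof. by move=> ru rv /(q_of_rtD ru (rtN rv)); rewrite qNr; lia. Qed.

(** Let $j$ be the simple root picked for $u+\alpha_i$. If $\alpha_i,\alpha_j$ are not orthogonal,
    then $q(u,\alpha_j)=2$ and $u=\alpha_j$. Otherwise both paths from $d=u-\alpha_j$ to
    $d+\alpha_i+\alpha_j$ pass through roots; induction applies at $d$, and [sT] compares the
    paths. *)
Lemma coc_pos_simple n u i : rt u -> ht u = n.+1%:Z -> q u (dl i) = -1 ->
  coc_pos u = s u (dl i) * coc_pos (u + dl i).
Proof.
elim/ltn_ind: n u i => n IH u i ru hu qu; have rg := rtD ru (rt_base i) qu.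
have hg : 1 < ht (u + dl i) by rewrite htD htdl hu; lia.
have [j rj ->] := coc_posE rg hg.
have [ji|ji] := eqVneq j i.
  by rewrite ji addrK mulrC divfK// s0.
have qgj := q_of_rtB rg (rt_base j) rj; rewrite qDl in qgj.
case: (q_base ji); rewrite qC => qij; rewrite qij in qgj; last first.
  have uj : u = dl j by apply: rt_eq2 => //; lia.
  have -> : u + dl i - dl j = dl i by rewrite uj addrAC subrr add0r.
  rewrite uj !coc_simple (sC (rt_base i) (rt_base j) qij) mul1r mulfV//.
  by apply: s0 => //; rewrite qC.
have quj : q u (dl j) = 1 by lia.
have rd := rtB ru (rt_base j) quj; set d := u - dl j in rd.
have ud : u = d + dl j by rewrite subrK.
have hd0 := rt_ht rd; have hd : ht d = n%:Z by rewrite /d htD htN htdl hu; lia.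
case: n hu hd IH => [|n] hu hd IH; first by move: hd0; rewrite hd.
have qdi : q d (dl i) = -1 by rewrite /d qDl qNl qu [q (dl j) _]qC qij; lia.
have qdj : q d (dl j) = -1 by rewrite /d qDl qNl quj rt2//; lia.
have -> : u + dl i - dl j = d + dl i by rewrite /d addrAC.
clearbody d; subst u.
have Ei := IH n (leqnn _) d i rd hd qdi.
have Ej := IH n (leqnn _) d j rd hd qdj.
have rdi := rtD rd (rt_base i) qdi.
have qji : q (dl j) (dl i) = 0 by rewrite qC.
have n1 := s0 rd (rt_base i) qdi; have n2 := s0 rd (rt_base j) qdj.
have n3 : s (d + dl i) (dl j) != 0 by apply: s0 => //; rewrite qDl qij qdj.
have n4 : s (d + dl j) (dl i) != 0 by apply: s0.
have Tij := sT (rt_base i) rd (rt_base j); rewrite qC qdi qdj qij in Tij.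
have {}Tij := Tij erefl erefl erefl.
rewrite [s (dl i) d]sC// in Tij; last by rewrite qC.
rewrite [dl i + d]addrC in Tij.
rewrite [s (dl i) (d + dl j)]sC// in Tij; last by rewrite qC.
apply: (mulfI n2); rewrite -Ej Ei [RHS]mulrA -Tij; field.
exact: n3.
Qed.

(** On negative roots the value is forced by $c_uc_{-u}=r_u$. *)
Definition coc u := if 0 < ht u then coc_pos u else r u / coc_pos (- u).

Lemma coc_pos_neq0 n u : rt u -> ht u = n.+1%:Z -> coc_pos u != 0.
Proof.
elim: n u => [|n IH] u ru hu; first by rewrite /coc_pos hu oner_eq0.
have hg : 1 < ht u by rewrite hu.
have [j rj ->] := coc_posE ru hg; rewrite mulf_neq0 ?invr_neq0//; last first.
  by apply: s0 => //; rewrite qDl qNl (q_of_rtB ru (rt_base j) rj) rt2.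
by apply: IH => //; rewrite htD htN htdl hu; lia.
Qed.

Lemma ht_nat u : 0 < ht u -> exists n, ht u = n.+1%:Z.
Proof. by move=> h; exists `|ht u|.-1; lia. Qed.

Lemma coc_opp u : rt u -> coc u * coc (- u) = r u.
Proof.
move=> ru; have h0 := rt_ht ru; rewrite /coc htN.
case: (ltgtP (ht u) 0) => [hu|hu|hu]; last by rewrite hu in h0.
  have -> : 0 < - ht u by lia.
  rewrite divfK//; have [|n hn] := @ht_nat (- u); first by rewrite htN; lia.
  by apply: coc_pos_neq0 hn; apply: rtN.
have -> : (0 < - ht u) = false by lia.
rewrite opprK rN// mulrC divfK//; have [n hn] := ht_nat hu.
by apply: coc_pos_neq0 hn.
Qed.

Lemma coc_neq0 u : rt u -> coc u != 0.
Proof.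
move=> ru; have := r0 ru; rewrite -(coc_opp ru); apply: contra_neq => ->.
by rewrite mul0r.
Qed.

(** The wanted identity with the second root fixed. This form can be propagated from simple roots to
    sums and negatives, the first root staying arbitrary. *)
Let good v := forall u, rt u -> q u v = -1 -> coc u * coc v = s u v * coc (u + v).

Lemma coc_good_simple i : good (dl i).
Proof.
move=> u ru qu; have rg := rtD ru (rt_base i) qu; have h0 := rt_ht ru; have h1 := rt_ht rg.
have -> : coc (dl i) = 1 by rewrite /coc htdl coc_simple.
rewrite mulr1; case: (ltgtP (ht u) 0) => [hu|hu|hu]; last by rewrite hu in h0.
  rewrite /coc.
  have -> : (0 < ht u) = false by lia.
  have -> : (0 < ht (u + dl i)) = false by move: h1; rewrite htD htdl; lia.
  (* For a negative [u] the positive root $a=-(u+\alpha_i)$ satisfies $a+\alpha_i=-u$; the known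
     identity for [a] is transported back by [sr]. *)
  set a := - (u + dl i); have ra : rt a by apply: rtN.
  have ua : - u = a + dl i by rewrite /a opprD subrK.
  have ha : 0 < ht a by move: h1; rewrite /a htN htD htdl; lia.
  have qa : q a (dl i) = -1 by rewrite /a qNl qDl qu rt2//; lia.
  have [n hn] := ht_nat ha; have E := coc_pos_simple ra hn qa.
  have ca := coc_pos_neq0 ra hn.
  have := sr ru (rt_base i) qu; rewrite -/a => E2.
  have E3 : s a (dl i) * r u = s u (dl i) * r (u + dl i) by rewrite E2 [s a _]sC.
  rewrite ua mulrA -E3; have := E => E4.
  have cn : coc_pos (a + dl i) != 0 by apply: contra_neq ca => c0; rewrite E c0 mulr0.
  have sn := s0 ra (rt_base i) qa.
  rewrite E; field; exact/andP.
rewrite /coc hu; have -> : 0 < ht (u + dl i) by rewrite htD htdl; lia.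
by have [n hn] := ht_nat hu; apply: coc_pos_simple hn qu.
Qed.

(** The hypothesis is applied to $u-v$ and combined with [sR], which says that adding $v$ and then
    $-v$ multiplies by $r_v$. *)
Lemma coc_good_opp v : rt v -> good v -> good (- v).
Proof.
move=> rv gv u ru qu; have quv : q u v = 1 by move: qu; rewrite qNr; lia.
have ru0 := rtB ru rv quv; set u0 := u - v in ru0 *.
have q0 : q u0 v = -1 by rewrite /u0 qDl qNl quv rt2//; lia.
have E := gv u0 ru0 q0; have uE : u0 + v = u by rewrite subrK.
rewrite uE in E; have R := sR ru0 rv q0; rewrite uE in R.
have O := coc_opp rv; have cv := coc_neq0 rv.
apply: (mulfI (s0 ru0 rv q0)); rewrite !mulrA R -E -O -/u0; ring.
Qed.

(** The pairings of [u] with [v1] and [v2] lie between $-2$ and 2 and add up to $-1$. Up to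
    exchanging [v1] and [v2] they are $(-1,0)$, handled by two additions and [sT], or $(-2,1)$,
    where [u] is the opposite of a summand. *)
Lemma coc_goodD v1 v2 : rt v1 -> rt v2 -> q v1 v2 = -1 -> good v1 -> good v2 -> good (v1 + v2).
Proof.
move=> r1 r2 q12 g1 g2 u ru qu; rewrite qDr in qu.
have r12 := rtD r1 r2 q12; have E12 := g2 v1 r1 q12; have n12 := s0 r1 r2 q12.
have q21 : q v2 v1 = -1 by rewrite qC.
apply: (mulfI n12); rewrite mulrCA -E12.
have l1 := rt_le2 ru r1; have l2 := rt_le2 ru r2.
have l1' := rt_le2 ru (rtN r1); have l2' := rt_le2 ru (rtN r2); rewrite !qNr in l1' l2'.
have key a b : rt a -> rt b -> q a b = -1 -> good a -> good b -> q u a = -1 -> q u b = 0 ->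
    coc u * (coc a * coc b) = s a b * (s u (a + b) * coc (u + (a + b))).
  move=> ra rb qab ga gb ua ub; have rua := rtD ru ra ua.
  have quab : q (u + a) b = -1 by rewrite qDl ub qab.
  rewrite mulrA (ga u)// -mulrA (gb (u + a))// addrA !mulrA; congr (_ * _).
  by rewrite sT//.
have keyO a b : rt a -> rt b -> q a b = -1 -> good a -> good b -> q u a = -2 ->
    coc u * (coc a * coc b) = s a b * (s u (a + b) * coc (u + (a + b))).
  move=> ra rb qab ga gb ua.
  have uE : u = - a by apply: rt_eq2 => //; [exact: rtN|rewrite qNr ua].
  rewrite uE addrA addNr add0r mulrA [coc (- a) * _]mulrC coc_opp// mulrA; congr (_ * _).
  have qba : q b a = -1 by rewrite qC.
  have rab := rtD ra rb qab.
  rewrite -(sR rb ra qba) [s b a]sC// [b + a]addrC; congr (_ * _).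
  by apply: sC => //; [exact: rtN|rewrite qNr qDl rt2// qba].
have [E|E] := eqVneq (q u v1) (-2).
  exact: keyO.
have [E0|E0] := eqVneq (q u v1) (-1); first by apply: key => //; lia.
have [E1|E1] := eqVneq (q u v1) 0.
  rewrite [coc v1 * _]mulrC [s v1 v2]sC// [v1 + v2]addrC; apply: key => //; lia.
rewrite [coc v1 * _]mulrC [s v1 v2]sC// [v1 + v2]addrC; apply: keyO => //; lia.
Qed.

Lemma coc_good v : rt v -> good v.
Proof.
have pos n : forall v, rt v -> ht v = n.+1%:Z -> good v.
  elim: n => [|n IH] {}v rv hv.
    have [i vi] : exists i, 0 < q v (dl i).
      apply: contrapT => H; have := rt2 rv; rewrite qformE => E.
      have v0 : forall i, 0 <= v 0 i.
        case: (rt_sign rv) => // v0; have : ht v <= 0 by apply: sumr_le0.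
        by rewrite hv.
      have : \sum_i v 0 i * q v (dl i) <= 0.
        apply: sumr_le0 => i _; apply: mulr_ge0_le0 => //.
        by rewrite leNgt; apply/negP => qi; apply: H; exists i.
      by rewrite E.
    have l2 := rt_le2 rv (rt_base i).
    have [q1|q1] := eqVneq (q v (dl i)) 1.
      by have := rt_ht (rtB rv (rt_base i) q1); rewrite htD htN htdl hv.
    have -> : v = dl i by apply: rt_eq2 => //; lia.
    exact: coc_good_simple.
  have hg : 1 < ht v by rewrite hv.
  have [i ri] := rt_descent rv hg.
  rewrite -(subrK (dl i) v); apply: coc_goodD => //.
  - by rewrite qDl qNl (q_of_rtB rv (rt_base i) ri) rt2.
  - by apply: IH => //; rewrite htD htN htdl hv; lia.
  - exact: coc_good_simple.
move=> rv; have h0 := rt_ht rv; case: (ltgtP (ht v) 0) => [hv|hv|hv]; last by rewrite hv in h0.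
  rewrite -(opprK v); apply: coc_good_opp; first exact: rtN.
  have [|n hn] := @ht_nat (- v); first by rewrite htN; lia.
  by apply: pos hn; apply: rtN.
by have [n hn] := ht_nat hv; apply: pos hn.
Qed.

Lemma cocycle_exists : exists c : 'rV[int]_l -> K,
  (forall u, rt u -> c u * c (- u) = r u) /\
  (forall u v, rt u -> rt v -> q u v = -1 -> c u * c v = s u v * c (u + v)).
Proof. by exists coc; split=> [u|u v ru rv]; [exact: coc_opp|exact: coc_good]. Qed.

End Cocycle.

Lemma eigen_indep (K : fieldType) (V : lmodType K) (I : eqType) (L : V -> V) (mu : I -> K)
    (v : I -> V) (s : seq I) : linear L -> uniq s ->
  {in s &, injective mu} -> {in s, forall i, L (v i) = mu i *: v i} ->
  \sum_(i <- s) v i = 0 -> {in s, forall i, v i = 0}.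
Proof.
move=> lL; elim: s v => [|j s IH] v //= /andP[js us] imu Lv.
rewrite big_cons => E.
have E2 : \sum_(i <- s) (mu i - mu j) *: v i = 0.
  transitivity (\sum_(i <- s) L (v i) - mu j *: \sum_(i <- s) v i).
    rewrite scaler_sumr -sumrB big_seq [RHS]big_seq; apply: eq_bigr => i si.
    by rewrite Lv ?inE ?si ?orbT// scalerBl.
  rewrite -(linsum lL); have -> : \sum_(i <- s) v i = - v j.
    by apply/eqP; rewrite -addr_eq0 addrC E.
  by rewrite (linN lL) Lv ?inE ?eqxx// scalerN subrr.
have vs0 : {in s, forall i, v i = 0}.
  have := IH (fun i => (mu i - mu j) *: v i) us _ _ E2 => H i si.
  have := H _ _ i si; move=> H2.
  have /eqP : (mu i - mu j) *: v i = 0.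
    apply: H2 => [a b sa sb|a sa]; first by apply: imu; rewrite inE ?sa ?sb orbT.
    by rewrite (linZ lL) Lv ?inE ?sa ?orbT// !scalerA mulrC.
  rewrite scaler_eq0 subr_eq0 => /orP[/eqP mij|/eqP //].
  by move: js; rewrite -(imu i j _ _ mij) ?si// inE ?si ?eqxx ?orbT.
move: E; rewrite big_seq big1 ?addr0 => [vj|i si]; last exact: vs0.
by move=> i; rewrite inE => /orP[/eqP->//|]; apply: vs0.
Qed.

(** * Root spaces and structure constants *)

Section LieFacts.
Variables (R : realType).
Local Notation C := R[i].
Variables (G : vectType C) (br : {bilinear G -> G -> G}) (form : {biscalar G}).
Variables (h : {vspace G}) (x : subvs_of h -> G) (eps : subvs_of h -> subvs_of h -> C).
Local Notation H := (subvs_of h).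
Local Notation "<< a , b >>" := (hform form a b).
Local Notation root := (is_root br form).
Hypothesis Hlie : lie_bracket br.
Hypothesis Hinv : invariant_form br form.
Hypothesis Hcar : cartan_subalgebra br h.
Hypothesis Hnorm : forall al : H, root al -> <<al, al>> = 2.
Hypothesis Hx : root_vector_choice br form x.
Hypothesis Heps : structure_constants br form x eps.

Let brr (y : G) : linear (br y). Proof. exact: linearPr. Qed.
Let brl (y : G) : linear (br^~ y). Proof. by move=> c u v; rewrite linearPl. Qed.
Let fr (y : G) : linear (form y : G -> C^o). Proof. exact: linearPr. Qed.
Let fl (y : G) : linear (form^~ y : G -> C^o). Proof. by move=> c u v; rewrite linearPl. Qed.

Lemma brC y z : br y z = - br z y.
Proof.
have [b0 _] := Hlie; have := b0 (y + z).
rewrite (linD (brr _)) (linD (brl y)) (linD (brl z)) !b0 add0r addr0 => /eqP.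
by rewrite addrC addr_eq0 => /eqP.
Qed.

Lemma jacobi y z w : br y (br z w) = br (br y z) w + br z (br y w).
Proof.
have [_ J] := Hlie; have /eqP := J y z w.
rewrite -addrA addr_eq0 => /eqP ->.
by rewrite [br w (br y z)]brC [br w y]brC (linN (brr z)) opprD !opprK addrC.
Qed.

Lemma inv_formC y z : form y z = form z y. Proof. by have [-> _ _] := Hinv. Qed.
Lemma form_inv y z w : form (br y z) w = form y (br z w).
Proof. by have [_ -> _] := Hinv. Qed.
Lemma form_nondeg y : (forall z, form y z = 0) -> y = 0.
Proof. by have [_ _] := Hinv; apply. Qed.

Lemma hformDr (a b c : H) : <<a, b + c>> = <<a, b>> + <<a, c>>.
Proof. by rewrite /hform !linearD. Qed.
Lemma hformDl (a b c : H) : <<a + b, c>> = <<a, c>> + <<b, c>>.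
Proof. by rewrite /hform linearD linearDl. Qed.
Lemma hformC (a b : H) : <<a, b>> = <<b, a>>. Proof. exact: inv_formC. Qed.

Definition weight_vector (v : G) := forall a, a \in h -> exists c, br a v = c *: v.

(** Simultaneous diagonalization along a finite list: a vector is cut into eigencomponents for one
    more element [a], and the components remain eigenvectors for the earlier elements because these
    commute with [a]. *)
Lemma weight_sums (s : seq G) : {in s, forall a, a \in h} -> forall y : G,
  exists t : seq G, y = \sum_(v <- t) v /\
    {in t, forall v, {in s, forall a, exists c, br a v = c *: v}}.
Proof.
have [hab _ hdiag] := Hcar.
elim: s => [_ y|a s IH ash y].
  by exists [:: y]; rewrite big_seq1; split.
have [|t [-> tP]] := IH _ y; first by move=> b bs; apply: ash; rewrite inE bs orbT.
have ah : a \in h by apply: ash; rewrite inE eqxx.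
have [X bX XP] := hdiag a ah.
have /choice[ev evP] v : exists c, v \in X -> br a v = c *: v.
  by have [/XP[c cP]|] := boolP (v \in X); [exists c|exists 0].
have step v : {in s, forall a, exists c, br a v = c *: v} ->
  exists t' : seq G, v = \sum_(u <- t') u /\
    {in t', forall u, {in a :: s, forall a, exists c, br a u = c *: u}}.
  move=> vP; pose cs := undup (map ev X).
  pose part c := \sum_(i < size X | ev X`_i == c) coord (in_tuple X) i v *: X`_i.
  have partE : v = \sum_(c <- cs) part c.
    rewrite {1}(coord_basis (X := in_tuple X) (U := fullv) bX (memvf v)).
    rewrite /part (exchange_big_dep xpredT)//=; apply: eq_bigr => i _.
    rewrite [RHS]big_mkcond (bigD1_seq (ev X`_i)) ?undup_uniq//=; last first.
      by rewrite mem_undup map_f// mem_nth.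
    by rewrite eqxx big1 ?addr0// => c /negPf; rewrite eq_sym => ->.
  have partA c : br a (part c) = c *: part c.
    rewrite (linsum (brr a)) scaler_sumr; apply: eq_bigr => i /eqP <-.
    by rewrite (linZ (brr a)) evP ?mem_nth// !scalerA mulrC.
  exists (map part cs); split; first by rewrite big_map.
  move=> _ /mapP[c ccs ->] b; rewrite inE => /orP[/eqP->|bs].
    by exists c; apply: partA.
  have [t0 t0P] := vP b bs; exists t0; apply/eqP; rewrite -subr_eq0; apply/eqP.
  have bh : b \in h by apply: ash; rewrite inE bs orbT.
  (* The vectors $[b,v_c]-t_0v_c$ are eigenvectors of [a] with distinct eigenvalues $c$ and sum
     $[b,v]-t_0v=0$, so each vanishes. *)
  apply: (@eigen_indep _ _ _ (br a) id (fun c => br b (part c) - t0 *: part c) cs) => //.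
  - exact: undup_uniq.
  - move=> d _; rewrite (linB (brr a)) (linZ (brr a)) partA scalerBr.
    rewrite jacobi (hab a b)// (lin0 (brl _)) add0r partA (linZ (brr b)).
    by rewrite !scalerA [t0 * d]mulrC.
  by rewrite sumrB -(linsum (brr b)) -scaler_sumr -partE t0P subrr.
elim: t tP => [_|v t IHt tP].
  by exists [::]; rewrite !big_nil.
have [|t1 [E1 P1]] := IHt; first by move=> u ut; apply: tP; rewrite inE ut orbT.
have [|t2 [E2 P2]] := step v; first by apply: tP; rewrite inE eqxx.
exists (t2 ++ t1); split; first by rewrite big_cons big_cat /= -E1 -E2.
by move=> u; rewrite mem_cat => /orP[/P2|/P1].
Qed.

Lemma weight_decomp y : exists t : seq G, y = \sum_(v <- t) v /\ {in t, forall v, weight_vector v}.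
Proof.
have [|t [E tP]] := weight_sums (s := vbasis h) _ y; first by move=> a; apply: vbasis_mem.
exists t; split=> // v vt a ah.
have /choice[c cP] i : exists c, br (vbasis h)`_i v = c *: v.
  have [il|il] := ltnP i (size (vbasis h)); first by apply: (tP v vt); apply: mem_nth.
  by exists 0; rewrite nth_default// (lin0 (brl _)) scale0r.
exists (\sum_(i < \dim h) coord (vbasis h) i a * c i).
rewrite {1}(coord_vbasis ah) (linsum (brl v)) scaler_suml; apply: eq_bigr => i _.
by rewrite (linZ (brl v)) cP scalerA.
Qed.

Lemma weight_pairing v : weight_vector v -> v != 0 ->
  exists2 y, weight_vector y & form v y != 0.
Proof.
move=> wv v0; apply: contrapT => N; move/eqP: v0; apply; apply: form_nondeg => y.
have [t [-> tP]] := weight_decomp y; rewrite (linsum (fr v)) big_seq big1// => u ut.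
by apply/eqP; apply/negPn/negP => vu; apply: N; exists u => //; apply: tP.
Qed.

Lemma bracket_opposite v y (la : G -> C) : (forall a, a \in h -> br a v = la a *: v) ->
  weight_vector y -> form v y != 0 ->
  (forall a, a \in h -> br a y = - la a *: y) /\ br v y \in h.
Proof.
move=> lav wy vy; have [_ hcent _] := Hcar.
have my a : a \in h -> br a y = - la a *: y.
  move=> ah; have [c cP] := wy a ah; rewrite cP; congr (_ *: _).
  have := form_inv v a y; rewrite brC lav// (linN (fl y)) (linZ (fl y)) cP (linZ (fr v)).
  by rewrite /GRing.scale /= -mulNr => /(mulIf vy).
split=> //; apply: hcent => a ah.
by rewrite jacobi (lav a ah) (my a ah) (linZ (brl y)) (linZ (brr v)) scaleNr subrr.
Qed.

(** The weight is represented by $\beta=[v,y]/\langle v,y\rangle$ for a weight vector $y$ pairing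
    with $v$: invariance gives $\langle a,[v,y]\rangle=\langle[a,v],y\rangle$. *)
Lemma weight_root v : weight_vector v -> v != 0 -> v \in h \/ exists be : H, root_vector br form be v /\ be != 0.
Proof.
move=> wv v0; have [_ hcent _] := Hcar.
have /choice[la laP] a : exists c, a \in h -> br a v = c *: v.
  by have [/wv[c cP]|] := boolP (a \in h); [exists c|exists 0].
have [z0|N] := pselect (forall a, a \in h -> br a v = 0); first by left; apply: hcent.
right; have [y wy vy] := weight_pairing wv v0.
have [_ vyh] := bracket_opposite laP wy vy.
pose be : H := (form v y)^-1 *: vsproj h (br v y).
have beE a : a \in h -> form a (vsval be) = la a.
  have vbe : vsval be = (form v y)^-1 *: br v y by rewrite /be linearZ /= vsprojK.
  move=> ah; rewrite vbe (linZ (fr a)) -form_inv laP// (linZ (fl y)).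
  by rewrite /GRing.scale /= mulrCA mulVf ?mulr1.
have bev (a : H) : br (vsval a) v = << a, be >> *: v.
  by rewrite /hform beE ?subvsP// laP// subvsP.
exists be; split; first by split.
apply/eqP => be0; apply: N => a ah; rewrite laP// -beE// be0.
by rewrite !linear0 scale0r.
Qed.

(** An [a] orthogonal to $\underline h$ is orthogonal to each root vector $v$ too:
    $0=\langle[a,\beta],v\rangle=\langle a,[\beta,v]\rangle=2\langle a,v\rangle$. Nondegeneracy on
    $\mathcal G$ concludes. *)
Lemma hform_nondeg (a : G) : a \in h -> (forall b, b \in h -> form a b = 0) -> a = 0.
Proof.
move=> ah a0; apply: form_nondeg => y; have [t [-> tP]] := weight_decomp y.
rewrite (linsum (fr a)) big_seq big1// => v vt.
have [->|v0] := eqVneq v 0; first exact: lin0 (fr a).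
have [vh|[be [[_ bev] be0]]] := weight_root (tP v vt) v0; first exact: a0.
have rbe : root be by split=> //; exists v.
have [hab _ _] := Hcar.
have := form_inv a (vsval be) v; rewrite hab ?subvsP// (lin0 (fl v)) bev Hnorm//.
by rewrite (linZ (fr a)) => /esym/eqP; rewrite scaler_eq0 pnatr_eq0 /= => /eqP.
Qed.

Lemma hform_inj (a b : H) : (forall c : H, <<c, a>> = <<c, b>>) -> a = b.
Proof.
move=> ab; apply/val_inj/eqP; rewrite -subr_eq0; apply/eqP; apply: hform_nondeg.
  by rewrite rpredB ?subvsP.
move=> c ch; rewrite inv_formC (linB (fr c)).
by have := ab (vsproj h c); rewrite /hform vsprojK// => ->; rewrite subrr.
Qed.

Definition wt (be : H) (z : G) := forall a : H, br (vsval a) z = <<a, be>> *: z.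

Lemma wt_weight be z : wt be z -> weight_vector z.
Proof. by move=> wz a ah; exists << vsproj h a, be>>; rewrite -wz vsprojK. Qed.

Lemma root_wt (al : H) : root al -> wt al (x al).
Proof. by case/Hx => -[_]. Qed.
Lemma x_neq0 (al : H) : root al -> x al != 0.
Proof. by case/Hx => -[]. Qed.

Lemma wt_bracket al z y : wt al z -> wt (- al) y -> br z y = form z y *: vsval al.
Proof.
move=> wz wy; have [_ hcent _] := Hcar.
have zyh : br z y \in h.
  apply: hcent => a ah; have := wz (vsproj h a); have := wy (vsproj h a).
  rewrite vsprojK// hformNr => E1 E2.
  by rewrite jacobi E1 E2 (linZ (brl y)) (linZ (brr z)) scaleNr subrr.
apply/eqP; rewrite -subr_eq0; apply/eqP/hform_nondeg.
  by rewrite rpredB// rpredZ// subvsP.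
move=> b bh; rewrite inv_formC (linB (fr b)) (linZ (fr b)) -form_inv.
have := wz (vsproj h b); rewrite vsprojK// => ->.
by rewrite (linZ (fl y)) /hform vsprojK// /GRing.scale /= mulrC subrr.
Qed.

Lemma wt_orth be ga z y : wt be z -> wt ga y -> be + ga != 0 -> form z y = 0.
Proof.
move=> wz wy bg; apply/eqP; apply: contraNT bg => zy; apply/eqP.
apply: hform_inj => a; rewrite hform0r hformDr.
have := form_inv z (vsval a) y; rewrite brC wz wy (linN (fl y)) (linZ (fl y)) (linZ (fr z)).
by rewrite /GRing.scale /= -mulNr => /(mulIf zy) <-; rewrite subrr.
Qed.

Lemma wt_h (a : G) : a \in h -> wt 0 a.
Proof. by move=> ah b; have [hab _ _] := Hcar; rewrite hab ?subvsP// hform0r scale0r. Qed.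

(* sl2-theory: the vectors e^n v have distinct weights, so some e^n v vanishes. *)
Lemma lowest_weight (ga : H) (e f v : G) (ka mu : C) :
  <<ga, ga>> = 2 -> wt ga e -> br e f = ka *: vsval ga -> ka != 0 ->
  br (vsval ga) v = mu *: v -> br f v = 0 -> v != 0 -> exists n : nat, mu = - n%:R.
Proof.
move=> ga2 we ef ka0 mv fv v0; apply: contrapT => N.
pose E n := iter n (br e) v; have ES n : E n.+1 = br e (E n) by [].
have EZ : E 0%N = v by [].
have gE n : br (vsval ga) (E n) = (mu + (2 * n)%:R) *: E n.
  elim: n => [|n IH]; first by rewrite addr0.
  rewrite ES jacobi we ga2 IH (linZ (brl _)) (linZ (brr e)) -scalerDl.
  by congr (_ *: _); rewrite mulnS natrD; ring.
have fE n : br f (E n.+1) = (- ka * n.+1%:R * (mu + n%:R)) *: E n.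
  elim: n => [|n IH].
    rewrite ES EZ jacobi fv (lin0 (brr e)) addr0 [br f e]brC ef (linN (brl v)) (linZ (brl v)) mv.
    by rewrite scalerA -scaleNr addr0 mulr1 mulNr.
  rewrite (ES n.+1) jacobi [br f e]brC ef (linN (brl _)) (linZ (brl _)) gE IH (linZ (brr e)).
  rewrite -ES scalerA -scaleNr -scalerDl; congr (_ *: _).
  by rewrite natrM -[n.+2]addn2 -[n.+1]addn1 !natrD; ring.
have E0 n : E n != 0.
  elim: n => // n IH; apply/eqP => En; have := fE n; rewrite En (lin0 (brr f)) => /esym/eqP.
  rewrite scaler_eq0 (negPf IH) orbF !mulf_eq0 oppr_eq0 (negPf ka0) pnatr_eq0 /=.
  by rewrite addr_eq0 => /eqP mun; apply: N; exists n.
have fr' : free [seq E i | i <- iota 0 (\dim {:G}).+1].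
  set s := [seq E i | i <- _]; apply/(@freeP _ _ _ (in_tuple s)) => k /= sk i.
  have sz : size s = (\dim {:G}).+1 by rewrite size_map size_iota.
  have si (j : 'I_(size s)) : s`_j = E j.
    by rewrite (nth_map 0%N) ?nth_iota ?size_iota -?sz.
  have := @eigen_indep _ _ _ (br (vsval ga)) (fun j : 'I_(size s) => mu + (2 * j)%:R)
     (fun j => k j *: E j) (index_enum _) (brr _) (index_enum_uniq _).
  move=> H; have /eqP : k i *: E i = 0.
    apply: H; last exact: mem_index_enum.
    - move=> j1 j2 _ _ /addrI/eqP; rewrite eqr_nat eqn_mul2l /= => /eqP jj; exact: val_inj.
    - by move=> j _; rewrite (linZ (brr _)) gE !scalerA mulrC.
    - by rewrite -[RHS]sk; apply: eq_bigr => j _; rewrite si.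
  by rewrite scaler_eq0 (negPf (E0 i)) orbF => /eqP.
have := dimvS (subvf <<[seq E i | i <- iota 0 (\dim {:G}).+1]>>).
by move: fr'; rewrite /free => /eqP ->; rewrite size_map size_iota ltnn.
Qed.

Lemma root_pairing (al : H) : root al -> exists2 y, wt (- al) y & form (x al) y != 0.
Proof.
move=> ra; have wx := root_wt ra; have [y wy xy] := weight_pairing (wt_weight wx) (x_neq0 ra).
exists y => //; have laP (a : G) : a \in h -> br a (x al) = << vsproj h a, al>> *: x al.
  by move=> ah; rewrite -wx vsprojK.
have [my _] := bracket_opposite laP wy xy.
by move=> a; rewrite my ?subvsP// vsvalK hformNr.
Qed.

Lemma root_opp (al : H) : root al -> root (- al).
Proof.
move=> ra; have [y wy xy] := root_pairing ra; split; first by rewrite oppr_eq0; case: ra.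
exists y; split=> //; apply: contra_neq xy => ->; exact: lin0 (fr _).
Qed.

(** Subtract the multiple of $x_\alpha$ that makes the difference orthogonal to a vector $y$ of
    weight $-\alpha$. Then $y$ kills the difference; were it nonzero, it would be a lowest weight
    vector with the positive eigenvalue 2. *)
Lemma root_space_dim1 (al : H) z : root al -> wt al z -> exists c, z = c *: x al.
Proof.
move=> ra wz; have [y wy xy] := root_pairing ra; have wx := root_wt ra.
exists (form z y / form (x al) y); apply/eqP; rewrite -subr_eq0; apply/eqP.
set c := _ / _; set z' := z - _.
have wz' : wt al z'.
  by move=> a; rewrite /z' (linB (brr _)) (linZ (brr _)) wz wx scalerBr !scalerA mulrC.
have zy0 : form z' y = 0.
  by rewrite /z' (linB (fl y)) (linZ (fl y)) /GRing.scale /= /c divfK ?subrr.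
apply/eqP/negPn/negP => z0.
have H2 : br (vsval al) z' = 2 *: z' by rewrite wz' Hnorm.
have H3 : br y z' = 0 by rewrite brC (wt_bracket wz' wy) zy0 scale0r oppr0.
have [n /eqP] := lowest_weight (Hnorm ra) wx (wt_bracket wx wy) xy H2 H3 z0.
by rewrite -subr_eq0 opprK -natrD pnatr_eq0.
Qed.

Lemma form_root_neq0 (al : H) : root al -> form (x al) (x (- al)) != 0.
Proof.
move=> ra; have [y wy xy] := root_pairing ra.
have [c yE] := root_space_dim1 (root_opp ra) wy; move: xy; rewrite yE (linZ (fr _)).
by apply: contra_neq => ->; rewrite scaler0.
Qed.

(** In the triple for $-\alpha$ the lowering element is $x_\alpha$. If it killed $x_\beta$, the
    eigenvalue $-\langle\alpha,\beta\rangle$ would be a lowest weight, hence nonpositive. *)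
Lemma bracket_neg (al be : H) (z : nat) : root al -> root be -> <<al, be>> = - z.+1%:R ->
  br (x al) (x be) != 0.
Proof.
move=> ra rb ab; apply/eqP => b0; have rn := root_opp ra.
have wn := root_wt rn; have w0 := root_wt ra.
have E : br (x (- al)) (x al) = form (x (- al)) (x al) *: vsval (- al).
  by apply: wt_bracket => //; rewrite opprK.
have H2 : br (vsval (- al)) (x be) = z.+1%:R *: x be by rewrite (root_wt rb) hformNl ab opprK.
have nz : form (x (- al)) (x al) != 0 by rewrite inv_formC form_root_neq0.
have [n] := @lowest_weight (- al) _ (x al) (x be) _ _ (Hnorm rn) wn E nz H2 b0 (x_neq0 rb).
by move=> /eqP; rewrite -subr_eq0 opprK -natrD pnatr_eq0.
Qed.

Lemma wtD be ga z y : wt be z -> wt ga y -> wt (be + ga) (br z y).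
Proof.
move=> wz wy a; rewrite jacobi wz wy (linZ (brl y)) (linZ (brr z)) -scalerDl.
by rewrite hformDr.
Qed.

Lemma rootD_neg (al be : H) (z : nat) : root al -> root be -> <<al, be>> = - z.+1%:R ->
  al + be != 0 -> root (al + be).
Proof.
move=> ra rb ab ab0; split=> //; exists (br (x al) (x be)); split.
  exact: bracket_neg ab.
exact: wtD (root_wt ra) (root_wt rb).
Qed.

Lemma rootD_pair (al be : H) : root al -> root be -> root (al + be) -> <<al, be>> = -1.
Proof.
move=> ra rb /Hnorm; rewrite hformDr !hformDl !Hnorm// [<<be, al>>]hformC => E.
set t := <<al, be>> in E *; have : (t + 1) * 2 = 0.
  transitivity (2 + t + (t + 2) - 2); first by ring.
  by rewrite E subrr.
by move=> /eqP; rewrite mulf_eq0 pnatr_eq0 orbF addr_eq0 => /eqP.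
Qed.

Lemma bracket_not_root (al be : H) : root al -> root be -> ~ root (al + be) -> al + be != 0 ->
  br (x al) (x be) = 0.
Proof.
move=> ra rb nab ab0; apply/eqP/negPn/negP => b0; apply: nab; split=> //.
by exists (br (x al) (x be)); split=> //; apply: wtD; apply: root_wt.
Qed.

Lemma bracket_opp (al : H) : root al -> br (x al) (x (- al)) = form (x al) (x (- al)) *: vsval al.
Proof. by case/Hx. Qed.

Lemma eps_neq0 (al be : H) : root al -> root be -> root (al + be) -> eps al be != 0.
Proof.
move=> ra rb rab; apply/eqP => e0; have /eqP := Heps ra rb rab; rewrite e0 scale0r.
by apply/negP; apply: (@bracket_neg _ _ 0); rewrite ?rootD_pair.
Qed.

Lemma x_cancel (al : H) c d : root al -> c *: x al = d *: x al -> c = d.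
Proof.
move=> /x_neq0 xn /eqP; rewrite -subr_eq0 -scalerBl scaler_eq0 (negPf xn) orbF subr_eq0.
by move=> /eqP.
Qed.

Lemma epsC (al be : H) : root al -> root be -> root (al + be) -> eps al be = - eps be al.
Proof.
move=> ra rb rab; apply: (x_cancel rab); rewrite -(Heps ra rb rab) brC (Heps rb ra) 1?addrC//.
by rewrite scaleNr.
Qed.

(** The Jacobi identity with $[x_\alpha,x_\gamma]=0$. With [eps_back] and [eps_cyclic] it provides
    the hypotheses [sT], [sR] and [sr] of the cocycle argument. *)
Lemma eps_assoc (al be ga : H) : root al -> root be -> root ga -> root (al + be) -> root (be + ga) ->
  root (al + be + ga) -> ~ root (al + ga) -> al + ga != 0 ->
  eps al be * eps (al + be) ga = eps be ga * eps al (be + ga).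
Proof.
move=> ra rb rc rab rbc rabc nac nac0; apply: (x_cancel rabc); have rabc' := rabc.
rewrite -addrA in rabc'.
rewrite -!scalerA -(Heps rab rc)// -[al + be + ga]addrA -(Heps ra rbc)//.
rewrite -(linZ (brl _)) -(linZ (brr _)) -(Heps ra rb)// -(Heps rb rc)//.
by rewrite [RHS]jacobi (bracket_not_root ra rc)// (lin0 (brr _)) addr0.
Qed.

(** Since $\langle\alpha,\beta\rangle=-1$, the difference $\alpha-\beta$ is neither 0 nor a root, so
    $x_\alpha$ commutes with $x_{-\beta}$ and Jacobi leaves only
    $[x_\alpha,[x_\beta,x_{-\beta}]]$. *)
Lemma eps_back (al be : H) : root al -> root be -> root (al + be) ->
  eps al be * eps (al + be) (- be) = form (x be) (x (- be)).
Proof.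
move=> ra rb rab; have ab1 := rootD_pair ra rb rab; have rn := root_opp rb.
have ra' : root (al + be - be) by rewrite addrK.
have Eb := Heps rab rn ra'; rewrite addrK in Eb.
apply: (x_cancel ra); rewrite -scalerA -Eb.
rewrite -(linZ (brl _)) -(Heps ra rb rab).
have nab : ~ root (al - be).
  move=> /(rootD_pair ra rn); rewrite hformNr ab1 opprK => /eqP.
  by rewrite -subr_eq0 opprK -[1 + 1]/(2%:R) pnatr_eq0.
have ab0 : al - be != 0.
  rewrite subr_eq0; apply/eqP => ab; move: ab1; rewrite ab Hnorm// => /eqP.
  by rewrite -subr_eq0 opprK natr1 pnatr_eq0.
have := jacobi (x al) (x be) (x (- be)); rewrite (bracket_not_root ra rn)// (lin0 (brr _)) addr0 => <-.
rewrite bracket_opp// (linZ (brr _)) brC (root_wt ra) hformC ab1 scaleN1r opprK.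
by [].
Qed.

Lemma eps_cyclic (al be ga : H) : root al -> root be -> root ga -> al + be + ga = 0 ->
  eps al be * form (x (- ga)) (x ga) = eps be ga * form (x al) (x (- al)).
Proof.
move=> ra rb rc abc.
have abE : al + be = - ga by apply/eqP; rewrite -addr_eq0 abc.
have bcE : be + ga = - al by apply/eqP; rewrite -addr_eq0 addrC addrA abc.
have rab : root (al + be) by rewrite abE; apply: root_opp.
have rbc : root (be + ga) by rewrite bcE; apply: root_opp.
have := form_inv (x al) (x be) (x ga); rewrite (Heps ra rb rab) (Heps rb rc rbc) abE bcE.
by rewrite (linZ (fl _)) (linZ (fr _)).
Qed.
End LieFacts.

(** * A module for the toroidal Z-algebra *)

Section CenterModule.
Variables (R : realType) (N : nat).
Local Notation C := R[i].
Local Notation Zr := 'rV[int]_N.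

(** A module over the dual numbers, [feps] being multiplication by $\varepsilon$. *)
Variables (kfibre : lmodType C) (feps : kfibre -> kfibre).
Hypothesis feps_lin : linear feps.
Hypothesis fepsK : forall v, feps (feps v) = 0.

Definition dotz (r m : Zr) : int := \sum_i r 0 i * m 0 i.
Lemma dotzDl r s m : dotz (r + s) m = dotz r m + dotz s m.
Proof. by rewrite -big_split; apply: eq_bigr => i _; rewrite mxE mulrDl. Qed.

(* With eps ^ 2 = 0, the point (m, l, p) specializes k_0(r, zeta) to
   zeta ^ (m . r) (1 + eps (l . r) zeta ^ (- p)) and k_j(0, zeta) to - m_j + eps p l_j zeta ^ (- p). *)
Definition kpoint : Type := (Zr * Zr * int)%type.

Definition krat (P : kpoint) (i : 'I_N.+1) : int :=
  if unlift ord0 i is Some j then - P.1.1 0 j else 1.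
(** The coefficient of $\varepsilon$ in $k_i(r,\zeta)$, read off from $k_i(r)=k_0(r)k_i(0)$: the
    first summand deforms $k_0(r)$, the second $k_i(0)$. *)
Definition keps (P : kpoint) (r : Zr) (i : 'I_N.+1) : int :=
  krat P i * dotz r P.1.2 + if unlift ord0 i is Some j then P.2 * P.1.2 0 j else 0.
Definition kdelta (n : int) : C := (n == 0)%:R.
Definition kfib i (P : kpoint) r n (v : kfibre) : kfibre :=
  (kdelta (n - dotz r P.1.1) * (krat P i)%:~R) *: v
  + (kdelta (n - dotz r P.1.1 + P.2) * (keps P r i)%:~R) *: feps v.

Lemma krat0 P : krat P ord0 = 1. Proof. by rewrite /krat unlift_none. Qed.
Lemma keps0 P r : keps P r ord0 = dotz r P.1.2.
Proof. by rewrite /keps unlift_none krat0 mul1r addr0. Qed.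
Lemma kepsD P r s i : keps P (r + s) i = krat P i * dotz r P.1.2 + keps P s i.
Proof. by rewrite /keps dotzDl mulrDr addrA. Qed.

Lemma kfib_lin i P r n : linear (kfib i P r n).
Proof.
move=> c u v; rewrite /kfib feps_lin !(scalerDr _ (c *: _)) !scalerA.
by rewrite ![_ * c]mulrC -!scalerA addrACA -scalerDr.
Qed.

Lemma kfib_supp (i j : 'I_N.+1) P r s n v : fsupp (fun k => kfib i P r (n - k) (kfib j P s k v)).
Proof.
apply: (@fsupp_seqW _ _ _ [:: dotz s P.1.1; dotz s P.1.1 - P.2]) => k; apply: contraNT.
rewrite !inE negb_or => /andP[k1 k2].
suff -> : kfib j P s k v = 0 by rewrite (lin0 (kfib_lin _ _ _ _)).
rewrite /kfib /kdelta; have -> : (k - dotz s P.1.1 == 0) = false by lia.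
have -> : (k - dotz s P.1.1 + P.2 == 0) = false by lia.
by rewrite !mul0r !scale0r addr0.
Qed.

Lemma fsum_kdelta (V : lmodType C) (F : int -> V) x : fsum (fun k => kdelta (k - x) *: F k) = F x.
Proof.
rewrite (@fsum1 _ _ x) /kdelta ?subrr ?eqxx ?scale1r// => k kx.
by rewrite subr_eq0 (negPf kx) scale0r.
Qed.
Lemma fsupp_kdelta (V : lmodType C) (F : int -> V) x : fsupp (fun k => kdelta (k - x) *: F k).
Proof. by apply: (@fsupp1 _ _ x) => k kx; rewrite /kdelta subr_eq0 (negPf kx) scale0r. Qed.

Lemma kfib_mul i P r s n v :
  fsum (fun k => kfib ord0 P r (n - k) (kfib i P s k v)) = kfib i P (r + s) n v.
Proof.
pose F1 k := kfib ord0 P r (n - k) ((krat P i)%:~R *: v).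
pose F2 k := kfib ord0 P r (n - k) ((keps P s i)%:~R *: feps v).
transitivity (fsum (fun k => kdelta (k - dotz s P.1.1) *: F1 k + kdelta (k - (dotz s P.1.1 - P.2)) *: F2 k)).
  apply: eq_fsum => k; rewrite {2}/kfib (linD (kfib_lin _ _ _ _)) /F1 /F2 -!(linZ (kfib_lin _ _ _ _)).
  have -> : k - (dotz s P.1.1 - P.2) = k - dotz s P.1.1 + P.2 by lia.
  by rewrite !scalerA.
rewrite fsumD; try exact: fsupp_kdelta.
rewrite !fsum_kdelta /F1 /F2 /kfib !(linZ feps_lin) fepsK !scaler0 addr0.
rewrite krat0 keps0 kepsD dotzDl mulr1 !scalerA -addrA -scalerDl.
have -> : n - dotz s P.1.1 - dotz r P.1.1 = n - (dotz r P.1.1 + dotz s P.1.1) by lia.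
have -> : n - (dotz s P.1.1 - P.2) - dotz r P.1.1 = n - (dotz r P.1.1 + dotz s P.1.1) + P.2 by lia.
congr (_ + _ *: _); move: (keps P s i) => a; rewrite mulr1 intrD intrM; ring.
Qed.

Lemma sum_krat P (r : Zr) : \sum_(j < N) r 0 j * krat P (lift ord0 j) = - dotz r P.1.1.
Proof. by rewrite /dotz -sumrN; apply: eq_bigr => j _; rewrite /krat liftK mulrN. Qed.
Lemma sum_keps P (r : Zr) :
  \sum_(j < N) r 0 j * keps P r (lift ord0 j) = dotz r P.1.2 * (P.2 - dotz r P.1.1).
Proof.
rewrite mulrBr {3}/dotz {1}/dotz mulr_suml mulr_sumr -sumrB; apply: eq_bigr => j _.
by rewrite /keps /krat liftK; ring.
Qed.

Lemma kfib_D P (r : Zr) n v :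
  \sum_(j < N) (r 0 j)%:~R *: kfib (lift ord0 j) P r n v + n%:~R *: kfib ord0 P r n v = 0.
Proof.
have sumC (f : 'I_N -> int) (d : C) (w : kfibre) :
    \sum_(j < N) (r 0 j)%:~R *: ((d * (f j)%:~R) *: w) = (d * (\sum_(j < N) r 0 j * f j)%:~R) *: w.
  rewrite rmorph_sum mulr_sumr scaler_suml; apply: eq_bigr => j _.
  by rewrite scalerA rmorphM /= mulrCA.
rewrite /kfib krat0 keps0.
transitivity ((kdelta (n - dotz r P.1.1) * (n - dotz r P.1.1)%:~R) *: v +
  (kdelta (n - dotz r P.1.1 + P.2) * (dotz r P.1.2 * (n - dotz r P.1.1 + P.2))%:~R) *: feps v).
  rewrite scalerDr; under eq_bigr do rewrite scalerDr.
  rewrite big_split /= addrACA !sumC sum_krat sum_keps !scalerA -!scalerDl.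
  by congr (_ *: _ + _ *: _); rewrite !(rmorphD, rmorphB, rmorphM, rmorphN) /=; ring.
by rewrite /kdelta; do 2! case: eqP => [->|_]; rewrite ?mulr0 ?mul0r ?mulr0z ?mulr0 ?scale0r ?addr0.
Qed.

Lemma kfib_gt i P r n v : dotz r P.1.1 + `|P.2| < n -> kfib i P r n v = 0.
Proof.
move=> H; rewrite /kfib /kdelta; have -> : (n - dotz r P.1.1 == 0) = false by lia.
have -> : (n - dotz r P.1.1 + P.2 == 0) = false by lia.
by rewrite !mul0r !scale0r addr0.
Qed.

Lemma kfib_comm i j P r s m n v : kfib i P r m (kfib j P s n v) = kfib j P s n (kfib i P r m v).
Proof.
rewrite /kfib !feps_lin !(linZ feps_lin) !fepsK !scaler0 !addr0.
rewrite !scalerDr !scalerA -!addrA; congr (_ *: _ + _); first by ring.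
by rewrite [RHS]addrC; congr (_ *: _ + _ *: _); ring.
Qed.

Lemma kfib1 v P : kfib ord0 P 0 0 v = v.
Proof.
have d0 m : dotz 0 m = 0 by rewrite /dotz big1// => i _; rewrite mxE mul0r.
by rewrite /kfib krat0 keps0 !d0 subr0 /kdelta eqxx mulr1 scale1r mulr0z mulr0 scale0r addr0.
Qed.

Local Notation Idx := (kpoint * expo N)%type.
(** The sum over all points and all degrees. The degree is carried as a label, so that coefficients
    of different degrees have independent images and the derivations can act through it. *)
Definition cmod : lmodType C := finsupp Idx kfibre.
Definition cK i r n (u : cmod) : cmod :=
  fext (fun (I : Idx) v => fsingle (I.1, I.2 + (n, r)) (kfib i I.1 r n v)) u.
Definition cD (i : 'I_N.+1) (u : cmod) : cmod :=
  fext (fun (I : Idx) v => fsingle I ((coord_expo I.2 i)%:~R *: v)) u.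

Lemma fsingle_lin (I : choiceType) (V : lmodType C) (i : I) : linear (fsingle i : V -> finsupp I V).
Proof. by move=> c u v; rewrite fsingleD fsingleZ. Qed.

Lemma cK_fib_lin i r n (I : Idx) :
  linear (fun v => fsingle (I.1, I.2 + (n, r)) (kfib i I.1 r n v) : cmod).
Proof. by move=> c u v; rewrite kfib_lin fsingle_lin. Qed.
Lemma cD_fib_lin i (I : Idx) : linear (fun v => fsingle I ((coord_expo I.2 i)%:~R *: v) : cmod).
Proof. by move=> c u v; rewrite scalerDr !scalerA mulrC -scalerA fsingle_lin. Qed.
Lemma cK_lin i r n : linear (cK i r n). Proof. exact: fext_linear (cK_fib_lin i r n). Qed.
Lemma cD_lin i : linear (cD i). Proof. exact: fext_linear (cD_fib_lin i). Qed.
Lemma cK1 i r n P g v : cK i r n (fsingle (P, g) v) = fsingle (P, g + (n, r)) (kfib i P r n v).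
Proof. exact: (fext1 (cK_fib_lin i r n)). Qed.
Lemma cD1 i P g v : cD i (fsingle (P, g) v) = fsingle (P, g) ((coord_expo g i)%:~R *: v).
Proof. exact: (fext1 (cD_fib_lin i)). Qed.

Lemma cmod_ind (P : cmod -> Prop) : P 0 -> (forall f g, P f -> P g -> P (f + g)) ->
  (forall p g v, P (fsingle (p, g) v)) -> forall f, P f.
Proof. by move=> P0 PD P1; apply: finsupp_ind => // -[p g] v; apply: P1. Qed.

Lemma cK_restricted i r u : exists n0 : int, forall n, n0 < n -> cK i r n u = 0.
Proof.
elim/cmod_ind: u => [|f g [a Ha] [b Hb]|P g v].
- by exists 0 => n _; apply: lin0 (cK_lin _ _ _).
- exists (Num.max a b) => n; rewrite gt_max => /andP[an bn].
  by rewrite (linD (cK_lin _ _ _)) Ha// Hb// addr0.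
by exists (dotz r P.1.1 + `|P.2|) => n nn; rewrite cK1 kfib_gt// fsingle0.
Qed.

Lemma cK_comm i j r s m n u : cK i r m (cK j s n u) = cK j s n (cK i r m u).
Proof.
elim/cmod_ind: u => [|f g Hf Hg|P g v]; first by rewrite !(lin0 (cK_lin _ _ _)).
- by rewrite !(linD (cK_lin _ _ _)) Hf Hg.
by rewrite !cK1 kfib_comm addrAC.
Qed.

Lemma cK_supp i j r s n u : fsupp (fun k => cK i r (n - k) (cK j s k u)).
Proof.
have [n0 Hn] := cK_restricted i r u; have [n1 Hn1] := cK_restricted j s u.
apply: (@fsupp_int _ _ (n - n0) n1) => k H; split; rewrite leNgt; apply: contra_neqN H => H.
  by rewrite cK_comm Hn ?(lin0 (cK_lin _ _ _))//; lia.
by rewrite Hn1 ?(lin0 (cK_lin _ _ _)).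
Qed.

Lemma cK_mul i r s n u : fsum (fun k => cK ord0 r (n - k) (cK i s k u)) = cK i (r + s) n u.
Proof.
elim/cmod_ind: u => [|f g Hf Hg|P g v].
- by rewrite fsum0 => [|k]; rewrite ?(lin0 (cK_lin _ _ _)).
- rewrite (linD (cK_lin _ _ _)) -Hf -Hg -fsumD; try exact: cK_supp.
  by apply: eq_fsum => k; rewrite !(linD (cK_lin _ _ _)).
rewrite cK1 -kfib_mul (linfsum (@fsingle_lin Idx kfibre _)); last exact: kfib_supp.
apply: eq_fsum => k; rewrite !cK1 -addrA.
have -> // : (k, s) + (n - k, r) = (n, r + s) :> expo N.
apply: injective_projections; first by rewrite -[LHS]/(k + (n - k)) subrKC.
by rewrite -[LHS]/(s + r) addrC.
Qed.

Lemma cK_D (r : Zr) n u : \sum_(j < N) (r 0 j)%:~R *: cK (lift ord0 j) r n u + n%:~R *: cK ord0 r n u = 0.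
Proof.
elim/cmod_ind: u => [|f g Hf Hg|P g v].
- rewrite (lin0 (cK_lin _ _ _)) scaler0 addr0 big1// => j _.
  by rewrite (lin0 (cK_lin _ _ _)) scaler0.
- transitivity ((\sum_(j < N) (r 0 j)%:~R *: cK (lift ord0 j) r n f + n%:~R *: cK ord0 r n f) +
    (\sum_(j < N) (r 0 j)%:~R *: cK (lift ord0 j) r n g + n%:~R *: cK ord0 r n g)); last first.
    by rewrite Hf Hg addr0.
  rewrite (linD (cK_lin _ _ _)) scalerDr [RHS]addrACA -big_split /=.
  by congr (_ + _); apply: eq_bigr => j _; rewrite (linD (cK_lin _ _ _)) scalerDr.
rewrite cK1 -fsingleZ; under eq_bigr do rewrite cK1 -fsingleZ.
by rewrite -(linsum (@fsingle_lin Idx kfibre _)) -fsingleD kfib_D fsingle0.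
Qed.

Lemma coord_expoD (p q : expo N) i : coord_expo (p + q) i = coord_expo p i + coord_expo q i.
Proof. by rewrite /coord_expo; case: unliftP => [j _|_] //=; rewrite mxE. Qed.

Lemma cD_K i j r n u : cD i (cK j r n u) = cK j r n (cD i u) + (coord_expo (n, r) i)%:~R *: cK j r n u.
Proof.
elim/cmod_ind: u => [|f g Hf Hg|P g v].
- by rewrite (lin0 (cD_lin _)) !(lin0 (cK_lin _ _ _)) (lin0 (cD_lin _)) scaler0 addr0.
- by rewrite (linD (cD_lin i)) !(linD (cK_lin _ _ _)) (linD (cD_lin i)) Hf Hg scalerDr addrACA.
rewrite cD1 !cK1 cD1 (linZ (kfib_lin _ _ _ _)) -fsingleZ -fsingleD -scalerDl.
by rewrite coord_expoD rmorphD.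
Qed.

Lemma cD_D i j u : cD i (cD j u) = cD j (cD i u).
Proof.
elim/cmod_ind: u => [|f g Hf Hg|P g v]; first by rewrite !(lin0 (cD_lin _)).
- by rewrite !(linD (cD_lin _)) Hf Hg.
by rewrite !cD1 !scalerA mulrC.
Qed.

Lemma cK_1 u : cK ord0 0 0 u = u.
Proof.
elim/cmod_ind: u => [|f g Hf Hg|P g v]; first exact: lin0 (cK_lin _ _ _).
- by rewrite (linD (cK_lin _ _ _)) Hf Hg.
by rewrite cK1 kfib1 addr0.
Qed.

Variable v0 : kfibre.
Hypothesis v0_free : forall a b : C, a *: v0 + b *: feps v0 = 0 -> a = 0 /\ b = 0.

(** The relation of degree $(n,r)$ in [d_A] has the coordinates of $(n,r)$ as coefficients. So a
    combination of the $t^nt^rk_i$ that vanishes at every point is already zero in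
    $\Omega_A/d_A$. *)
Lemma coords_parallel (n : int) (r : Zr) (g : 'I_N.+1 -> C) :
  (forall P, \sum_i g i *: kfib i P r n v0 = 0) ->
  exists t, forall i, g i = t * (coord_expo (n, r) i)%:~R.
Proof.
move=> Hg; have key P : kdelta (n - dotz r P.1.1) * (\sum_i g i * (krat P i)%:~R) = 0 /\
    kdelta (n - dotz r P.1.1 + P.2) * (\sum_i g i * (keps P r i)%:~R) = 0.
  apply: v0_free; rewrite -[RHS](Hg P) !mulr_sumr !scaler_suml -big_split; apply: eq_bigr => i _.
  by rewrite /kfib scalerDr !scalerA; congr (_ *: _ + _ *: _); ring.
have c0 : coord_expo (n, r) ord0 = n by rewrite /coord_expo unlift_none.
have cS j : coord_expo (n, r) (lift ord0 j) = r 0 j by rewrite /coord_expo liftK.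
have split_ord (Q : 'I_N.+1 -> Prop) : Q ord0 -> (forall j, Q (lift ord0 j)) -> forall i, Q i.
  by move=> Q0 QS i; case: (unliftP ord0 i) => [j ->|->].
have dot0 s : dotz s 0 = 0 by rewrite /dotz big1// => i _; rewrite mxE mulr0.
have dotd s j : dotz s (delta_mx 0 j) = s 0 j.
  rewrite /dotz (bigD1 j)//= mxE !eqxx mulr1 big1 ?addr0// => k kj.
  by rewrite mxE (negPf kj) andbF mulr0.
have dotB s m m' : dotz s (m - m') = dotz s m - dotz s m'.
  by rewrite /dotz -sumrB; apply: eq_bigr => j _; rewrite !mxE mulrBr.
have dotZ s (c : int) m : dotz s (c *: m) = c * dotz s m.
  by rewrite /dotz mulr_sumr; apply: eq_bigr => j _; rewrite !mxE; ring.
have sumd (j : 'I_N) (f : 'I_N -> C) : \sum_i f i * ((delta_mx 0 j : Zr) 0 i)%:~R = f j.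
  rewrite (bigD1 j)//= mxE !eqxx mulr1 big1 ?addr0// => k kj.
  by rewrite mxE (negPf kj) andbF mulr0.
have [n0|n0] := eqVneq n 0; last first.
  have nC : n%:~R != 0 :> C by rewrite intr_eq0.
  exists (g ord0 / n%:~R); apply: split_ord => [|j]; first by rewrite c0 divfK.
  (* The point $m=0$, $l=\delta_j$, $p=-n$ is visible in degree $n$ whatever $r$ is, and yields
     $g_0r_j=ng_j$. *)
  have [_] := key ((0, delta_mx 0 j), - n); rewrite /= dot0 subr0 subrr /kdelta eqxx mul1r.
  rewrite big_ord_recl keps0 /= dotd cS => E.
  have : g ord0 * (r 0 j)%:~R = n%:~R * g (lift ord0 j).
    apply/eqP; rewrite -subr_eq0 -[X in _ == X]E; apply/eqP; congr (_ + _).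
    rewrite -(sumd j (fun k => g (lift ord0 k))) mulr_sumr -sumrN; apply: eq_bigr => k _.
    rewrite /keps /krat liftK /= [(0 : Zr) _ _]mxE oppr0 mul0r add0r rmorphM rmorphN /=; ring.
  by rewrite mulrAC => ->; field.
subst n; have g0 : g ord0 = 0.
  have [+ _] := key ((0, 0), 0); rewrite /= dot0 subrr /kdelta eqxx mul1r big_ord_recl krat0 mulr1.
  by rewrite big1 ?addr0// => j _; rewrite /krat liftK /= mxE oppr0 mulr0.
(* For $n=0$ undeformed points suffice: $m=0$ has given $g_0=0$, and each $m$ orthogonal to $r$
   gives a linear condition on the remaining coordinates. *)
have keyA m : dotz r m = 0 -> \sum_j g (lift ord0 j) * (m 0 j)%:~R = 0.
  move=> rm; have [+ _] := key ((m, 0), 0); rewrite /= rm subrr /kdelta eqxx mul1r big_ord_recl.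
  rewrite g0 mul0r add0r => E; apply/eqP; rewrite -oppr_eq0 -sumrN; apply/eqP.
  by rewrite -[RHS]E; apply: eq_bigr => j _; rewrite /krat liftK rmorphN /= mulrN.
have [r0|rn0] := eqVneq r 0.
  exists 0; apply: split_ord => [|j]; rewrite mul0r//.
  by have := keyA (delta_mx 0 j); rewrite sumd; apply; rewrite dotd r0 mxE.
have [k rk] : exists k, r 0 k != 0.
  apply: contrapT => rk; move/eqP: rn0; apply; apply/rowP => k; rewrite mxE.
  by apply: contrapT => /eqP rk0; apply: rk; exists k.
have rC : (r 0 k)%:~R != 0 :> C by rewrite intr_eq0.
exists (g (lift ord0 k) / (r 0 k)%:~R); apply: split_ord => [|j]; first by rewrite g0 c0 mulr0.
(* The vectors $r_k\delta_j-r_j\delta_k$ are integral and orthogonal to $r$; testing on them gives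
   $r_kg_j=r_jg_k$. *)
rewrite cS; have := keyA (r 0 k *: delta_mx 0 j - r 0 j *: delta_mx 0 k).
rewrite dotB !dotZ !dotd mulrC subrr => /(_ erefl).
have -> : \sum_i g (lift ord0 i) * ((r 0 k *: delta_mx 0 j - r 0 j *: delta_mx 0 k : Zr) 0 i)%:~R =
    (r 0 k)%:~R * g (lift ord0 j) - (r 0 j)%:~R * g (lift ord0 k).
  rewrite -(sumd j (fun i => g (lift ord0 i))) -(sumd k (fun i => g (lift ord0 i))) !mulr_sumr -sumrB.
  by apply: eq_bigr => i _; rewrite !mxE rmorphB !rmorphM /=; ring.
move=> /eqP; rewrite subr_eq0 => /eqP E; apply: (mulfI rC); rewrite E; field.
exact: rC.
Qed.

End CenterModule.

(** All that the lattice construction uses of [U]: the relations among the central series and the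
    derivations. *)
Record central_module (R : realType) (N : nat) (U : lmodType R[i])
    (K : 'I_N.+1 -> 'rV[int]_N -> int -> U -> U) (D : 'I_N.+1 -> U -> U) : Prop := {
  cm_lin : forall i r n, linear (K i r n);
  cm_Dlin : forall i, linear (D i);
  cm_restricted : forall i r u, exists n0 : int, forall n, n0 < n -> K i r n u = 0;
  cm_comm : forall i j r s m n u, K i r m (K j s n u) = K j s n (K i r m u);
  cm_mul : forall i r s n u, fsum (fun k => K ord0 r (n - k) (K i s k u)) = K i (r + s) n u;
  cm_D : forall (r : 'rV[int]_N) n u,
    \sum_(j < N) (r 0 j)%:~R *: K (lift ord0 j) r n u + n%:~R *: K ord0 r n u = 0;
  cm_DK : forall i j r n u,
    D i (K j r n u) = K j r n (D i u) + (coord_expo (n, r) i)%:~R *: K j r n u;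
  cm_DD : forall i j u, D i (D j u) = D j (D i u);
  cm_1 : forall u, K ord0 0 0 u = u }.

(** * The two expansions of $(1-x)^c$ for integral $c$ *)

Section IntBinomValues.
Variable K : numFieldType.
Local Notation ib c i := (int_binom (c%:~R : K) i).

Lemma int_binomS (m : K) (p : nat) :
  int_binom m p.+1%:Z = ((p%:R - m) / p.+1%:R) * int_binom m p%:Z.
Proof.
have n0 : p.+1%:R != 0 :> K by rewrite pnatr_eq0.
apply: (mulfI n0); rewrite /= exprS mulrCA gbinomialS [RHS]mulrA [p.+1%:R * _]mulrC divfK//; ring.
Qed.

Lemma int_binom_m1 i : ib (-1) i = if 0 <= i then 1 else 0.
Proof.
case: i => [p|p] //=; rewrite -[LHS]/(ib (-1) p%:Z).
elim: p => [|p IH]; first exact: int_binom0.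
rewrite int_binomS IH mulr1 rmorphN opprK natr1 divff// pnatr_eq0 //.
Qed.

Lemma int_binom_m2 i : ib (-2) i = if 0 <= i then (i + 1)%:~R else 0.
Proof.
case: i => [p|p] //=; rewrite -[LHS]/(ib (-2) p%:Z).
elim: p => [|p IH]; first by rewrite int_binom0.
rewrite int_binomS IH; have n0 : p.+1%:R != 0 :> K by rewrite pnatr_eq0.
have -> : (p%:Z + 1)%:~R = p.+1%:R :> K by rewrite -[p%:Z + 1]/(p + 1)%N%:Z addn1.
rewrite divfK// rmorphN opprK -[p.+1%:Z + 1]/(p.+1 + 1)%N%:Z.
by rewrite -[RHS]/((p.+1 + 1)%N%:R : K) -natrD; congr _%:R; rewrite addn2 addn1.
Qed.

Lemma int_binom_nat (c p : nat) : ib c%:Z p%:Z = (-1) ^+ p * 'C(c, p)%:R.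
Proof.
elim: p => [|p IH]; first by rewrite int_binom0 bin0 mulr1.
have n0 : p.+1%:R != 0 :> K by rewrite pnatr_eq0.
rewrite int_binomS IH; apply: (mulfI n0).
have E : p.+1%:R * 'C(c, p.+1)%:R = (c%:R - p%:R) * 'C(c, p)%:R :> K.
  have [pc|pc] := leqP p c; last by rewrite !bin_small ?mulr0//; lia.
  by rewrite -natrB// -!natrM mul_bin_left.
transitivity ((p%:R - c%:R) * ((-1) ^+ p * 'C(c, p)%:R) : K).
  by rewrite [LHS]mulrA; congr (_ * _); rewrite mulrC divfK.
transitivity (- (-1) ^+ p * (p.+1%:R * 'C(c, p.+1)%:R) : K); last by rewrite exprS; ring.
by rewrite E; ring.
Qed.

Lemma int_binom_sym (c : nat) i : ib c%:Z i = (-1) ^+ c * ib c%:Z (c%:Z - i).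
Proof.
case: (ltP i 0) => [i0|i0].
  case: i i0 => // p _; have -> : c%:Z - Negz p = (c + p.+1)%N%:Z by lia.
  by rewrite int_binom_nat bin_small ?mulr0//; lia.
case: i i0 => // p _; have [pc|pc] := leqP p c; last first.
  rewrite int_binom_nat bin_small// mulr0; case E : (c%:Z - p%:Z) => [k|k]; first by lia.
  by rewrite mulr0.
rewrite subzn// !int_binom_nat bin_sub// mulrA -exprD; congr (_ * _).
by rewrite -signr_odd -[RHS]signr_odd oddD oddB// addbA addbb.
Qed.

(* The difference of the expansions of (1 - x)^c in nonnegative powers of x and of 1/x. *)
Lemma int_binom_diff_nat (c : nat) i : ib c%:Z i - (-1) ^ c%:Z * ib c%:Z (c%:Z - i) = 0.
Proof. by rewrite {1}int_binom_sym subrr. Qed.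

(** The expansions of $(1-x)^{-1}$ differ by $\delta$, those of $(1-x)^{-2}$ by a shifted $D\delta$.
    These produce the right-hand sides of relation (7). *)
Lemma int_binom_diff_m1 i : ib (-1) i - (-1) ^ (-1) * ib (-1) (-1 - i) = 1.
Proof.
have -> : (-1) ^ (-1) = -1 :> K by rewrite -[_ ^ _]/((-1)^-1) invrN invr1.
rewrite !int_binom_m1; have -> : (0 <= -1 - i) = ~~ (0 <= i) by lia.
case: (0 <= i); first by rewrite mulr0 subr0.
by rewrite mulr1 sub0r opprK.
Qed.

Lemma int_binom_diff_m2 i : ib (-2) i - (-1) ^ (-2) * ib (-2) (-2 - i) = (i + 1)%:~R.
Proof.
have -> : (-1) ^ (-2) = 1 :> K by rewrite -[_ ^ _]/(((-1) ^+ 2)^-1) sqrrN expr1n invr1.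
rewrite !int_binom_m2 mul1r; case: (leP 0 i) => i0.
  have -> : (0 <= -2 - i) = false by lia.
  by rewrite subr0.
case: (leP 0 (-2 - i)) => i2; first by rewrite sub0r -rmorphN /=; congr _%:~R; lia.
have -> : i = -1 by lia.
by rewrite subr0 addNr.
Qed.

End IntBinomValues.

(** * The module $U[Q]$ over the toroidal Z-algebra *)

Section ZModule.
Variables (R : realType) (N : nat).
Local Notation C := R[i].
Variables (G : vectType C) (br : {bilinear G -> G -> G}) (form : {biscalar G}).
Variables (h : {vspace G}) (x : subvs_of h -> G) (eps : subvs_of h -> subvs_of h -> C).
Local Notation H := (subvs_of h).
Local Notation "<< a , b >>" := (hform form a b).
Local Notation root := (is_root br form).
Local Notation Zr := 'rV[int]_N.
Variables (l : nat) (Am : 'M[int]_l).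
Local Notation Q := 'rV[int]_l.
Local Notation q := (qform Am).
Variables (emb : Q -> H) (zc : H -> Q) (f : H -> Q -> C).
Hypothesis embD : forall u v, emb (u + v) = emb u + emb v.
Hypothesis AmT : Am^T = Am.
Hypothesis zcK : forall a, root a -> emb (zc a) = a.
Hypothesis zcD : forall a b, root a -> root b -> root (a + b) -> zc (a + b) = zc a + zc b.
Hypothesis zcN : forall a b, root a -> root b -> a + b = 0 -> zc b = - zc a.
Hypothesis hformE : forall u v, <<emb u, emb v>> = (q u v)%:~R.
Hypothesis q_rootD : forall a b, root a -> root b -> root (a + b) -> q (zc a) (zc b) = -1.
Hypothesis q_rootN : forall a b, root a -> root b -> a + b = 0 -> q (zc a) (zc b) = -2.
Hypothesis q_other : forall a b, root a -> root b -> ~ root (a + b) -> a + b <> 0 ->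
  exists c : nat, q (zc a) (zc b) = c%:Z.
Hypothesis q_root : forall a, root a -> q (zc a) (zc a) = 2.
(** The scalars by which the operators move $e^g$. [fD] and [fN] prescribe composites; the sign in
    [fC] is the one that makes the two orders comparable, as $(1-x)^c=(-x)^c(1-x^{-1})^c$. *)
Hypothesis fD : forall a b g, root a -> root b -> root (a + b) ->
  f a (g + zc b) * f b g = eps a b * f (a + b) g.
Hypothesis fN : forall a b g, root a -> root b -> a + b = 0 ->
  f a (g + zc b) * f b g = form (x b) (x (- b)).
Hypothesis fC : forall a b g, root a -> root b ->
  f b (g + zc a) * f a g = (-1) ^ (q (zc a) (zc b)) * (f a (g + zc b) * f b g).

Variables (U : lmodType C) (K : 'I_N.+1 -> Zr -> int -> U -> U) (D : 'I_N.+1 -> U -> U).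
Hypothesis HU : central_module K D.
Let Kl := cm_lin HU.
Let Dl := cm_Dlin HU.

Definition zmod : lmodType C := finsupp Q U.
Implicit Types w : zmod.

Lemma fsingleP (g : Q) : linear (fsingle g : U -> zmod).
Proof. by move=> c u v; rewrite fsingleD fsingleZ. Qed.

Lemma zdiag_fib (L : Q -> U -> U) : (forall g, linear (L g)) ->
  forall g, linear (fun u => fsingle g (L g u) : zmod).
Proof. by move=> Ll g c u v; rewrite Ll fsingleP. Qed.

Lemma zZ_fib a r n g : linear (fun u =>
  fsingle (g + zc a) (f a g *: K ord0 r (n + q (zc a) g + 1) u) : zmod).
Proof. by move=> c u v; rewrite Kl scalerDr scalerA [f a g * c]mulrC -scalerA fsingleP. Qed.
Lemma zH_lin (a : H) g : linear (fun u : U => <<a, emb g>> *: u).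
Proof. by move=> c u v; rewrite scalerDr !scalerA mulrC. Qed.
(** The energy of $e^g$. Passing from $g$ to $g+\alpha$ raises it by
    $\langle\alpha,g\rangle+\langle\alpha,\alpha\rangle/2=\langle\alpha,g\rangle+1$, exactly the
    shift of degree in [zZ]; this is why $[d_0,Z]=DZ$. *)
Definition zdeg (i : 'I_N.+1) (g : Q) : C := if i == ord0 then (q g g)%:~R / 2 else 0.
Lemma zD_lin i g : linear (fun u : U => D i u - zdeg i g *: u).
Proof.
move=> c u v; rewrite Dl scalerDr scalerA [zdeg i g * c]mulrC -scalerA opprD addrACA.
by rewrite -scalerBr.
Qed.

Definition zZ a r n w : zmod :=
  fext (fun g u => fsingle (g + zc a) (f a g *: K ord0 r (n + q (zc a) g + 1) u)) w.
Definition zk i r n w : zmod := fext (fun g u => fsingle g (K i r n u)) w.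
Definition zh a w : zmod := fext (fun g u => fsingle g (<<a, emb g>> *: u)) w.
Definition zd i w : zmod := fext (fun g u => fsingle g (D i u - zdeg i g *: u)) w.

Lemma zZ_lin a r n : linear (zZ a r n). Proof. exact: fext_linear (zZ_fib a r n). Qed.
Lemma zk_lin i r n : linear (zk i r n).
Proof. exact: fext_linear (zdiag_fib (fun=> Kl i r n)). Qed.
Lemma zh_lin a : linear (zh a). Proof. exact: fext_linear (zdiag_fib (zH_lin a)). Qed.
Lemma zd_lin i : linear (zd i). Proof. exact: fext_linear (zdiag_fib (zD_lin i)). Qed.

Lemma zZE a r n g u :
  zZ a r n (fsingle g u) = fsingle (g + zc a) (f a g *: K ord0 r (n + q (zc a) g + 1) u).
Proof. exact: (fext1 (zZ_fib a r n)). Qed.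
Lemma zkE i r n g u : zk i r n (fsingle g u) = fsingle g (K i r n u).
Proof. exact: (fext1 (zdiag_fib (fun=> Kl i r n))). Qed.
Lemma zhE a g u : zh a (fsingle g u) = fsingle g (<<a, emb g>> *: u).
Proof. exact: (fext1 (zdiag_fib (zH_lin a))). Qed.
Lemma zdE i g u : zd i (fsingle g u) = fsingle g (D i u - zdeg i g *: u).
Proof. exact: (fext1 (zdiag_fib (zD_lin i))). Qed.
Let linE := (zZ_lin, zk_lin, zh_lin, zd_lin).

Definition zops : Z1_ops N h zmod := {|
  Zop := fun a r n => mklin (zZ_lin a r n);
  kop := fun i r n => mklin (zk_lin i r n);
  hop := fun a => mklin (zh_lin a);
  dop := fun i => mklin (zd_lin i) |}.

Lemma eq_zmod (F1 F2 : zmod -> zmod) : linear F1 -> linear F2 ->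
  (forall g u, F1 (fsingle g u) = F2 (fsingle g u)) -> F1 =1 F2.
Proof. exact: finsupp_lin_ext. Qed.

Lemma zrestricted (A : int -> zmod -> zmod) : (forall n, linear (A n)) ->
  (forall g u, exists n0 : int, forall n, n0 < n -> A n (fsingle g u) = 0) -> restricted A.
Proof.
move=> Al A1; apply: finsupp_ind => [|w1 w2 [a Ha] [b Hb]|//].
  by exists 0 => n _; apply: lin0.
exists (Num.max a b) => n; rewrite gt_max => /andP[an bn].
by rewrite (linD (Al n)) Ha// Hb// addr0.
Qed.

Lemma zZ_restricted a r : restricted (zZ a r).
Proof.
apply: zrestricted => [n|g u]; first exact: zZ_lin.
have [n0 Hn] := cm_restricted HU ord0 r u; exists (n0 - q (zc a) g) => n nn.
by rewrite zZE Hn ?scaler0 ?fsingle0//; lia.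
Qed.

Lemma zk_restricted i r : restricted (zk i r).
Proof.
apply: zrestricted => [n|g u]; first exact: zk_lin.
have [n0 Hn] := cm_restricted HU i r u; exists n0 => n nn.
by rewrite zkE Hn ?fsingle0.
Qed.

Lemma zkZ i b r s m n w : zk i r m (zZ b s n w) = zZ b s n (zk i r m w).
Proof.
move: w; apply: eq_zmod => [c u v|c u v|g u]; [by rewrite !linE..|].
by rewrite zZE !zkE zZE (linZ (Kl _ _ _)) (cm_comm HU).
Qed.

Lemma zkk i j r s m n w : zk i r m (zk j s n w) = zk j s n (zk i r m w).
Proof.
move: w; apply: eq_zmod => [c u v|c u v|g u]; [by rewrite !linE..|].
by rewrite !zkE (cm_comm HU).
Qed.

Lemma K_supp i j r s n u : fsupp (fun k => K i r (n - k) (K j s k u)).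
Proof.
have [n0 Hn] := cm_restricted HU i r u; have [n1 Hn1] := cm_restricted HU j s u.
apply: (@fsupp_int _ _ (n - n0) n1) => k H; split; rewrite leNgt; apply: contra_neqN H => H.
  by rewrite (cm_comm HU) Hn ?(lin0 (Kl _ _ _))//; lia.
by rewrite Hn1 ?(lin0 (Kl _ _ _)).
Qed.

Lemma zmul_supp (A B : int -> zmod -> zmod) n w : (forall i, linear (A i)) -> (forall i, linear (B i)) ->
  restricted A -> restricted B ->
  (forall i j v, A i (B j v) = B j (A i v)) -> fsupp (fun k => A (n - k) (B k w)).
Proof.
move=> Al Bl rA rB AB; have [n0 Hn] := rA w; have [n1 Hn1] := rB w.
apply: (@fsupp_int _ _ (n - n0) n1) => k H; split; rewrite leNgt; apply: contra_neqN H => H.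
  by rewrite AB Hn ?(lin0 (Bl _))//; lia.
by rewrite Hn1 ?(lin0 (Al _)).
Qed.

Lemma zmul_linear (A B : int -> zmod -> zmod) n : (forall i, linear (A i)) -> (forall i, linear (B i)) ->
  (forall w, fsupp (fun k => A (n - k) (B k w))) ->
  linear (fun w => fsum (fun k => A (n - k) (B k w))).
Proof.
move=> Al Bl fAB c u v; rewrite fsumZ// -fsumD//; last exact: fsuppZ.
by apply: eq_fsum => k; rewrite Bl Al.
Qed.

Lemma zZk0 b r s n w : series_mul (zZ b r) (zk ord0 s) n w = zZ b (r + s) n w.
Proof.
rewrite -[LHS]/(fsum _).
have sp v : fsupp (fun k => zZ b r (n - k) (zk ord0 s k v)).
  apply: (zmul_supp (A := zZ b r) (B := zk ord0 s)); [exact: zZ_lin|exact: zk_lin|exact: zZ_restricted|exact: zk_restricted|].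
  by move=> i j u; rewrite zkZ.
move: w; apply: eq_zmod; [exact: (zmul_linear (zZ_lin b r) (zk_lin ord0 s))|exact: zZ_lin|move=> g u].
rewrite zZE -(cm_mul HU).
rewrite fsumZ; last exact: K_supp.
rewrite (linfsum (@fsingleP (g + zc b))); last by apply: fsuppZ; apply: K_supp.
by apply: eq_fsum => k; rewrite zkE zZE; congr (fsingle _ (_ *: K _ _ _ _)); lia.
Qed.

Lemma zk0k i r s n w : series_mul (zk ord0 r) (zk i s) n w = zk i (r + s) n w.
Proof.
rewrite -[LHS]/(fsum _).
have sp v : fsupp (fun k => zk ord0 r (n - k) (zk i s k v)).
  apply: (zmul_supp (A := zk ord0 r) (B := zk i s)); [exact: zk_lin..|exact: zk_restricted|exact: zk_restricted|].
  by move=> a b u; rewrite zkk.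
move: w; apply: eq_zmod; [exact: (zmul_linear (zk_lin ord0 r) (zk_lin i s))|exact: zk_lin|move=> g u].
rewrite zkE -(cm_mul HU) (linfsum (@fsingleP g)); last exact: K_supp.
by apply: eq_fsum => k; rewrite !zkE.
Qed.

Lemma zDk (r : Zr) n w :
  \sum_(i < N) (r 0 i)%:~R *: zk (lift ord0 i) r n w + n%:~R *: zk ord0 r n w = 0.
Proof.
elim/finsupp_ind: w => [|w1 w2 H1 H2|g u].
- by rewrite (lin0 (zk_lin _ _ _)) scaler0 addr0 big1// => i _; rewrite (lin0 (zk_lin _ _ _)) scaler0.
- transitivity ((\sum_(i < N) (r 0 i)%:~R *: zk (lift ord0 i) r n w1 + n%:~R *: zk ord0 r n w1)
    + (\sum_(i < N) (r 0 i)%:~R *: zk (lift ord0 i) r n w2 + n%:~R *: zk ord0 r n w2)).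
    rewrite [RHS]addrACA -big_split /= (linD (zk_lin _ _ _)) scalerDr; congr (_ + _); apply: eq_bigr => i _.
    by rewrite (linD (zk_lin _ _ _)) scalerDr.
  by rewrite H1 H2 addr0.
rewrite zkE -fsingleZ; under eq_bigr do rewrite zkE -fsingleZ.
by rewrite -(linsum (@fsingleP g)) -fsingleD (cm_D HU) fsingle0.
Qed.

Lemma coord_lift (n : int) (r : Zr) i : coord_expo (n, r) (lift ord0 i) = r 0 i.
Proof. by rewrite /coord_expo liftK. Qed.
Lemma coord_0 (n : int) (r : Zr) : coord_expo (n, r) ord0 = n.
Proof. by rewrite /coord_expo unlift_none. Qed.

Lemma zdk i j r n w : comm_ops (zd i) (zk j r n) w =
  (coord_expo (n, r) i)%:~R *: zk j r n w.
Proof.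
move: w; apply: eq_zmod => [c u v|c u v|g u].
- by rewrite /comm_ops !linE opprD addrACA -scalerBr.
- by rewrite linE scalerDr !scalerA mulrC.
rewrite /comm_ops !zdE !zkE zdE (cm_DK HU) (linB (Kl _ _ _)) (linZ (Kl _ _ _)) -(linB (@fsingleP g)).
by rewrite -fsingleZ; congr fsingle; rewrite opprB addrA subrK addrAC subrr add0r.
Qed.

Lemma zdZ i b r n w : root b -> comm_ops (zd i) (zZ b r n) w =
  (coord_expo (n, r) i)%:~R *: zZ b r n w.
Proof.
move=> rb; move: w; apply: eq_zmod => [c u v|c u v|g u].
- by rewrite /comm_ops !linE opprD addrACA -scalerBr.
- by rewrite linE scalerDr !scalerA mulrC.
rewrite /comm_ops !zdE !zZE zdE -(linB (@fsingleP _)) -fsingleZ; congr fsingle.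
rewrite (linZ (Dl _)) (cm_DK HU) (linB (Kl _ _ _)) (linZ (Kl _ _ _)).
set X := K _ _ _ u; have aux (V : zmodType) (y a d e : V) : y + a - d - (y - e) = a - d + e.
  by rewrite opprB -[y + a - d]addrA [LHS]addrC [LHS]addrA subrK addrC.
rewrite scalerDr scalerBr aux !scalerA -scalerBl -scalerDl; congr (_ *: _).
transitivity (f b g * ((coord_expo (n + q (zc b) g + 1, r) i)%:~R - zdeg i (g + zc b) + zdeg i g)).
  by ring.
rewrite mulrC; congr (_ * _).
rewrite /zdeg; case: (unliftP ord0 i) => [j ->|->].
  by rewrite !coord_lift addr0 subr0.
by rewrite eqxx !coord_0 qformDl !qformDr (q_root rb) (qformC g _ AmT) !rmorphD /=; field.
Qed.

Lemma zhZ a b r n w : root b -> comm_ops (zh a) (zZ b r n) w = <<a, b>> *: zZ b r n w.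
Proof.
move=> rb; move: w; apply: eq_zmod => [c u v|c u v|g u].
- by rewrite /comm_ops !linE opprD addrACA -scalerBr.
- by rewrite linE scalerDr !scalerA mulrC.
rewrite /comm_ops zhE !zZE zhE -(linB (@fsingleP _)) -fsingleZ; congr fsingle.
have -> : <<a, emb (g + zc b)>> = <<a, emb g>> + <<a, b>>.
  by rewrite embD zcK// /hform !linearD.
rewrite (linZ (Kl _ _ _)) !scalerA -scalerBl; congr (_ *: _); ring.
Qed.

Lemma zkh i r n a w : zk i r n (zh a w) = zh a (zk i r n w).
Proof.
move: w; apply: eq_zmod => [c u v|c u v|g u]; [by rewrite !linE..|].
by rewrite zhE !zkE zhE (linZ (Kl _ _ _)).
Qed.
Lemma zhh a b w : zh a (zh b w) = zh b (zh a w).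
Proof.
move: w; apply: eq_zmod => [c u v|c u v|g u]; [by rewrite !linE..|].
by rewrite !zhE !scalerA mulrC.
Qed.
Lemma zhd a i w : zh a (zd i w) = zd i (zh a w).
Proof.
move: w; apply: eq_zmod => [c u v|c u v|g u]; [by rewrite !linE..|].
by rewrite zdE !zhE zdE (linZ (Dl _)) scalerBr !scalerA [zdeg _ _ * _]mulrC.
Qed.
Lemma zdd i j w : zd i (zd j w) = zd j (zd i w).
Proof.
move: w; apply: eq_zmod => [c u v|c u v|g u]; [by rewrite !linE..|].
rewrite !zdE !(linB (Dl _)) !(linZ (Dl _)) (cm_DD HU) !scalerBr !scalerA [zdeg j g * _]mulrC.
by congr fsingle; rewrite !opprB addrACA [RHS]addrACA; congr (_ + _); rewrite addrC.
Qed.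

Definition zcomm b1 b2 r s m n w : zmod :=
  twisted_mul <<b1, b2>> (zZ b1 r) (zZ b2 s) m n w - twisted_mul <<b1, b2>> (zZ b2 s) (zZ b1 r) n m w.

Lemma ztw_supp c a b r s m n w :
  fsupp (fun k : int => int_binom c k *: zZ a r (m - k) (zZ b s (n + k) w)).
Proof.
have [n0 Hn] := zZ_restricted b s w.
apply: (@fsupp_int _ _ 0 (n0 - n)) => k; case: k => [k|k]; last by rewrite scale0r eqxx.
move=> H; split=> //; rewrite leNgt; apply: contra_neqN H => H.
by rewrite Hn ?(lin0 (zZ_lin _ _ _)) ?scaler0//; lia.
Qed.

Lemma ztw_lin c a b r s m n : linear (twisted_mul c (zZ a r) (zZ b s) m n).
Proof.
move=> d u v; rewrite !twisted_mulE fsumZ; last exact: ztw_supp.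
rewrite -fsumD; [|by apply: fsuppZ; exact: ztw_supp|exact: ztw_supp].
by apply: eq_fsum => k; rewrite !zZ_lin scalerDr !scalerA mulrC.
Qed.

Lemma zcomm_lin b1 b2 r s m n : linear (zcomm b1 b2 r s m n).
Proof. by move=> c u v; rewrite /zcomm !ztw_lin opprD addrACA -scalerBr. Qed.

Lemma KK_supp r s n0 n1 u (c : int -> C) :
  fsupp (fun k : int => c k *: K ord0 r (n0 - k) (K ord0 s (n1 + k) u)).
Proof.
apply: fsuppZ; apply: (@fsupp_bij _ _ _ (fun k => k - n1) (fun k => k + n1)).
- by move=> k; rewrite subrK.
- by move=> k; rewrite addrK.
apply: eq_fsupp (K_supp ord0 ord0 r s (n0 + n1) u) => k; rewrite /comp.
have -> : n0 - (k - n1) = n0 + n1 - k by lia.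
by have -> : n1 + (k - n1) = k by lia.
Qed.

(** Both twisted products send $e^g$ to a multiple of $e^{g+a+b}$ and apply the same commuting $k_0$
    coefficients, so the commutator is a single sum weighted by the difference of two binomial
    expansions. *)
Lemma zcommE a b r s m n g u : root a -> root b ->
  let c := q (zc a) (zc b) in
  zcomm a b r s m n (fsingle g u) = fsingle (g + zc b + zc a) ((f a (g + zc b) * f b g) *:
    fsum (fun i => (int_binom (c%:~R : C) i - (-1) ^ c * int_binom (c%:~R : C) (c - i)) *:
      K ord0 r (m + q (zc a) g + 1 + c - i) (K ord0 s (n + q (zc b) g + 1 + i) u))).
Proof.
move=> ra rb c; have abE : <<a, b>> = c%:~R by rewrite -{1}(zcK ra) -{1}(zcK rb) hformE.
rewrite /zcomm abE !twisted_mulE.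
set f1 := f a (g + zc b) * f b g; have f2 := fC g ra rb; rewrite -/c -/f1 in f2.
pose g0 i := K ord0 r (m + q (zc a) g + 1 + c - i) (K ord0 s (n + q (zc b) g + 1 + i) u).
have E1 : fsum (fun k => int_binom (c%:~R : C) k *: zZ a r (m - k) (zZ b s (n + k) (fsingle g u))) =
    fsingle (g + zc b + zc a) (f1 *: fsum (fun i => int_binom (c%:~R : C) i *: g0 i)).
  rewrite fsumZ; last exact: KK_supp.
  rewrite (linfsum (@fsingleP _)); last by apply: fsuppZ; exact: KK_supp.
  apply: eq_fsum => k; rewrite !zZE (linZ (Kl _ _ _)) -fsingleZ !scalerA /f1 [_ * int_binom _ _]mulrC mulrA /g0.
  rewrite qformDr -/c; have -> : m - k + (q (zc a) g + c) + 1 = m + q (zc a) g + 1 + c - k by lia.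
  by have -> : n + k + q (zc b) g + 1 = n + q (zc b) g + 1 + k by lia.
have E2 : fsum (fun k => int_binom (c%:~R : C) k *: zZ b s (n - k) (zZ a r (m + k) (fsingle g u))) =
    fsingle (g + zc b + zc a) (f1 *: fsum (fun i => ((-1) ^ c * int_binom (c%:~R : C) (c - i)) *: g0 i)).
  (* The substitution $i\mapsto c-i$ aligns the second product with the first: moving $b$ past $a$
     shifts the degree by $c=\langle a,b\rangle$. *)
  rewrite (@fsum_bij _ _ _ (fun i => c - i) (fun i => c - i)); last 2 first.
  - by move=> i; rewrite opprB addrC subrK.
  - by move=> i; rewrite opprB addrC subrK.
  rewrite fsumZ; last exact: KK_supp.
  rewrite (linfsum (@fsingleP _)); last by apply: fsuppZ; exact: KK_supp.
  apply: eq_fsum => k; rewrite /comp !zZE (linZ (Kl _ _ _)) -fsingleZ !scalerA -[g + zc b + zc a]addrAC.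
  rewrite (cm_comm HU) /g0 qformDr [q (zc b) (zc a)](qformC _ _ AmT) -/c.
  have -> : m + (c - k) + q (zc a) g + 1 = m + q (zc a) g + 1 + c - k by lia.
  have -> : n - (c - k) + (q (zc b) g + c) + 1 = n + q (zc b) g + 1 + k by lia.
  congr (fsingle _ (_ *: _)); rewrite -mulrA f2 mulrCA mulrA.
  exact: mulrC.
rewrite E1 E2 -(linB (@fsingleP _)) -scalerBr; congr (fsingle _ (_ *: _)).
rewrite -[- fsum _]scaleN1r fsumZ; last exact: KK_supp.
rewrite -fsumD; [|exact: KK_supp|by apply: fsuppZ; exact: KK_supp].
by apply: eq_fsum => i; rewrite scaleN1r -scalerBl.
Qed.

Lemma KK_sum r s n0 n1 u :
  fsum (fun i => K ord0 r (n0 - i) (K ord0 s (n1 + i) u)) = K ord0 (r + s) (n0 + n1) u.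
Proof.
rewrite -(cm_mul HU) (@fsum_bij _ _ _ (fun k => k - n1) (fun k => k + n1)); last 2 first.
- by move=> k; rewrite subrK.
- by move=> k; rewrite addrK.
apply: eq_fsum => k; rewrite /comp; have -> : n0 - (k - n1) = n0 + n1 - k by lia.
by have -> : n1 + (k - n1) = k by lia.
Qed.

Lemma fsum_bigsum (J : choiceType) (I : seq 'I_N) (F : 'I_N -> J -> U) : (forall i, fsupp (F i)) ->
  \sum_(i <- I) fsum (F i) = fsum (fun k => \sum_(i <- I) F i k).
Proof.
move=> sF; suff [] : \sum_(i <- I) fsum (F i) = fsum (fun k => \sum_(i <- I) F i k) /\
  fsupp (fun k => \sum_(i <- I) F i k) by [].
elim: I => [|i I [IH1 IH2]].
  rewrite big_nil; split; first by rewrite fsum0// => k; rewrite big_nil.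
  by apply: eq_fsupp (fsupp0 _ _) => k; rewrite big_nil.
split; last by apply: eq_fsupp (fsuppD (sF i) IH2) => k; rewrite big_cons.
by rewrite big_cons IH1 -fsumD//; apply: eq_fsum => k; rewrite big_cons.
Qed.

(** Weighting by the index of $k_0(r)$ applies $D$ to it, and relation (3) replaces $Dk_0(r)$ by
    $-\sum_jr_jk_j(r)$. *)
Lemma KK_wsum (r s : Zr) n0 n1 u :
  fsum (fun i => (n0 - i)%:~R *: K ord0 r (n0 - i) (K ord0 s (n1 + i) u)) =
  - \sum_(j < N) (r 0 j)%:~R *: K (lift ord0 j) (r + s) (n0 + n1) u.
Proof.
have sp i : fsupp (fun k => K ord0 s (n0 + n1 - k) (K i r k u)) by exact: K_supp.
transitivity (- \sum_(j < N) fsum (fun k => (r 0 j)%:~R *: K ord0 s (n0 + n1 - k) (K (lift ord0 j) r k u))).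
  rewrite fsum_bigsum; last by move=> i; apply: fsuppZ.
  rewrite (@fsum_bij _ _ _ (fun k => n0 - k) (fun k => n0 - k)); last 2 first.
  - by move=> k; rewrite opprB addrC subrK.
  - by move=> k; rewrite opprB addrC subrK.
  rewrite -[RHS]scaleN1r fsumZ; last first.
    apply: eq_fsupp (fsuppZ (fun k => - k%:~R) (sp ord0)) => k.
    have /eqP := cm_D HU r k u; rewrite addr_eq0 => /eqP E.
    transitivity (K ord0 s (n0 + n1 - k) (- (k%:~R *: K ord0 r k u))).
      by rewrite -scaleNr (linZ (Kl _ _ _)).
    by rewrite -E (linsum (Kl _ _ _)); apply: eq_bigr => j _; rewrite (linZ (Kl _ _ _)).
  apply: eq_fsum => k; rewrite /comp; have -> : n0 - (n0 - k) = k by lia.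
  have -> : n1 + (n0 - k) = n0 + n1 - k by lia.
  have /eqP := cm_D HU r k u; rewrite addr_eq0 => /eqP E.
  transitivity (-1 *: K ord0 s (n0 + n1 - k) (- (k%:~R *: K ord0 r k u))).
    by rewrite (linN (Kl _ _ _)) scaleN1r opprK (linZ (Kl _ _ _)) (cm_comm HU).
  by rewrite -E (linsum (Kl _ _ _)); congr (_ *: _); apply: eq_bigr => j _; rewrite (linZ (Kl _ _ _)).
congr (- _); apply: eq_bigr => j _; rewrite -fsumZ; last exact: sp.
by rewrite (cm_mul HU) addrC.
Qed.

Lemma zcomm_root a b r s m n w : root a -> root b -> root (a + b) ->
  zcomm a b r s m n w = eps a b *: zZ (a + b) (r + s) (m + n) w.
Proof.
move=> ra rb rab; move: w; apply: eq_zmod => [|c u v|g u]; first exact: zcomm_lin.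
- by rewrite linE scalerDr !scalerA mulrC.
rewrite zcommE// q_rootD// zZE -fsingleZ scalerA -fD// zcD//.
have -> : g + (zc a + zc b) = g + zc b + zc a by rewrite addrA addrAC.
congr (fsingle _ (_ *: _)).
transitivity (fsum (fun i => K ord0 r (m + q (zc a) g + 1 - 1 - i) (K ord0 s (n + q (zc b) g + 1 + i) u))).
  by apply: eq_fsum => i; rewrite int_binom_diff_m1 scale1r.
rewrite KK_sum qformDl; congr (K _ _ _ _); lia.
Qed.

Lemma zcomm_other a b r s m n w : root a -> root b -> ~ root (a + b) -> a + b <> 0 ->
  zcomm a b r s m n w = 0.
Proof.
move=> ra rb nab ab0; move: w; apply: eq_zmod => [|c u v|g u]; first exact: zcomm_lin.
- by rewrite scaler0 addr0.
have [c cE] := q_other ra rb nab ab0; rewrite zcommE// cE.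
rewrite fsum0 ?scaler0 ?fsingle0// => i.
by rewrite int_binom_diff_nat scale0r.
Qed.

Lemma zcomm_opp a b (r s : Zr) m n w : root a -> root b -> a + b = 0 ->
  zcomm a b r s m n w = form (x b) (x (- b)) *:
   (- zh b (zk ord0 (r + s) (m + n) w) + \sum_(i < N) (r 0 i)%:~R *: zk (lift ord0 i) (r + s) (m + n) w
    + m%:~R *: zk ord0 (r + s) (m + n) w).
Proof.
move=> ra rb ab; move: w; apply: eq_zmod => [|c u v|g u]; first exact: zcomm_lin.
- rewrite !linE opprD.
  have -> : \sum_(i < N) (r 0 i)%:~R *: zk (lift ord0 i) (r + s) (m + n) (c *: u + v) =
    c *: (\sum_(i < N) (r 0 i)%:~R *: zk (lift ord0 i) (r + s) (m + n) u) +
    \sum_(i < N) (r 0 i)%:~R *: zk (lift ord0 i) (r + s) (m + n) v.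
    rewrite scaler_sumr -big_split; apply: eq_bigr => i _.
    by rewrite zk_lin scalerDr !scalerA mulrC.
  set S := \sum_(i < N) _; set T := \sum_(i < N) _; set kap := form _ _.
  set A := zh b _; set B := zh b _; set X := zk _ _ _ u; set Y := zk _ _ _ v.
  transitivity (kap *: (c *: (- A + S + m%:~R *: X) + (- B + T + m%:~R *: Y))).
    congr (_ *: _); rewrite !scalerDr scalerN !scalerA [_ * c]mulrC.
    have aux (V : zmodType) (d1 d2 d3 d4 d5 d6 : V) :
        d1 + d2 + (d3 + d4) + (d5 + d6) = d1 + d3 + d5 + (d2 + d4 + d6).
      by rewrite [LHS](AC (2*2*2) ((1*3*5)*(2*4*6)))%AC.
    exact: aux.
  by rewrite scalerDr !scalerA mulrC.
have zba : zc b = - zc a by apply: zcN.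
have qb : q (zc b) g = - q (zc a) g by rewrite zba qformNl.
rewrite zcommE// q_rootN// fN// zkE zhE.
have -> : g + zc b + zc a = g by rewrite zba subrK.
under eq_bigr do rewrite zkE -fsingleZ.
rewrite -(linsum (@fsingleP g)) -(linN (@fsingleP g)) -fsingleZ -!fsingleD -fsingleZ.
congr (fsingle _ (_ *: _)).
have hb : <<b, emb g>> = - (q (zc a) g)%:~R by rewrite -{1}(zcK rb) hformE qb rmorphN.
rewrite hb -scaleNr opprK.
pose F i := K ord0 r (m + q (zc a) g + 1 - 2 - i) (K ord0 s (n + q (zc b) g + 1 + i) u).
have sF : fsupp F.
  by have := KK_supp r s (m + q (zc a) g + 1 - 2) (n + q (zc b) g + 1) u (fun=> 1);
     apply: eq_fsupp => i; rewrite scale1r.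
(* The weight of $D\delta$ is $i+1=(m+\langle a,g\rangle)-(m+\langle a,g\rangle-1-i)$. The first
   part gives $m\,k_0$ and $-b\,k_0$, the second is the weighted sum of [KK_wsum]. *)
transitivity ((m + q (zc a) g)%:~R *: fsum F -
   fsum (fun i => (m + q (zc a) g + 1 - 2 - i)%:~R *: F i)).
  rewrite fsumZ// -[- fsum _]scaleN1r fsumZ; last exact: fsuppZ.
  rewrite -fsumD; [|exact: fsuppZ|by do 2! apply: fsuppZ].
  apply: eq_fsum => i; rewrite int_binom_diff_m2 scaleN1r -scalerBl -rmorphB /=.
  by congr (_%:~R *: _); lia.
rewrite /F KK_sum KK_wsum opprK.
have -> : m + q (zc a) g + 1 - 2 + (n + q (zc b) g + 1) = m + n by rewrite qb; lia.
by rewrite rmorphD scalerDl /= -[RHS]addrA [RHS]addrC -addrA addrC; congr (_ + _); rewrite addrC.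
Qed.

Lemma zops_Z1_module : Z1_module br form x eps zops.
Proof.
split.
- by move=> b r _; apply: zZ_restricted.
- by move=> i r; apply: zk_restricted.
- move=> c a b w; rewrite -[LHS]/(zh (c *: a + b) w) -[RHS]/(c *: zh a w + zh b w).
  elim/finsupp_ind: w => [|w1 w2 H1 H2|g u].
  + by rewrite !(lin0 (zh_lin _)) scaler0 addr0.
  + by rewrite !(linD (zh_lin _)) H1 H2 scalerDr addrACA.
  + rewrite !zhE -fsingleZ -fsingleD scalerA -scalerDl; congr (fsingle _ (_ *: _)).
    by rewrite /hform linearP linearPl.
- by move=> b r s n w rb; apply: zZk0.
- by move=> i r s n w; apply: zk0k.
- by move=> r n w; apply: zDk.
- by move=> b r n w rb; rewrite -[LHS]/(comm_ops (zd ord0) (zZ b r n) w) zdZ// coord_0.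
- by move=> i r n w; rewrite -[LHS]/(comm_ops (zd ord0) (zk i r n) w) zdk coord_0.
- move=> i j r n w; rewrite -[LHS]/(comm_ops (zd (lift ord0 i)) (zk j r n) w) zdk.
  by rewrite coord_lift.
- by move=> a b r s m n w ra rb rab; apply: zcomm_root.
- by move=> a b r s m n w ra rb ab; apply: zcomm_opp.
- by move=> a b r s m n w ra rb nab ab; apply: zcomm_other.
- by move=> a b r n w rb; apply: zhZ.
- move=> i b r s m n w rb; apply/eqP; rewrite subr_eq0; apply/eqP; exact: zkZ.
- move=> i j r s m n w; apply/eqP; rewrite subr_eq0; apply/eqP; exact: zkk.
- move=> i r n a w; apply/eqP; rewrite subr_eq0; apply/eqP; exact: zkh.
- move=> i b r n w rb; rewrite -[LHS]/(comm_ops (zd (lift ord0 i)) (zZ b r n) w) zdZ//.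
  by rewrite coord_lift.
- move=> a b w; apply/eqP; rewrite subr_eq0; apply/eqP; exact: zhh.
- move=> a i w; apply/eqP; rewrite subr_eq0; apply/eqP; exact: zhd.
- move=> i j w; apply/eqP; rewrite subr_eq0; apply/eqP; exact: zdd.
Qed.

Lemma zops_k0 : k0_acts_as_1 zops.
Proof.
move=> w; rewrite -[LHS]/(zk ord0 0 0 w); elim/finsupp_ind: w => [|w1 w2 H1 H2|g u].
- exact: lin0 (zk_lin _ _ _).
- by rewrite (linD (zk_lin _ _ _)) H1 H2.
- by rewrite zkE (cm_1 HU).
Qed.

End ZModule.

(** * The action of the centre and its injectivity *)

Section CenterAction.
Variables (R : realType) (N : nat).
Local Notation C := R[i].
Variables (G : vectType C) (br : {bilinear G -> G -> G}) (form : {biscalar G}).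
Variables (h : {vspace G}) (x : subvs_of h -> G) (eps : subvs_of h -> subvs_of h -> C).
Variables (W : lmodType C) (A : Z1_ops N h W).
Hypothesis HZ : Z1_module br form x eps A.

Definition kact (w : W) (f : Omega_A R N) : W :=
  fext (fun j (c : C^o) => (c : C) *: kop A j.2 j.1.2 j.1.1 w) f.

Lemma kact_fib w (j : expo N * 'I_N.+1) :
  linear (fun c : C^o => (c : C) *: kop A j.2 j.1.2 j.1.1 w).
Proof. by move=> c u v; rewrite scalerDl scalerA. Qed.
Lemma kact_linear w : linear (kact w).
Proof. exact: fext_linear (kact_fib w). Qed.
Lemma kact1 w p i c : kact w (fsingle (p, i) c) = (c : C) *: kop A i p.2 p.1 w.
Proof. exact: (fext1 (kact_fib w)). Qed.

Lemma kact_lin2 f : linear (kact^~ f).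
Proof.
move=> c u v; rewrite /kact /fext.
have sp w : fsupp (fun j => (f j : C) *: kop A j.2 j.1.2 j.1.1 w).
  exact: fext_fsupp (kact_fib w) f.
rewrite fsumZ// -fsumD//; last exact: fsuppZ.
by apply: eq_fsum => j; rewrite linearP scalerDr !scalerA mulrC.
Qed.

Lemma kact_dA w s : d_A s -> kact w s = 0.
Proof.
move=> [p _ <-]; rewrite (linsum (kact_linear w)) -[RHS](Z1_Dk HZ p.2 p.1 w) big_ord_recl addrC.
congr (_ + _); [apply: eq_bigr => i _|];
  by rewrite (linZ (kact_linear w)) kact1 scale1r /coord_expo ?liftK ?unlift_none.
Qed.

Definition center_act (z : center R N) : {linear W -> W} :=
  mklin (f := fun w => lquot_lift (S := @d_A R N) (kact w) z) (kact_lin2 (lrepr z)).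

Lemma center_actE f w : center_act (lclass (@d_A R N) f) w = kact w f.
Proof. exact: (lquot_liftE (kact_linear w) (@kact_dA w)). Qed.

Lemma center_act_faithful :
  (forall f : Omega_A R N, (forall w, kact w f = 0) -> f \in lspan (@d_A R N)) ->
  center_acts_faithfully A.
Proof.
move=> inj; exists center_act; split.
- move=> c u v w; exact: (lquot_lift_linear (kact_linear w) (@kact_dA w)).
- by move=> n r i w; rewrite /tk center_actE kact1 scale1r.
- move=> u v uv; rewrite -[u]lreprK -[v]lreprK; apply/eqP; rewrite lclassE; apply: inj => w.
  by rewrite (linB (kact_linear w)) -!center_actE !lreprK uv subrr.
Qed.

End CenterAction.

Section CenterFaithful.
Variables (R : realType) (N : nat).
Local Notation C := R[i].

Lemma d_A_span (f : Omega_A R N) (t : expo N -> C) :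
  (forall p i, f (p, i) = t p * (coord_expo p i)%:~R) -> f \in lspan (@d_A R N).
Proof.
move=> ft; have [s us sf] := fsupp_seq (finsupp_fsupp f).
pose sp := undup [seq j.1 | j <- s]; pose sa := [seq (p, i) | p <- sp, i <- enum 'I_N.+1].
have -> : f = \sum_(j <- sa) fsingle j (f j).
  apply: finsuppE => [|[p i] /sf js].
    by apply: allpairs_uniq; rewrite ?undup_uniq ?enum_uniq// => -[? ?] [? ?] _ _ [-> ->].
  by apply: allpairs_f; rewrite ?mem_enum// mem_undup; apply/mapP; exists (p, i).
rewrite big_allpairs_dep /=; apply: rpred_sum => p _.
have -> : \sum_(i <- enum 'I_N.+1) fsingle (p, i) (f (p, i)) =
    t p *: (\sum_i (coord_expo p i)%:~R *: omega_k R p i).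
  rewrite scaler_sumr big_enum /=; apply: eq_bigr => i _.
  by rewrite ft /omega_k scalerA -fsingleZ; congr fsingle; rewrite /GRing.scale /= mulr1.
apply: rpredZ; apply/asboolP; exists 1%N, (fun=> 1), (fun=> \sum_i (coord_expo p i)%:~R *: omega_k R p i).
by split=> [_|]; [exists p|rewrite big_ord1 scale1r].
Qed.

(** Used to recover $w=0$ from $m\otimes w=0$ by contracting with functionals. It passes to direct
    sums, so it need only be checked on the dual numbers. *)
Definition separated (V : lmodType C) : Prop :=
  forall v : V, (forall L : V -> C^o, linear L -> L v = 0) -> v = 0.

Lemma separated_finsupp (I : choiceType) (V : lmodType C) :
  separated V -> separated (finsupp I V).
Proof.
move=> sV f f0; apply: val_inj; apply/funext => i /=; apply: sV => L Ll.
by apply: (f0 (fun g => L (g i))) => c g g'; rewrite finsuppDE finsuppZE Ll.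
Qed.

Lemma dual_number_module : exists (V : lmodType C) (e : V -> V) (v : V),
  [/\ linear e, forall u, e (e u) = 0,
      forall a b : C, a *: v + b *: e v = 0 -> a = 0 /\ b = 0 & separated V].
Proof.
exists (C^o * C^o)%type, (fun u => (0, u.1)), (1, 0); split.
- move=> c u v; apply: injective_projections => //=; by rewrite scaler0 addr0.
- by [].
- move=> a b [/= E1 E2]; move: E1 E2; rewrite /GRing.scale /= !mulr1 !mulr0 addr0 add0r.
  by move=> -> ->.
- by move=> u f0; apply: injective_projections; [apply: (f0 fst)|apply: (f0 snd)].
Qed.

Variables (kfibre : lmodType C) (feps : kfibre -> kfibre).
Hypothesis feps_lin : linear feps.
Hypothesis fepsK : forall v, feps (feps v) = 0.
Variable v0 : kfibre.
Hypothesis v0_free : forall a b : C, a *: v0 + b *: feps v0 = 0 -> a = 0 /\ b = 0.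

Lemma cmod_central : central_module (@cK R N kfibre feps) (@cD R N kfibre).
Proof.
split.
- by move=> i r n; apply: cK_lin.
- by move=> i; apply: cD_lin.
- by move=> i r u; apply: cK_restricted.
- by move=> i j r s m n u; apply: cK_comm.
- by move=> i r s n u; apply: cK_mul.
- by move=> r n u; apply: cK_D.
- by move=> i j r n u; apply: cD_K.
- by move=> i j u; apply: cD_D.
- by move=> u; apply: cK_1.
Qed.

Variables (G : vectType C) (form : {biscalar G}) (h : {vspace G}) (l : nat) (Am : 'M[int]_l).
Variables (emb : 'rV[int]_l -> subvs_of h) (zc : subvs_of h -> 'rV[int]_l).
Variable f : subvs_of h -> 'rV[int]_l -> C.
Let A := zops form Am emb zc f cmod_central.

Lemma zops_kact_inj (g : Omega_A R N) : (forall w, kact A w g = 0) -> g \in lspan (@d_A R N).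
Proof.
move=> g0; pose w P : zmod l (@cmod R N kfibre) := fsingle 0 (fsingle (P, 0) v0).
have key P p : \sum_i (g (p, i) : C) *: kfib feps i P p.2 p.1 v0 = 0.
  transitivity ((kact A (w P) g : zmod l (@cmod R N kfibre)) 0 (P, p)); last by rewrite g0.
  move: (g); apply: finsupp_lin_ext.
  - move=> c u v; rewrite scaler_sumr -big_split; apply: eq_bigr => i _.
    by rewrite finsuppDE finsuppZE scalerDl scalerA.
  - by move=> c u v; rewrite kact_linear.
  - move=> [q j] c; rewrite kact1 -[kop _ _ _ _ _]/(zk _ j q.2 q.1 _) (zkE cmod_central) (cK1 feps_lin).
    rewrite [X in fsingle (P, X) _](_ : _ = q); last by rewrite -surjective_pairing; exact: add0r.
    rewrite finsuppZE /= eqxx /= xpair_eqE eqxx /=. case: eqP => [->|pq].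
      rewrite (bigD1 j)//= eqxx big1 ?addr0// => i ij.
      by rewrite xpair_eqE (negPf ij) andbF scale0r.
    rewrite scaler0 big1// => i _; rewrite xpair_eqE.
    by have /eqP/negPf -> := pq; rewrite scale0r.
have /choice[t tP] p : exists t : C, forall i, g (p, i) = t * (coord_expo p i)%:~R.
  by have := coords_parallel v0_free (fun P => key P p); rewrite -surjective_pairing.
exact: d_A_span tP.
Qed.

End CenterFaithful.

Record root_lattice (R : realType) (G : vectType R[i]) (br : {bilinear G -> G -> G})
    (form : {biscalar G}) (h : {vspace G}) (x : subvs_of h -> G)
    (eps : subvs_of h -> subvs_of h -> R[i]) (l : nat) (Am : 'M[int]_l)
    (emb : 'rV[int]_l -> subvs_of h) (zc : subvs_of h -> 'rV[int]_l)
    (f : subvs_of h -> 'rV[int]_l -> R[i]) : Prop := {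
  rl_embD : forall u v, emb (u + v) = emb u + emb v;
  rl_AmT : Am^T = Am;
  rl_zcK : forall a, is_root br form a -> emb (zc a) = a;
  rl_zcD : forall a b, is_root br form a -> is_root br form b -> is_root br form (a + b) ->
    zc (a + b) = zc a + zc b;
  rl_zcN : forall a b, is_root br form a -> is_root br form b -> a + b = 0 -> zc b = - zc a;
  rl_form : forall u v, hform form (emb u) (emb v) = (qform Am u v)%:~R;
  rl_q_rootD : forall a b, is_root br form a -> is_root br form b -> is_root br form (a + b) ->
    qform Am (zc a) (zc b) = -1;
  rl_q_rootN : forall a b, is_root br form a -> is_root br form b -> a + b = 0 ->
    qform Am (zc a) (zc b) = -2;
  rl_q_other : forall a b, is_root br form a -> is_root br form b ->
    ~ is_root br form (a + b) -> a + b <> 0 -> exists c : nat, qform Am (zc a) (zc b) = c%:Z;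
  rl_q_root : forall a, is_root br form a -> qform Am (zc a) (zc a) = 2;
  rl_fD : forall a b g, is_root br form a -> is_root br form b -> is_root br form (a + b) ->
    f a (g + zc b) * f b g = eps a b * f (a + b) g;
  rl_fN : forall a b g, is_root br form a -> is_root br form b -> a + b = 0 ->
    f a (g + zc b) * f b g = form (x b) (x (- b));
  rl_fC : forall a b g, is_root br form a -> is_root br form b ->
    f b (g + zc a) * f a g = (-1) ^ (qform Am (zc a) (zc b)) * (f a (g + zc b) * f b g) }.

(** * The root lattice and its two-cocycle *)

Section RootLattice.
Variables (R : realType).
Local Notation C := R[i].
Variables (G : vectType C) (br : {bilinear G -> G -> G}) (form : {biscalar G}).
Variables (h : {vspace G}) (x : subvs_of h -> G) (eps : subvs_of h -> subvs_of h -> C).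
Local Notation H := (subvs_of h).
Local Notation "<< a , b >>" := (hform form a b).
Local Notation root := (is_root br form).
Hypothesis Hlie : lie_bracket br.
Hypothesis Hinv : invariant_form br form.
Hypothesis Hcar : cartan_subalgebra br h.
Hypothesis Hnorm : forall al : H, root al -> <<al, al>> = 2.
Hypothesis Hx : root_vector_choice br form x.
Hypothesis Heps : structure_constants br form x eps.
Hypothesis Hade : type_ADE br form h.

Let formC := inv_formC Hinv.
Let root_opp := root_opp Hlie Hinv Hcar Hx.
Let rootD_neg := rootD_neg Hlie Hinv Hcar Hnorm Hx.
Let rootD_pair := rootD_pair Hinv Hnorm.

Lemma hform_linl (c : H) : linear (fun a => <<a, c>> : C^o).
Proof. by move=> d a b; rewrite /hform linearP linearPl. Qed.
Lemma hform_linr (c : H) : linear (fun a => <<c, a>> : C^o).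
Proof. by move=> d a b; rewrite /hform !linearP. Qed.
Lemma hform_sym (a b : H) : <<a, b>> = <<b, a>>. Proof. exact: formC. Qed.

(** A positive pairing of distinct roots makes $a-b$ a root, and then all three of $a$, $b$, $a-b$
    having norm 2 forces the pairing to be 1. *)
Lemma root_pair_pos (a b : H) (z : nat) : root a -> root b -> <<a, b>> = z.+1%:R -> a <> b -> z = 0%N.
Proof.
move=> ra rb ab nab; have rnb := root_opp rb.
have abN : <<a, - b>> = - z.+1%:R by rewrite (linN (hform_linr a)) ab.
have := rootD_pair ra rnb (rootD_neg ra rnb abN _).
rewrite abN => /(_ _) E; have /oppr_inj/eqP : - z.+1%:R = -1 :> C.
  by apply: E; rewrite subr_eq0; apply/eqP.
by rewrite (_ : 1 = 1%:R)// eqr_nat => /eqP[].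
Qed.

Lemma root_lattice_exists : exists l (Am : 'M[int]_l) emb zc f,
  root_lattice br form x eps Am emb zc f.
Proof.
have [l [e [b [_ [broot bbasis bspan] bform]]]] := Hade.
(* All roots have norm 2, so the Cartan matrix is also the Gram matrix of the base and is
   symmetric. *)
pose Am : 'M[int]_l := \matrix_(i, j) if i == j then 2 else if e i j then -1 else 0.
have AmE i j : <<tnth b i, tnth b j>> = (Am i j)%:~R.
  have := bform i j; rewrite (Hnorm (broot j)) mulrAC divff ?pnatr_eq0// mul1r => ->.
  by rewrite mxE; case: ifP => // _; case: ifP => // _; rewrite rmorphN.
have iC : injective (fun k : int => k%:~R : C) by move=> k m; apply: intr_inj.
have AmT : Am^T = Am by apply/matrixP => i j; apply: iC; rewrite /= mxE -!AmE hform_sym.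
pose emb (u : 'rV[int]_l) : H := \sum_i (u 0 i)%:~R *: tnth b i.
have embD u v : emb (u + v) = emb u + emb v.
  by rewrite /emb -big_split; apply: eq_bigr => i _; rewrite mxE rmorphD scalerDl.
have embN u : emb (- u) = - emb u.
  by rewrite /emb -sumrN; apply: eq_bigr => i _; rewrite mxE rmorphN scaleNr.
have emb0 : emb 0 = 0 by apply: (addIr (emb 0)); rewrite -embD addr0 add0r.
have emb_inj : injective emb.
  move=> u v /eqP; rewrite -subr_eq0 -embN -embD => /eqP E0.
  have /freeP bfree : free b := basis_free bbasis.
  apply/rowP => i; apply/eqP; rewrite -subr_eq0; apply/eqP; apply: iC => /=.
  have := bfree (fun i => ((u - v) 0 i)%:~R) _ i; rewrite !mxE => ->//.
  by rewrite -[RHS]E0; apply: eq_bigr => j _; rewrite (tnth_nth 0).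
pose q := qform Am.
have hE u v : <<emb u, emb v>> = (q u v)%:~R.
  rewrite /q qform_sum (linsum (hform_linl _)) rmorph_sum; apply: eq_bigr => i _ /=.
  rewrite (linsum (hform_linr _)) rmorph_sum; apply: eq_bigr => j _ /=.
  rewrite (linZ (hform_linl _)) (linZ (hform_linr _)) AmE !rmorphM /= /GRing.scale /=; ring.
have qC u v : q u v = q v u by exact: qformC AmT.
(* Integral coordinates of a root; on elements that are not roots the choice is arbitrary. *)
have /choice[zc zcP] a : exists u, root a -> emb u = a /\ ((forall i, 0 <= u 0 i) \/ (forall i, u 0 i <= 0)).
  have [ra|] := pselect (root a); last by exists 0.
  have [n [->|->]] := bspan a ra.
    exists (\row_i (n i)%:Z) => _; split; last by left => i; rewrite mxE.
    by apply: eq_bigr => i _; rewrite mxE.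
  exists (- \row_i (n i)%:Z) => _; split; last by right => i; rewrite !mxE oppr_le0.
  by rewrite embN; congr (- _); apply: eq_bigr => i _; rewrite mxE.
have zcK a : root a -> emb (zc a) = a by move=> /zcP[].
pose rt u := root (emb u).
have zcemb u : rt u -> zc (emb u) = u by move=> ru; apply: emb_inj; apply: zcK.
have rt2 u : rt u -> q u u = 2 by move=> ru; apply: iC; rewrite /= -hE Hnorm.
have rtN u : rt u -> rt (- u) by move=> ru; rewrite /rt embN; apply: root_opp.
have qN u v : q u (- v) = - q u v by exact: qformNr.
have qNl u v : q (- u) v = - q u v by exact: qformNl.
have rtDneg u v : rt u -> rt v -> q u v < 0 -> u + v <> 0 -> rt (u + v).
  move=> ru rv quv uv0; rewrite /rt embD; apply: (rootD_neg (z := `|q u v|.-1)) => //.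
    rewrite hE; have -> : q u v = - (`|q u v|.-1.+1)%:Z by lia.
    by rewrite rmorphN.
  by apply/eqP => E; apply: uv0; apply: emb_inj; rewrite embD E emb0.
have opp0 (u v : 'rV[int]_l) : u + v = 0 -> v = - u.
  by move=> /eqP; rewrite addrC addr_eq0 => /eqP.
have rtD u v : rt u -> rt v -> q u v = -1 -> rt (u + v).
  move=> ru rv quv; apply: rtDneg => //; first by rewrite quv.
  by move=> /opp0 E; move: quv; rewrite E qN rt2.
have q_of_rtD u v : rt u -> rt v -> rt (u + v) -> q u v = -1.
  move=> ru rv ruv; apply: iC; rewrite /= -hE rootD_pair//.
  by rewrite -embD.
have q_pos u v : rt u -> rt v -> 0 < q u v -> u <> v -> q u v = 1.
  move=> ru rv quv uv; have /root_pair_pos : <<emb u, emb v>> = (`|q u v|.-1).+1%:R.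
    by rewrite hE; have {1}-> : q u v = (`|q u v|.-1).+1%:Z by lia.
  by move=> /(_ ru rv) E; have := E (fun H => uv (emb_inj _ _ H)); lia.
have rt_eq2 u v : rt u -> rt v -> q u v = 2 -> u = v.
  by move=> ru rv quv; apply: contrapT => uv; have := q_pos u v ru rv; rewrite quv => /(_ isT uv).
have rt_le2 u v : rt u -> rt v -> q u v <= 2.
  move=> ru rv; rewrite leNgt; apply/negP => quv.
  have [E|uv] := pselect (u = v); first by move: quv; rewrite E rt2.
  have E : q u v = 1 by apply: q_pos => //; lia.
  by move: quv; rewrite E.
have emb_dl i : emb (delta_mx 0 i) = tnth b i.
  rewrite /emb (bigD1 i)//= mxE !eqxx scale1r big1 ?addr0// => j ji.
  by rewrite mxE (negPf ji) andbF scale0r.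
have rt_base i : rt (delta_mx 0 i) by rewrite /rt emb_dl.
have q_base i j : i != j -> q (delta_mx 0 i) (delta_mx 0 j) = 0 \/ q (delta_mx 0 i) (delta_mx 0 j) = -1.
  move=> ij; have -> : q (delta_mx 0 i) (delta_mx 0 j) = Am i j by apply: iC; rewrite /= -hE !emb_dl AmE.
  by rewrite mxE (negPf ij); case: ifP; [right|left].
have rt_sign u : rt u -> (forall i, 0 <= u 0 i) \/ (forall i, u 0 i <= 0).
  by move=> ru; have [_] := zcP _ ru; rewrite zcemb.
(* The upper triangular half of the Gram matrix. Its bilinear form satisfies $B(u,v)+B(v,u)=q(u,v)$,
   so the bimultiplicative $(-1)^B$ is a two-cocycle with commutator $(-1)^q$. *)
pose L : 'M[int]_l := \matrix_(i, j) if i == j then 1 else if (i < j)%N then Am i j else 0.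
pose B := qform L.
have BDl u v w : B (u + v) w = B u w + B v w by exact: qformDl.
have BDr u v w : B w (u + v) = B w u + B w v by exact: qformDr.
have BNl u w : B (- u) w = - B u w by exact: qformNl.
have BNr u w : B w (- u) = - B w u by exact: qformNr.
have Bq u v : B u v + B v u = q u v.
  rewrite /B /q !qform_sum [X in _ + X]exchange_big -big_split; apply: eq_bigr => i _ /=.
  rewrite -big_split; apply: eq_bigr => j _ /=.
  have -> : Am i j = L i j + L j i; last by ring.
  rewrite ![L _ _]mxE [j == i]eq_sym; have [->|ij] := eqVneq i j; first by rewrite mxE eqxx.
  have [ij'|ji|/val_inj E] := ltngtP i j; [by rewrite addr0| |by rewrite E eqxx in ij].
  by rewrite -{1}AmT mxE add0r.
have B1 u : rt u -> B u u = 1 by move=> /rt2; rewrite -Bq; lia.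
pose sg (k : int) : C := (-1) ^ k.
have m1 : (-1 : C) != 0 by rewrite oppr_eq0 oner_eq0.
have sgD k m : sg (k + m) = sg k * sg m by exact: expfzDr.
have sg1 : sg 1 = -1 by rewrite /sg expr1z.
have sgK k : sg k * sg k = 1.
  rewrite -sgD /sg; have -> : k + k = 2%:Z * k by lia.
  by rewrite -exprz_exp -exprnP sqrrN expr1n exp1rz.
have sgN k : sg (- k) = sg k by apply: (mulfI (expfz_neq0 k m1)); rewrite -sgD subrr sgK.
(* If $u+v$ is a root then $q(u,v)=-1$, and the sign turns the antisymmetric [eps] into a symmetric
   function. *)
pose s u v := eps (emb u) (emb v) * sg (B u v).
(* The minus sign is $(-1)^{B(u,-u)}$, as $B(u,u)=1$ on roots. *)
pose r u := - form (x (emb u)) (x (- emb u)).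
have root_uv u v : rt u -> rt v -> q u v = -1 -> root (emb u + emb v).
  by move=> ru rv quv; rewrite -embD; apply: rtD.
have [c [cN cD]] : exists c : 'rV[int]_l -> C, (forall u, rt u -> c u * c (- u) = r u) /\
  (forall u v, rt u -> rt v -> q u v = -1 -> c u * c v = s u v * c (u + v)).
  apply: (@cocycle_exists C l Am rt s r) => //.
  - move=> u v ru rv quv; rewrite mulf_neq0 ?expfz_neq0//.
    exact: (eps_neq0 Hlie Hinv Hcar Hnorm Hx Heps) (root_uv _ _ ru rv quv).
  - by move=> u ru; rewrite oppr_eq0; apply: (form_root_neq0 Hlie Hinv Hcar Hnorm Hx).
  - by move=> u ru; rewrite /r embN opprK formC.
  - move=> u v ru rv quv; rewrite /s (epsC Hlie Hx Heps ru rv)//; last exact: root_uv.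
    have -> : B v u = q u v - B u v by rewrite -Bq addrC addKr.
    by rewrite (quv : q u v = -1) sgD !sgN sg1; ring.
  - move=> u v w ru rv rw quv qvw quw; rewrite /s !embD BDl BDr !sgD.
    have ruv := root_uv _ _ ru rv quv; have rvw := root_uv _ _ rv rw qvw.
    have E := eps_assoc Hlie Hx Heps ru rv rw ruv rvw.
    transitivity (eps (emb u) (emb v) * eps (emb u + emb v) (emb w) * (sg (B u v) * sg (B u w) * sg (B v w))).
      by ring.
    rewrite E; first by ring.
    + rewrite -!embD; apply: rtD => //; first by rewrite /rt embD.
      by rewrite /q qformDl; move: quw qvw => -> ->.
    + by rewrite -embD => /(q_of_rtD _ _ ru rw); rewrite (quw : q u w = 0).
    + apply/eqP => E0; suff : w = - u by move=> E1; move: (quw : q u w = 0); rewrite E1 qN rt2.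
      by apply: emb_inj; rewrite embN; apply/eqP; rewrite -addr_eq0 addrC E0.
  - move=> u v ru rv quv; rewrite /s /r embN embD BDl !BNr B1// sgD !sgN sg1.
    rewrite -(eps_back Hlie Hinv Hcar Hnorm Hx Heps ru rv (root_uv _ _ ru rv quv)).
    transitivity (eps (emb u) (emb v) * eps (emb u + emb v) (- emb v) * - (sg (B u v) * sg (B u v))).
      by ring.
    by rewrite sgK; ring.
  - move=> u v ru rv quv; rewrite /s /r !embN !embD !BNr BDr B1// sgN sgD sg1.
    have ruv := root_uv _ _ ru rv quv.
    have -> : sg (B v u) = - sg (B u v).
      have -> : B v u = q u v - B u v by rewrite -Bq addrC addKr.
      by rewrite (quv : q u v = -1) sgD !sgN sg1; ring.
    have := eps_cyclic Hlie Hinv Hcar Hx Heps ru rv (root_opp ruv) (subrr _).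
    rewrite opprK => E.
    transitivity (- (eps (emb u) (emb v) * form (x (emb u + emb v)) (x (- (emb u + emb v)))) * sg (B u v)).
      by ring.
    by rewrite E; ring.
exists l, Am, emb, zc, (fun a g => c (zc a) * sg (B (zc a) g)).
have rtz a : root a -> rt (zc a) by move=> ra; rewrite /rt zcK.
have zcD a a' : root a -> root a' -> root (a + a') -> zc (a + a') = zc a + zc a'.
  by move=> ra ra' raa; apply: emb_inj; rewrite embD !zcK.
have zcN a a' : root a -> root a' -> a + a' = 0 -> zc a' = - zc a.
  move=> ra ra' raa; apply: emb_inj; rewrite embN !zcK//; apply/eqP.
  by rewrite -addr_eq0 addrC raa.
have zq a a' : root a -> root a' -> root (a + a') -> q (zc a) (zc a') = -1.
  by move=> ra ra' raa; apply: q_of_rtD; [exact: rtz..|rewrite -zcD//; exact: rtz].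
split=> //.
- by move=> a a' ra ra' raa; rewrite (zcN a a')// -/q qN rt2//; apply: rtz.
- move=> a a' ra ra' nr n0; rewrite -/q; case E: (q (zc a) (zc a')) => [k|k]; first by exists k.
  case: nr; rewrite -(zcK a ra) -(zcK a' ra') -embD; apply: rtDneg; [exact: rtz..|by rewrite E|].
  by move=> E0; apply: n0; rewrite -(zcK a ra) -(zcK a' ra') (opp0 _ _ E0) embN subrr.
- by move=> a ra; apply: rt2; apply: rtz.
- move=> a a' g ra ra' raa; rewrite BDr !sgD zcD// BDl sgD.
  transitivity (c (zc a) * c (zc a') * (sg (B (zc a) g) * sg (B (zc a) (zc a')) * sg (B (zc a') g))).
    by ring.
  rewrite cD; [|exact: rtz..|exact: zq]; rewrite /s !zcK//.
  transitivity (sg (B (zc a) (zc a')) * sg (B (zc a) (zc a')) *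
    (eps a a' * (c (zc a + zc a') * (sg (B (zc a) g) * sg (B (zc a') g))))); first by ring.
  by rewrite sgK mul1r.
- move=> a a' g ra ra' aa; rewrite (zcN a a')// BDr !sgD BNr BNl !sgN B1; last exact: rtz.
  transitivity (c (zc a) * c (- zc a) * (sg (B (zc a) g) * sg (B (zc a) g)) * sg 1); first by ring.
  rewrite sgK cN; last exact: rtz.
  rewrite /r zcK// sg1; have -> : a = - a' by apply/eqP; rewrite -addr_eq0 aa.
  by rewrite opprK formC; ring.
- move=> a a' g ra ra'; rewrite -/q -/(sg _) !BDr !sgD -Bq sgD.
  transitivity (sg (B (zc a) (zc a')) * sg (B (zc a) (zc a')) * (c (zc a') * (sg (B (zc a') g) *
    sg (B (zc a') (zc a))) * (c (zc a) * sg (B (zc a) g)))); last by ring.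
  by rewrite sgK mul1r.
Qed.

End RootLattice.

(** * Lie algebra modules *)

Section LoopModule.
Variables (R : realType) (N : nat).
Local Notation C := R[i].
Variables (G : vectType C) (br : {bilinear G -> G -> G}) (form : {biscalar G}).
Local Notation loop := (loop N G).
Local Notation center := (center R N).

Lemma center_ind (P : center -> Prop) : P 0 -> (forall u v, P u -> P v -> P (u + v)) ->
  (forall c p i, P (c *: tk R p i)) -> forall z, P z.
Proof.
move=> P0 PD Pk z; rewrite -[z]lreprK; elim/finsupp_ind: (lrepr z) => [|f g Pf Pg|[p i] c].
- by rewrite (lin0 (lclass_linear _)).
- by rewrite lclassD; apply: PD.
- have -> : fsingle (p, i) c = c *: omega_k R p i :> Omega_A R N.
    by rewrite /omega_k -fsingleZ; congr fsingle; rewrite /GRing.scale /= mulr1.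
  by rewrite lclassZ; apply: Pk.
Qed.

Lemma der_center_linear c : linear (@der_center R N c).
Proof.
move=> a z w; rewrite -[z]lreprK -[w]lreprK -(lclass_linear (@d_A R N)) !der_center_class.
rewrite -(lclass_linear (@d_A R N)); congr lclass.
apply: val_inj; apply/funext => j /=. exact: scale_linP.
Qed.

Lemma der_center_tk c (p : expo N) i : der_center c (tk R p i) = weight c p *: tk R p i.
Proof.
rewrite /tk der_center_class -(linZ (lclass_linear _)); congr lclass.
apply: val_inj; apply/funext => -[q j].
rewrite -[RHS]/(weight c p *: (omega_k R p i (q, j) : C^o)) /=; case: ifP => [/eqP[-> _]//|_].
by rewrite !scaler0.
Qed.

Variable T : lmodType C.
Variables (X : G -> expo N -> T -> T) (Z : center -> T -> T) (D : 'I_N.+1 -> T -> T).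
Hypothesis Xl : forall y p, linear (X y p).
Hypothesis Xg : forall p v, linear (fun y => X y p v).
Hypothesis Zl : forall z, linear (Z z).
Hypothesis Zc : forall v, linear (fun z => Z z v).
Hypothesis Dl : forall i, linear (D i).
Hypothesis XX : forall y z p q v, X y p (X z q v) - X z q (X y p v) =
  X (br y z) (p + q) v + form y z *: Z (\sum_i (coord_expo p i)%:~R *: tk R (p + q) i) v.
Hypothesis ZX : forall z y p v, Z z (X y p v) = X y p (Z z v).
Hypothesis ZZ : forall z w v, Z z (Z w v) = Z w (Z z v).
Hypothesis DX : forall i y p v, D i (X y p v) = X y p (D i v) + (coord_expo p i)%:~R *: X y p v.
Hypothesis DZ : forall i j p v,
  D i (Z (tk R p j) v) = Z (tk R p j) (D i v) + (coord_expo p i)%:~R *: Z (tk R p j) v.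
Hypothesis DD : forall i j v, D i (D j v) = D j (D i v).

Definition loop_act (f : loop) (v : T) : T := fext (fun p y => X y p v) f.
Definition der_act (c : 'rV[C]_N.+1) (v : T) : T := \sum_i c 0 i *: D i v.
Definition tor_act (u : toroidal N G) (v : T) : T :=
  loop_act u.1.1 v + Z u.1.2 v + der_act u.2 v.

Let loop_act_supp (f : loop) v : fsupp (fun p => X (f p) p v).
Proof. exact: (fext_fsupp (fun p => Xg p v)). Qed.

Lemma loop_act_lin f : linear (loop_act f).
Proof.
move=> c u v; rewrite /loop_act /fext fsumZ// -fsumD//; last exact: fsuppZ.
by apply: eq_fsum => p; rewrite Xl.
Qed.
Lemma loop_act_linl v : linear (fun f => loop_act f v).
Proof. exact: (fext_linear (fun p => Xg p v)). Qed.
Lemma loop_act1 p y v : loop_act (fsingle p y) v = X y p v.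
Proof. exact: (fext1 (fun p => Xg p v)). Qed.
Lemma der_act_lin c : linear (der_act c).
Proof.
move=> a u v; rewrite /der_act scaler_sumr -big_split; apply: eq_bigr => i _.
by rewrite Dl scalerDr !scalerA mulrC.
Qed.
Lemma tor_act_lin u : linear (tor_act u).
Proof.
move=> c v w; rewrite /tor_act loop_act_lin Zl der_act_lin !scalerDr.
by rewrite [LHS](AC (2*2*2) ((1*3*5)*(2*4*6)))%AC.
Qed.
Lemma tor_act_linl v : linear (fun u => tor_act u v).
Proof.
move=> c u w; rewrite /tor_act /= (loop_act_linl v) (Zc v).
have -> : der_act (c *: u.2 + w.2) v = c *: der_act u.2 v + der_act w.2 v.
  rewrite /der_act scaler_sumr -big_split; apply: eq_bigr => i _.
  by rewrite !mxE scalerDl scalerA.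
by rewrite !scalerDr [LHS](AC (2*2*2) ((1*3*5)*(2*4*6)))%AC.
Qed.

Lemma loop_actE (f : loop) (s : seq (expo N)) v : uniq s -> (forall p, f p != 0 -> p \in s) ->
  loop_act f v = \sum_(p <- s) X (f p) p v.
Proof.
move=> us sf; apply: fsumE => // p H; apply: sf; apply: contra_neq H => ->.
exact: lin0 (Xg p v).
Qed.

Lemma fsupp_out (f : loop) (s : seq (expo N)) : (forall p, f p != 0 -> p \in s) ->
  forall p, p \notin s -> f p = 0.
Proof. by move=> sf p ps; apply/eqP; apply: contraNT ps; apply: sf. Qed.

Lemma loop_brE (f g : loop) (s : seq (expo N)) : uniq s ->
  (forall p, f p != 0 -> p \in s) -> (forall p, g p != 0 -> p \in s) ->
  loop_br br f g = \sum_(p <- s) \sum_(q <- s) fsingle (p + q) (br (f p) (g q)).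
Proof.
move=> us sf sg; rewrite -[LHS]/(fsum _) (fsumE us) => [|p].
  apply: eq_bigr => p _; apply: (fsumE us) => q; apply: contra_neqT => /(fsupp_out sg) ->.
  by rewrite linear0r fsingle0.
apply: contra_neqT => /(fsupp_out sf) ->.
by apply: fsum0 => q; rewrite linear0l fsingle0.
Qed.

Lemma loop_cocycleE (f g : loop) (s : seq (expo N)) : uniq s ->
  (forall p, f p != 0 -> p \in s) -> (forall p, g p != 0 -> p \in s) ->
  loop_cocycle form f g = \sum_(p <- s) \sum_(q <- s)
    form (f p) (g q) *: \sum_i (coord_expo p i)%:~R *: tk R (p + q) i.
Proof.
move=> us sf sg; rewrite -[LHS]/(fsum _) (fsumE us) => [|p].
  apply: eq_bigr => p _; apply: (fsumE us) => q; apply: contra_neqT => /(fsupp_out sg) ->.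
  by rewrite linear0r scale0r.
apply: contra_neqT => /(fsupp_out sf) ->.
by apply: fsum0 => q; rewrite linear0l scale0r.
Qed.

Lemma loop_act_br f g v : loop_act (loop_br br f g) v + Z (loop_cocycle form f g) v =
  loop_act f (loop_act g v) - loop_act g (loop_act f v).
Proof.
have [s [us sf sg]] := fsupp2_seq (finsupp_fsupp f) (finsupp_fsupp g).
rewrite (loop_brE us sf sg) (loop_cocycleE us sf sg) (linsum (loop_act_linl v)) (linsum (Zc v)).
rewrite -big_split /=.
transitivity (\sum_(p <- s) \sum_(q <- s) (X (f p) p (X (g q) q v) - X (g q) q (X (f p) p v))).
  apply: eq_bigr => p _; rewrite (linsum (loop_act_linl v)) (linsum (Zc v)) -big_split /=.
  by apply: eq_bigr => q _; rewrite XX loop_act1 (linZ (Zc v)).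
under eq_bigr do rewrite sumrB; rewrite sumrB; congr (_ - _).
  rewrite (loop_actE _ us sf); apply: eq_bigr => p _.
  by rewrite (loop_actE _ us sg) (linsum (Xl _ _)).
rewrite exchange_big (loop_actE _ us sg); apply: eq_bigr => q _.
by rewrite (loop_actE _ us sf) (linsum (Xl _ _)).
Qed.

Lemma der_act_X c y p v : der_act c (X y p v) = X y p (der_act c v) + weight c p *: X y p v.
Proof.
rewrite /der_act (linsum (Xl _ _)) /weight scaler_suml -big_split; apply: eq_bigr => i _ /=.
by rewrite DX scalerDr (linZ (Xl _ _)) scalerA.
Qed.

Lemma der_act_loop c f v :
  loop_act (der_loop c f) v = der_act c (loop_act f v) - loop_act f (der_act c v).
Proof.
apply/eqP; rewrite eq_sym subr_eq addrC; apply/eqP; move: f; apply: finsupp_lin_ext.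
- by move=> a f g; rewrite (loop_act_linl v) der_act_lin.
- move=> a f g; have -> : der_loop c (a *: f + g) = a *: der_loop c f + der_loop c g.
    by apply: val_inj; apply/funext => j /=; exact: scale_linP.
  by rewrite !loop_act_linl lin_addP.
- move=> p y; have -> : der_loop c (fsingle p y) = fsingle p (weight c p *: y).
    by apply: val_inj; apply/funext => j /=; case: eqP => [->//|_]; rewrite scaler0.
  by rewrite !loop_act1 der_act_X (linZ (Xg p v)).
Qed.

Lemma der_act_center c z v : Z (der_center c z) v = der_act c (Z z v) - Z z (der_act c v).
Proof.
apply/eqP; rewrite eq_sym subr_eq addrC; apply/eqP; move: z; apply: center_ind.
- by rewrite (lin0 (der_center_linear c)) !(lin0 (Zc _)) (lin0 (der_act_lin c)) addr0.
- move=> z w Hz Hw; rewrite (linD (der_center_linear c)) !(linD (Zc _)) (linD (der_act_lin c)) Hz Hw.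
  exact: addrACA.
- move=> a p j; rewrite (linZ (der_center_linear c)) !(linZ (Zc _)) (linZ (der_act_lin c)) -scalerDr.
  congr (_ *: _); rewrite der_center_tk (linZ (Zc _)) /der_act (linsum (Zl _)) /weight scaler_suml -big_split.
  by apply: eq_bigr => i _ /=; rewrite DZ scalerDr (linZ (Zl _)) scalerA.
Qed.

Lemma der_act_comm c d v : der_act c (der_act d v) = der_act d (der_act c v).
Proof.
rewrite /der_act; under eq_bigr do rewrite (linsum (Dl _)) scaler_sumr.
rewrite exchange_big; apply: eq_bigr => j _; rewrite (linsum (Dl _)) scaler_sumr; apply: eq_bigr => i _.
by rewrite !(linZ (Dl _)) DD !scalerA mulrC.
Qed.

Lemma center_loop_act z f v : Z z (loop_act f v) = loop_act f (Z z v).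
Proof. by rewrite (linfsum (Zl z))//; apply: eq_fsum => p; rewrite ZX. Qed.

(** [p], [q], [r] and [w] stand for composites of commuting parts (loop with centre, centre with
    centre, derivation with derivation), which cancel in the commutator. *)
Lemma bracket_rearrange (V : zmodType) (a w1 w2 y1 y2 y3 y4 z1 z2 z3 z4 p q r w : V) :
  a + (y1 - y2) - (y3 - y4) + (w1 - w2 - a + (z1 - z2) - (z3 - z4)) =
  w1 + p + y4 + (q + r + z4) + (y1 + z1 + w) - (w2 + q + y2 + (p + r + z2) + (y3 + z3 + w)).
Proof.
rewrite !opprD !opprK; pose S := w1 + y4 + z4 + y1 + z1 - w2 - y2 - z2 - y3 - z3.
transitivity ((a - a) + S); first by rewrite [LHS](AC (1*2*2*(3*2*2)) ((1*8)*(6*5*12*2*9*7*3*10*4*11)))%AC.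
transitivity ((p - p) + (q - q) + (r - r) + (w - w) + S); first by rewrite !subrr !add0r.
by rewrite [RHS](AC (3*3*3*(3*3*3)) ((2*13)*(4*11)*(5*14)*(9*18)*(1*3*6*7*8*10*12*15*16*17)))%AC.
Qed.

Lemma tor_act_br u w v :
  tor_act (tor_br br form u w) v = tor_act u (tor_act w v) - tor_act w (tor_act u v).
Proof.
move: u w => [[f z] c] [[g t] d]; rewrite /tor_act /= !(linB (loop_act_linl v)) !(linB (Zc v)).
rewrite !(linD (loop_act_linl v)) !(linD (Zc v)) !der_act_loop !der_act_center.
have -> : der_act 0 v = 0 by rewrite /der_act big1// => i _; rewrite mxE scale0r.
rewrite addr0; set a := loop_act (loop_br _ _ _) _; set b := Z (loop_cocycle _ _ _) _.
have -> : b = loop_act f (loop_act g v) - loop_act g (loop_act f v) - a.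
  by rewrite -loop_act_br [a + b]addrC addrK.
rewrite !(linD (loop_act_lin _)) !(linD (Zl _)) !(linD (der_act_lin _)) !center_loop_act.
rewrite [Z z (Z t v)]ZZ [der_act c (der_act d v)]der_act_comm.
exact: bracket_rearrange.
Qed.

End LoopModule.

(** * Ideals of the toroidal algebra that meet the centre trivially *)

Section CentralIdeal.
Variables (R : realType) (N : nat).
Local Notation C := R[i].
Variables (G : vectType C) (br : {bilinear G -> G -> G}) (form : {biscalar G}).
Variables (h : {vspace G}) (x : subvs_of h -> G) (eps : subvs_of h -> subvs_of h -> C).
Local Notation H := (subvs_of h).
Local Notation "<< a , b >>" := (hform form a b).
Local Notation root := (is_root br form).
Hypothesis Hlie : lie_bracket br.
Hypothesis Hinv : invariant_form br form.
Hypothesis Hcar : cartan_subalgebra br h.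
Hypothesis Hnorm : forall al : H, root al -> <<al, al>> = 2.
Hypothesis Hx : root_vector_choice br form x.
Hypothesis Heps : structure_constants br form x eps.
Hypothesis Hade : type_ADE br form h.
Local Notation loop := (loop N G).
Local Notation center := (center R N).

Let formC := inv_formC Hinv.
Let root_opp := root_opp Hlie Hinv Hcar Hx.
Let brr (y : G) : linear (br y). Proof. exact: linearPr. Qed.
Let fr (y : G) : linear (form y : G -> C^o). Proof. exact: linearPr. Qed.
Let fl (y : G) : linear (form^~ y : G -> C^o). Proof. by move=> c u v; rewrite linearPl. Qed.

Lemma weight_vector_cases v : weight_vector br h v -> v \in h \/ exists be c, root be /\ v = c *: x be.
Proof.
move=> wv; have [->|v0] := eqVneq v 0; first by left; apply: mem0v.
have [|[be [rv be0]]] := weight_root Hlie Hinv Hcar wv v0; [by left|right].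
have rb : root be by split=> //; exists v.
have [c ->] := root_space_dim1 Hlie Hinv Hcar Hnorm Hx rb rv.2.
by exists be, c.
Qed.

Lemma root_gen (P : G -> Prop) : (forall c u v, P u -> P v -> P (c *: u + v)) ->
  (forall a, a \in h -> P a) -> (forall al, root al -> P (x al)) -> forall y, P y.
Proof.
move=> PD Ph Px y; have [t [-> tP]] := weight_decomp Hlie Hcar y.
rewrite big_seq; apply: big_ind => [|u v Pu Pv|v /tP /weight_vector_cases[/Ph//|[be [c [/Px rb ->]]]]].
- by apply: Ph; apply: mem0v.
- by rewrite -[u]scale1r; apply: PD.
- by rewrite -[_ *: _]addr0; apply: PD => //; apply: Ph; apply: mem0v.
Qed.

Lemma br_root_h (al : H) (a : G) : root al -> a \in h -> br (x al) a = - form a (vsval al) *: x al.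
Proof.
move=> ra ah; rewrite (brC Hlie) -[in LHS](vsprojK ah) (root_wt Hx ra) /hform.
by rewrite (vsprojK ah) scaleNr.
Qed.

(** If $\alpha+\beta$ is a root then $\langle\alpha,\alpha+\beta\rangle=1$, so $2\alpha+\beta$ is
    neither a root nor 0. Only the component of weight $-\alpha$ survives two brackets with
    $x_\alpha$. *)
Lemma ad_root_sq (al : H) y : root al -> exists c, br (x al) (br (x al) y) = c *: x al.
Proof.
move=> ra; have [b0 _] := Hlie; move: y; apply: root_gen.
- move=> c u v [d Eu] [e Ev]; exists (c * d + e); rewrite !brr Eu Ev.
  by rewrite scalerDl scalerA.
- move=> a ah; exists 0; rewrite (br_root_h ra ah) (linZ (brr _)) b0 scaler0 scale0r.
  by [].
- move=> be rb; have [ab0|ab0] := eqVneq (al + be) 0.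
    have -> : be = - al by apply/eqP; rewrite -addr_eq0 addrC ab0.
    rewrite (bracket_opp Hx ra) (linZ (brr _)) (br_root_h ra (subvsP _)) scalerA.
    by eexists.
  exists 0; rewrite scale0r; have [rab|nrab] := pselect (root (al + be)); last first.
    by rewrite (bracket_not_root Hlie Hx)// (lin0 (brr _)).
  have E : <<al, al + be>> = 1.
    rewrite (hformDr form) (Hnorm ra) (rootD_pair Hinv Hnorm ra rb rab); ring.
  rewrite (Heps ra rb rab) (linZ (brr _)) (bracket_not_root Hlie Hx ra rab) ?scaler0//.
    move=> /(rootD_pair Hinv Hnorm ra rab) /eqP; rewrite E -subr_eq0 opprK.
    by rewrite -(natrD _ 1 1) pnatr_eq0.
  apply/eqP => /(congr1 (fun b => <<al, b>>)); rewrite (hformDr form) E (Hnorm ra).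
  rewrite (lin0 (hform_linr form al)) -(natrD _ 2 1) => /eqP; by rewrite pnatr_eq0.
Qed.

(** For $a\in\underline h$ the bracket $[a,y]$ is orthogonal to $\underline h$ and to all root
    vectors, hence 0, and $\underline h$ is its own centralizer. *)
Lemma mem_cartan y : (forall al, root al -> form (x al) y = 0) -> y \in h.
Proof.
move=> y0; have [hab hcent _] := Hcar; apply: hcent => a ah; apply: (form_nondeg Hinv).
apply: root_gen => [c u v Eu Ev|b bh|be rb].
- by rewrite fr Eu Ev scaler0 addr0.
- by rewrite (brC Hlie) (linN (fl _)) (form_inv Hinv) hab// (lin0 (fr _)) oppr0.
- rewrite (brC Hlie) (linN (fl _)) (form_inv Hinv) (brC Hlie) (br_root_h rb ah) -scaleNr opprK.
  by rewrite (linZ (fr _)) [form y _]formC y0// scaler0 oppr0.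
Qed.

Lemma cartan_root_eq0 a : a \in h -> (forall al, root al -> br (x al) a = 0) -> a = 0.
Proof.
move=> ah a0; have [hab _ _] := Hcar; apply: (hform_nondeg Hlie Hinv Hcar Hnorm ah) => b bh.
have [l [e [t [_ [troot tbasis _] _]]]] := Hade.
have key (be : H) : root be -> form a (vsval be) = 0.
  move=> rb; have /eqP := a0 _ rb; rewrite (br_root_h rb ah) scaler_eq0 oppr_eq0.
  by rewrite (negPf (x_neq0 Hx rb)) orbF => /eqP.
have : vsproj h b \in <<t>>%VS by rewrite (span_basis tbasis) memvf.
have gl : linear (fun c : H => form a (vsval c) : C^o) by move=> d u v; rewrite !linearP.
move=> /coord_span E; rewrite -(vsprojK bh) E (linsum gl) big1// => i _.
rewrite (linZ gl) -tnth_nth key ?scaler0//.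
Qed.

Definition shift_br (q : expo N) (y : G) (f : loop) : loop :=
  fext (fun p v => fsingle (q + p) (br y v)) f.
Definition shift_cocycle (q : expo N) (y : G) (f : loop) : center :=
  fext (fun p v => form y v *: \sum_i (coord_expo q i)%:~R *: tk R (q + p) i) f.

Lemma shift_br_at q y f p : shift_br q y f (q + p) = br y (f p).
Proof.
move: f; apply: finsupp_lin_ext => [c f g|c f g|r v].
- rewrite /shift_br fext_linear// => s d u v.
  by rewrite brr fsingleD fsingleZ.
- by rewrite finsuppDE finsuppZE brr.
- rewrite /shift_br fext1 => [|s d u w]; last by rewrite brr fsingleD fsingleZ.
  rewrite /= (can_eq (addKr q)); case: eqP => // _; by rewrite (lin0 (brr _)).
Qed.

Lemma shift_br0_at y f p : shift_br 0 y f p = br y (f p).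
Proof. by rewrite -[p in LHS]add0r shift_br_at. Qed.

Lemma coord_expo0 i : coord_expo (0 : expo N) i = 0.
Proof. by rewrite /coord_expo; case: unlift => //= j; rewrite mxE. Qed.

Lemma shift_cocycle0 y f : shift_cocycle 0 y f = 0.
Proof. by apply: fsum0 => p; rewrite big1 ?scaler0// => i _; rewrite coord_expo0 scale0r. Qed.

Lemma weight0 (c : 'rV[C]_N.+1) : weight c (0 : expo N) = 0.
Proof. by rewrite /weight big1// => i _; rewrite coord_expo0 mulr0. Qed.

Lemma tor_br_single y q f z c : tor_br br form (tor_g y q) (f, z, c) =
  (shift_br q y f - fsingle q (weight c q *: y), shift_cocycle q y f, 0).
Proof.
have der0 (g : loop) : der_loop 0 g = 0.
  apply: val_inj; apply/funext => p /=; rewrite /weight big1 ?scale0r// => i _.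
  by rewrite mxE mul0r.
have derz0 (w : center) : der_center 0 w = 0.
  move: w; apply: center_ind => [|u v Hu Hv|d p i].
  - exact: lin0 (der_center_linear 0).
  - by rewrite (linD (der_center_linear 0)) Hu Hv addr0.
  - rewrite (linZ (der_center_linear 0)) der_center_tk /weight big1 ?scale0r ?scaler0// => j _.
    by rewrite mxE mul0r.
rewrite /tor_br /tor_g der0 derz0 (lin0 (der_center_linear c)) subr0 !addr0; congr (_, _, _).
  congr (_ - _); last first.
    by apply: val_inj; apply/funext => p /=; case: eqP => [->//|_]; rewrite scaler0.
  rewrite /loop_br (fsbig_single (i := q)) /= ?eqxx// => j /negPf ->.
  by apply: fsum0 => p; rewrite linear0l fsingle0.
rewrite /loop_cocycle (fsbig_single (i := q)) /= ?eqxx// => j /negPf ->.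
by apply: fsum0 => p; rewrite linear0l scale0r.
Qed.

(** The coefficient of $t^0k_0$ descends to $\Omega_A/d_A$ because the relation of degree 0 is
    void. *)
Lemma center_coef_exists : exists L : center -> C^o, linear L /\
  forall p i, L (tk R p i) = ((p == 0) && (i == ord0))%:R.
Proof.
pose E (f : Omega_A R N) := f (0, ord0) : C^o.
have El : linear E by move=> c f g; rewrite /E finsuppDE finsuppZE.
have Ed s : d_A s -> E s = 0.
  move=> [p _ <-]; rewrite (linsum El) big1// => i _; rewrite (linZ El) /E /= xpair_eqE.
  case: eqP => [<-|_]; last by rewrite scaler0.
  by rewrite coord_expo0 scale0r.
exists (lquot_lift E); split; first exact: lquot_lift_linear El Ed.
move=> p i; rewrite /tk (lquot_liftE El Ed) /E /= xpair_eqE [0 == p]eq_sym [ord0 == i]eq_sym.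
by case: ifP.
Qed.

Variable k : toroidal N G -> Prop.
Hypothesis k_br : forall w u, k u -> k (tor_br br form w u).
Hypothesis k_center : forall z, k (0, z, 0) -> z = 0.

Let k_br0 y f z c : k (f, z, c) -> k (shift_br 0 y f, 0, 0).
Proof.
move=> /(k_br (tor_g y 0)); rewrite tor_br_single weight0 scale0r fsingle0 subr0 shift_cocycle0.
by [].
Qed.

(* The bracket with x_al twice, then x_(-al), then al sends a loop into the center, and picks
   out there the coefficients of x_(-al). *)
Lemma ideal_root_coef f (al : H) p : k (f, 0, 0) -> root al -> form (x al) (f p) = 0.
Proof.
move=> kf ra; have [L [Ll LE]] := center_coef_exists; have [hab _ _] := Hcar.
have [b0 _] := Hlie.
(* [Q] is the exponent of $t$, whose only nonzero coordinate is the one along $k_0$; the final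
   cocycle thus takes values in multiples of $k_0$, where [L] detects degree 0. *)
pose Q : expo N := (1, 0); pose f2 := shift_br 0 (x al) (shift_br 0 (x al) f).
have f2E r : f2 r = br (x al) (br (x al) (f r)) by rewrite /f2 !shift_br0_at.
(* Chosen so that the component of [f] at [p] ends in degree $-Q$, which the last bracket sends to
   degree 0. *)
pose q := - Q - p; pose f3 := shift_br q (x (- al)) f2.
have f3E r : f3 r = br (x (- al)) (f2 (r - q)) by rewrite -(shift_br_at q) addrC subrK.
have f3h r : f3 r \in h.
  rewrite f3E f2E; have [c ->] := ad_root_sq (f (r - q)) ra.
  by rewrite (linZ (brr _)) (brC Hlie) (bracket_opp Hx ra) memvZ// memvN memvZ// subvsP.
have : k (shift_br Q (vsval al) f3, shift_cocycle Q (vsval al) f3, 0).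
  have := k_br0 (x al) (k_br0 (x al) kf).
  move=> /(k_br (tor_g (x (- al)) q)) /(k_br (tor_g (vsval al) Q)).
  rewrite [tor_br _ _ (tor_g (x (- al)) q) _]tor_br_single tor_br_single.
  have w0 r : weight (0 : 'rV[C]_N.+1) r = 0.
    by rewrite /weight big1// => i _; rewrite mxE mul0r.
  by rewrite !w0 !scale0r !fsingle0 !subr0.
have -> : shift_br Q (vsval al) f3 = 0.
  by apply: fsum0 => r; rewrite hab ?subvsP// fsingle0.
move=> /k_center /(congr1 L); rewrite (lin0 Ll) => E.
have : form (vsval al) (f3 (- Q)) = 0.
  rewrite -[RHS]E /shift_cocycle; move: (f3); apply: finsupp_lin_ext.
  - by move=> c u v; rewrite finsuppDE finsuppZE fr.
  - move=> c u v; rewrite fext_linear ?Ll// => r d y w.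
    by rewrite fr scalerDl scalerA.
  - move=> r y; rewrite fext1 => [|s d u w]; last by rewrite fr scalerDl scalerA.
    rewrite (linZ Ll) (linsum Ll) big_ord_recl (linZ Ll) LE eqxx andbT big1 ?addr0; last first.
      by move=> i _; rewrite (linZ Ll) LE andbF scaler0.
    rewrite /= [Q + r]addrC addr_eq0 eq_sym /coord_expo unlift_none /= scale1r.
    rewrite /GRing.scale /=; case: eqP => _; rewrite ?mulr1 ?mulr0//; exact: lin0 (fr _).
have -> : f3 (- Q) = br (x (- al)) (br (x al) (br (x al) (f p))).
  by rewrite f3E f2E /q opprB [- Q + _]addrC subrK.
have w_al : br (vsval al) (x al) = 2 *: x al by rewrite (root_wt Hx ra) Hnorm.
have w_opp : br (vsval al) (x (- al)) = - 2 *: x (- al).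
  by rewrite (root_wt Hx (root_opp ra)) (hformNr form) Hnorm.
rewrite -(form_inv Hinv) w_opp (linZ (fl _)) -(form_inv Hinv) (brC Hlie) (bracket_opp Hx ra).
rewrite (linN (fl _)) (linZ (fl _)) -(form_inv Hinv) w_al (linZ (fl _)) => /eqP.
rewrite scaler_eq0 oppr_eq0 pnatr_eq0 /= oppr_eq0 scaler_eq0.
rewrite (negPf (form_root_neq0 Hlie Hinv Hcar Hnorm Hx ra)) scaler_eq0 pnatr_eq0 /=.
by move=> /eqP.
Qed.

(** All values of [f] lie in $\underline h$ by [ideal_root_coef]. The same applied to $[x_\alpha,f]$
    and $-\alpha$ shows that every root vanishes on them. *)
Lemma ideal_loop f : k (f, 0, 0) -> f = 0.
Proof.
move=> kf; apply: val_inj; apply/funext => p /=.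
apply: cartan_root_eq0 => [|al ra].
  by apply: mem_cartan => al ra; apply: ideal_root_coef.
have ph : f p \in h by apply: mem_cartan => be rb; apply: ideal_root_coef.
have := @ideal_root_coef _ (- al) p (k_br0 (x al) kf) (root_opp ra).
rewrite shift_br0_at (br_root_h ra ph) (linZ (fr _)) => /eqP; rewrite mulf_eq0 [form (x _) _]formC.
by rewrite (negPf (form_root_neq0 Hlie Hinv Hcar Hnorm Hx ra)) orbF => /eqP ->; rewrite scale0r.
Qed.

Lemma ideal_eq0 u : k u -> u = 0.
Proof.
(* A bracket with $y\otimes t^0$ has no contribution from the cocycle or from the derivations, so it
   lands in the loop part, where [ideal_loop] applies; the values of [f] are then central in
   $\mathcal G$. *)
move: u => [[f z] c] ku; have f0 : f = 0.
  apply: val_inj; apply/funext => p /=; have ad0 y : br y (f p) = 0.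
    by rewrite -shift_br0_at (ideal_loop (k_br0 y ku)).
  by apply: cartan_root_eq0 => //; have [_ hc _] := Hcar; apply: hc.
subst f; have [l [e [t [dia [troot tbasis _] _]]]] := Hade.
have l0 : (0 < l)%N by case: dia => *; lia.
pose al := tnth t (Ordinal l0); have ra : root al by exact: troot.
have c0 : c = 0.
  (* With [f] gone, the bracket with $x_\alpha\otimes t^q$ has loop part $-c(q)\,x_\alpha\otimes
     t^q$; the $i$-th unit exponent isolates the coordinate $c_i$. *)
  apply/rowP => i; rewrite mxE; pose q : expo N := if unlift ord0 i is Some j then (0, delta_mx 0 j) else (1, 0).
  have wq : weight c q = c 0 i.
    rewrite /weight (bigD1 i)//= big1 ?addr0 => [|j ji]; rewrite /q /coord_expo.
      case: (unliftP ord0 i) => [j ->|->]; rewrite ?unlift_none ?mulr1//= mxE !eqxx mulr1.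
      by [].
    case: (unliftP ord0 i) ji => [i' ->|->]; case: (unliftP ord0 j) => [j' ->|->] //=; rewrite ?mxE ?mulr0//.
    by rewrite (inj_eq lift_inj) => /negPf ->; rewrite andbF mulr0.
  have := k_br (tor_g (x al) q) ku; rewrite tor_br_single.
  have -> : shift_br q (x al) (0 : loop) = 0.
    by apply: fsum0 => p; rewrite (lin0 (brr _)) fsingle0.
  have -> : shift_cocycle q (x al) (0 : loop) = 0.
    by apply: fsum0 => p; rewrite linear0r scale0r.
  rewrite sub0r wq => /ideal_loop /eqP; rewrite oppr_eq0 => /eqP /(congr1 (fun g : loop => g q)) /=.
  rewrite eqxx => /eqP; rewrite scaler_eq0 (negPf (x_neq0 Hx ra)) orbF => /eqP.
  by [].
by move: ku; rewrite c0 => /k_center ->.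
Qed.

End CentralIdeal.

Section LoopComm.
Variables (R : realType) (N : nat).
Local Notation C := R[i].
Variables (G : vectType C) (br : {bilinear G -> G -> G}) (form : {biscalar G}).
Variables (T : lmodType C) (X : G -> expo N -> T -> T) (Z : center R N -> T -> T).
Hypothesis Xl : forall y p, linear (X y p).
Hypothesis Xg : forall p v, linear (fun y => X y p v).

(** The relation for one pair of elements in all degrees. It is bilinear in the pair, so it need
    only be checked on $\underline h$ and the root vectors. *)
Definition loop_comm (y z : G) : Prop := forall p q v, X y p (X z q v) - X z q (X y p v) =
  X (br y z) (p + q) v + form y z *: Z (\sum_i (coord_expo p i)%:~R *: tk R (p + q) i) v.

Let XE c v w q t : X (c *: v + w) q t = c *: X v q t + X w q t. Proof. exact: Xg. Qed.
Let rearrange c d e (a a' b b' : T) :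
  c *: (a + d *: b) + (a' + e *: b) = c *: a + a' + (c * d + e) *: b.
Proof. by rewrite scalerDr scalerA scalerDl addrACA. Qed.

Lemma loop_comm_linear_r u c v w :
  loop_comm u v -> loop_comm u w -> loop_comm u (c *: v + w).
Proof.
move=> Hv Hw p q t; rewrite !XE Xl opprD addrACA -scalerBr Hv Hw.
by rewrite !linearPr /= XE; apply: rearrange.
Qed.
Lemma loop_comm_linear_l u c v w :
  loop_comm v u -> loop_comm w u -> loop_comm (c *: v + w) u.
Proof.
move=> Hv Hw p q t; rewrite !XE Xl opprD addrACA -scalerBr Hv Hw.
by rewrite !linearPl /= XE; apply: rearrange.
Qed.
End LoopComm.

(** * The representation of the toroidal algebra by vertex operators *)

Section VertexRepresentation.
Variables (R : realType) (N : nat).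
Local Notation C := R[i].
Variables (G : vectType C) (br : {bilinear G -> G -> G}) (form : {biscalar G}).
Variables (h : {vspace G}) (x : subvs_of h -> G) (eps : subvs_of h -> subvs_of h -> C).
Local Notation H := (subvs_of h).
Local Notation "<< a , b >>" := (hform form a b).
Local Notation root := (is_root br form).
Local Notation Zr := 'rV[int]_N.
Hypothesis Hlie : lie_bracket br.
Hypothesis Hinv : invariant_form br form.
Hypothesis Hcar : cartan_subalgebra br h.
Hypothesis Hnorm : forall al : H, root al -> <<al, al>> = 2.
Hypothesis Hx : root_vector_choice br form x.
Hypothesis Heps : structure_constants br form x eps.

Let root_opp := root_opp Hlie Hinv Hcar Hx.
Let form_x0 := form_root_neq0 Hlie Hinv Hcar Hnorm Hx.
Let fl (y : G) : linear (form^~ y : G -> C^o). Proof. by move=> c u v; rewrite linearPl. Qed.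

Lemma form_root_root (al be : H) : root al -> root be -> al + be != 0 -> form (x al) (x be) = 0.
Proof.
move=> ra rb; exact: (wt_orth Hlie Hinv Hcar Hnorm (root_wt Hx ra) (root_wt Hx rb)).
Qed.

Lemma form_h_root a (be : H) : a \in h -> root be -> form a (x be) = 0.
Proof.
move=> ah rb; apply: (wt_orth Hlie Hinv Hcar Hnorm (wt_h form Hcar ah) (root_wt Hx rb)).
by rewrite add0r; case: rb.
Qed.

(** A fixed vector pairs nontrivially with only finitely many root vectors, by linearity from
    $\underline h$ and the root vectors. Each root vector pairs with some member of a basis. *)
Lemma roots_finite : exists s : seq H, uniq s /\ forall al, root al <-> al \in s.
Proof.
have /choice[s sP] y : exists s : seq H, forall be, root be -> form y (x be) != 0 -> be \in s.
  move: y; apply: (root_gen Hlie Hinv Hcar Hnorm Hx).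
  - move=> c u v [s Hs] [t Ht]; exists (s ++ t) => be rb; rewrite fl mem_cat.
    have [->|/Hs->//] := eqVneq (form u (x be)) 0; have [->|/Ht->//] := eqVneq (form v (x be)) 0.
      by rewrite scaler0 addr0 eqxx.
    by rewrite orbT.
  - by move=> a ah; exists [::] => be rb; rewrite form_h_root ?eqxx.
  - move=> al ra; exists [:: - al] => be rb; rewrite inE; apply: contra_neqT => ab.
    by apply: form_root_root => //; rewrite addrC addr_eq0.
pose S := flatten [seq s y | y <- vbasis (fullv : {vspace G})].
exists (undup [seq be <- S | `[<root be>]]); split=> [|al]; first exact: undup_uniq.
rewrite mem_undup mem_filter; split=> [ra|/andP[/asboolP//]]; apply/andP; split; first exact/asboolP.
apply: contrapT => nS; move/eqP: (x_neq0 Hx ra); apply; apply: (form_nondeg Hinv) => y.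
rewrite (inv_formC Hinv) (coord_vbasis (memvf y)) (linsum (fl _)) big1// => i _.
rewrite (linZ (fl _)); apply/eqP; rewrite scaler_eq0; apply/orP; right; apply/eqP.
apply: contrapT => /eqP f0; apply: nS; apply/flattenP; exists (s (vbasis fullv)`_i); last exact: sP.
by apply: map_f; apply: mem_nth; rewrite size_tuple.
Qed.

Variables (W : lmodType C) (A : Z1_ops N h W).
Hypothesis HZ : Z1_module br form x eps A.
Variables (M : lmodType C) (F : heisenberg_ops h M).
Hypothesis HF : level_one_fock form F.
Variables (T : lmodType C) (tens : M -> W -> T).
Hypothesis HT : tensor_like tens.
Variable phi : center R N -> {linear W -> W}.
Hypothesis phi_linear : forall c u v w, phi (c *: u + v) w = c *: phi u w + phi v w.
Hypothesis phi_tk : forall n r i, phi (tk R (n, r) i) =1 kop A i r n.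
Variable s : seq H.
Hypothesis s_uniq : uniq s.
Hypothesis sP : forall al, root al <-> al \in s.

Local Notation vop := (vop A HF HT).
Local Notation hopT := (hopT A F HT).
Local Notation kT := (kT A HT).
Local Notation oT := (oT A F HT).

(** The coordinate along $x_\alpha$: the root vector $x_{-\alpha}$ is orthogonal to $\underline h$
    and to all root vectors but $x_\alpha$. *)
Definition root_coef (al : H) (y : G) : C := form y (x (- al)) / form (x al) (x (- al)).
Definition cartan_part (y : G) : H := vsproj h (y - \sum_(al <- s) root_coef al y *: x al).
Definition gT (y : G) (p : expo N) (v : T) : T :=
  hopT (cartan_part y) p.2 p.1 v + \sum_(al <- s) root_coef al y *: vop al p.2 p.1 v.
Definition zT (z : center R N) (v : T) : T := tmap HT (idlin M) (phi z) v.
Definition derT (i : 'I_N.+1) (v : T) : T :=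
  if unlift ord0 i is Some j then dT A HT j v else d0T A F HT v.

Lemma root_coef_linear al c u v : root_coef al (c *: u + v) = c * root_coef al u + root_coef al v.
Proof. by rewrite /root_coef fl mulrDl /GRing.scale /= mulrA. Qed.

Lemma cartan_part_linear : linear cartan_part.
Proof.
move=> c u v; rewrite /cartan_part -linearP; congr (vsproj h _).
have -> : \sum_(al <- s) root_coef al (c *: u + v) *: x al =
    c *: (\sum_(al <- s) root_coef al u *: x al) + \sum_(al <- s) root_coef al v *: x al.
  rewrite scaler_sumr -big_split; apply: eq_bigr => al _.
  by rewrite root_coef_linear scalerDl scalerA.
by rewrite opprD scalerBr addrACA.
Qed.

Lemma oT_linear_l i v : linear (fun be => oT be i v).
Proof.
move=> c a b; move: v; apply: (eq_tensor HT).
- exact: oT_lin.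
- by move=> d u v; rewrite !oT_lin scale_linP lin_addP.
- move=> m w; have [->|i0] := eqVneq i 0.
    by rewrite !oT0E (Z1_hop_linear HZ) (tlike_r HT).
  by rewrite !oTE// (osc_linear HF) (tlike_l HT).
Qed.

Lemma hopT_linear_l r n v : linear (fun be => hopT be r n v).
Proof.
move=> c a b; rewrite /hopT fsumZ; last exact: (hterm_supp HZ HF).
rewrite -fsumD; [|by apply: fsuppZ; exact: (hterm_supp HZ HF)|exact: (hterm_supp HZ HF)].
by apply: eq_fsum => i; rewrite /hterm oT_linear_l.
Qed.

Lemma gT_lin y p : linear (gT y p).
Proof.
move=> c u v; rewrite /gT (hopT_lin HZ HF).
have -> : \sum_(al <- s) root_coef al y *: vop al p.2 p.1 (c *: u + v) =
    c *: (\sum_(al <- s) root_coef al y *: vop al p.2 p.1 u) + \sum_(al <- s) root_coef al y *: vop al p.2 p.1 v.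
  rewrite scaler_sumr -big_split !big_seq; apply: eq_bigr => al /sP ra.
  by rewrite (vop_lin HZ)// scale_linP.
exact: lin_addP.
Qed.

Lemma gT_linear_l p v : linear (fun y => gT y p v).
Proof.
move=> c u w; rewrite /gT cartan_part_linear hopT_linear_l.
have -> : \sum_(al <- s) root_coef al (c *: u + w) *: vop al p.2 p.1 v =
    c *: (\sum_(al <- s) root_coef al u *: vop al p.2 p.1 v) + \sum_(al <- s) root_coef al w *: vop al p.2 p.1 v.
  rewrite scaler_sumr -big_split; apply: eq_bigr => al _.
  by rewrite root_coef_linear scalerDl scalerA.
exact: lin_addP.
Qed.

Lemma root_coef_root (al be : H) : root al -> root be -> root_coef al (x be) = (al == be)%:R.
Proof.
move=> ra rb; rewrite /root_coef; have [<-|ab] := eqVneq al be; first by rewrite divff// form_x0.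
by rewrite form_root_root ?mul0r//; [exact: root_opp|rewrite subr_eq0 eq_sym].
Qed.

Lemma sum_root (V : lmodType C) (E : H -> V) be : root be ->
  \sum_(al <- s) root_coef al (x be) *: E al = E be.
Proof.
move=> rb; have bs : be \in s by apply/sP.
rewrite (bigD1_seq be)//= root_coef_root// eqxx scale1r big_seq_cond big1 ?addr0// => al.
by move=> /andP[/sP ra /negPf ab]; rewrite root_coef_root// ab scale0r.
Qed.

Lemma sum_cartan (V : lmodType C) (E : H -> V) a : a \in h ->
  \sum_(al <- s) root_coef al a *: E al = 0.
Proof.
move=> ah; rewrite big_seq big1// => al /sP ra.
by rewrite /root_coef form_h_root ?mul0r ?scale0r//; apply: root_opp.
Qed.

Lemma gT_root al p v : root al -> gT (x al) p v = vop al p.2 p.1 v.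
Proof.
move=> ra; rewrite /gT sum_root// /cartan_part sum_root// subrr linear0.
by rewrite (lin0 (hopT_linear_l _ _ _)) add0r.
Qed.

Lemma gT_cartan (a : H) p v : gT (vsval a) p v = hopT a p.2 p.1 v.
Proof.
by rewrite /gT /cartan_part !sum_cartan ?subvsP// subr0 vsvalK addr0.
Qed.

Lemma zT_lin z : linear (zT z). Proof. exact: linearP. Qed.
Lemma zTE z m w : zT z (tens m w) = tens m (phi z w). Proof. exact: tmapE. Qed.
Lemma zT_linear_l v : linear (fun z => zT z v).
Proof.
move=> c a b; move: v; apply: (eq_tensor HT).
- exact: zT_lin.
- move=> d u v; rewrite !zT_lin scale_linP; exact: lin_addP.
- by move=> m w; rewrite !zTE phi_linear (tlike_r HT).
Qed.
Lemma zT_tk p i v : zT (tk R p i) v = kT i p.2 p.1 v.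
Proof.
move: v; apply: (eq_tensor HT); [exact: zT_lin|exact: kT_lin|move=> m w].
by rewrite zTE kTE {1}[p]surjective_pairing phi_tk.
Qed.

Lemma zT_cocycle p q v : zT (\sum_i (coord_expo p i)%:~R *: tk R (p + q) i) v =
  p.1%:~R *: kT ord0 (p.2 + q.2) (p.1 + q.1) v +
  \sum_(j < N) (p.2 0 j)%:~R *: kT (lift ord0 j) (p.2 + q.2) (p.1 + q.1) v.
Proof.
rewrite (linsum (zT_linear_l v)) big_ord_recl (linZ (zT_linear_l v)) zT_tk.
rewrite {1}/coord_expo unlift_none; congr (_ + _); apply: eq_bigr => j _.
by rewrite (linZ (zT_linear_l v)) zT_tk /coord_expo liftK.
Qed.

Lemma zT_comm z (Op : T -> T) : linear Op ->
  (forall i r n v, kT i r n (Op v) = Op (kT i r n v)) -> forall v, zT z (Op v) = Op (zT z v).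
Proof.
move=> Ol Hk v; elim/center_ind: z => [|a b Ha Hb|c p i].
- by rewrite !(lin0 (zT_linear_l _)) (lin0 Ol).
- by rewrite !(linD (zT_linear_l _)) (linD Ol) Ha Hb.
- by rewrite !(linZ (zT_linear_l _)) (linZ Ol) !zT_tk Hk.
Qed.

Lemma zgT z y p v : zT z (gT y p v) = gT y p (zT z v).
Proof.
apply: zT_comm; first exact: gT_lin.
move=> i r n u; rewrite /gT (linD (kT_lin _ _ _ _ _)) (khT HZ HF) (linsum (kT_lin _ _ _ _ _)).
congr (_ + _); rewrite !big_seq; apply: eq_bigr => al /sP ra.
by rewrite (linZ (kT_lin _ _ _ _ _)) (kvT HZ).
Qed.

Lemma zzT z z' v : zT z (zT z' v) = zT z' (zT z v).
Proof.
apply: zT_comm; first exact: zT_lin.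
move=> i r n u; apply/esym; apply: zT_comm; first exact: kT_lin.
by move=> *; apply: (kkT HZ).
Qed.

Lemma derT_lin i : linear (derT i).
Proof. by rewrite /derT; case: unlift => [j|]; [exact: dT_lin|exact: d0T_lin]. Qed.

Lemma der_gT i y p v : derT i (gT y p v) = gT y p (derT i v) + (coord_expo p i)%:~R *: gT y p v.
Proof.
rewrite /gT (linD (derT_lin i)).
have hE a : derT i (hopT a p.2 p.1 v) = hopT a p.2 p.1 (derT i v) + (coord_expo p i)%:~R *: hopT a p.2 p.1 v.
  by rewrite /derT /coord_expo; case: unlift => [j|]; [exact: (d_hT HZ HF)|exact: (d0_hT HZ HF)].
have vE al : root al -> derT i (vop al p.2 p.1 v) = vop al p.2 p.1 (derT i v) + (coord_expo p i)%:~R *: vop al p.2 p.1 v.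
  by move=> ra; rewrite /derT /coord_expo; case: unlift => [j|]; [exact: (d_vopT HZ)|exact: (d0_vopT HZ)].
rewrite hE (linsum (derT_lin i)) scalerDr [RHS]addrACA; congr (_ + _).
rewrite scaler_sumr -big_split !big_seq; apply: eq_bigr => al /sP ra.
by rewrite (linZ (derT_lin i)) vE// scalerDr !scalerA mulrC.
Qed.

Lemma der_zT i j p v : derT i (zT (tk R p j) v) =
  zT (tk R p j) (derT i v) + (coord_expo p i)%:~R *: zT (tk R p j) v.
Proof.
rewrite !zT_tk /derT /coord_expo.
by case: unlift => [i'|]; [exact: (d_kT HZ)|exact: (d0_kT HZ)].
Qed.

Lemma derT_comm i j v : derT i (derT j v) = derT j (derT i v).
Proof.
rewrite /derT; case: unlift => [i'|]; case: unlift => [j'|] //; first exact: (d_dT HZ).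
  by apply/esym; apply: (d0_dT HZ).
by apply: (d0_dT HZ).
Qed.

Local Notation gcomm := (loop_comm br form gT zT).

Lemma gT_comm_hh (a b : H) : gcomm (vsval a) (vsval b).
Proof.
move=> p q v; have [hab _ _] := Hcar.
rewrite !gT_cartan (h_hT HZ HF) zT_cocycle hab ?subvsP//.
by rewrite (lin0 (gT_linear_l _ _)) add0r.
Qed.

Lemma gT_comm_hroot (a : H) al : root al -> gcomm (vsval a) (x al).
Proof.
move=> ra p q v; rewrite gT_cartan !gT_root// gT_cartan (h_vopT HZ)// (root_wt Hx ra).
by rewrite (linZ (gT_linear_l _ _)) gT_root// form_h_root ?subvsP// scale0r addr0.
Qed.

Lemma gT_comm_rooth (a : H) al : root al -> gcomm (x al) (vsval a).
Proof.
move=> ra p q v; rewrite -opprB gT_comm_hroot// (inv_formC Hinv (x al)) form_h_root ?subvsP//.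
rewrite !scale0r !addr0 (brC Hlie) (linN (gT_linear_l _ _)).
by rewrite opprK [q + p]addrC.
Qed.

Lemma gT_comm_roots al be : root al -> root be -> gcomm (x al) (x be).
Proof.
move=> ra rb p q v; rewrite !gT_root//; have [ab0|ab0] := eqVneq (al + be) 0.
  have E : be = - al by apply/eqP; rewrite -addr_eq0 addrC ab0.
  subst be; rewrite (vop_comm_opp HZ HF (hform_sym Hinv))// (bracket_opp Hx ra).
  rewrite (linZ (gT_linear_l _ _)) gT_cartan zT_cocycle -scalerDr (inv_formC Hinv) addrA.
  by [].
rewrite form_root_root// scale0r addr0; have [rab|nrab] := pselect (root (al + be)).
  by rewrite (vop_comm_root HZ HF (hform_sym Hinv))// (Heps ra rb rab) (linZ (gT_linear_l _ _)) gT_root.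
rewrite (vop_comm_other HZ HF (hform_sym Hinv))//; last exact/eqP.
by rewrite (bracket_not_root Hlie Hx)// (lin0 (gT_linear_l _ _)).
Qed.

Lemma gT_comm y z : gcomm y z.
Proof.
have lin_r u : forall c v w, gcomm u v -> gcomm u w -> gcomm u (c *: v + w).
  exact: (loop_comm_linear_r gT_lin gT_linear_l).
have lin_l u : forall c v w, gcomm v u -> gcomm w u -> gcomm (c *: v + w) u.
  exact: (loop_comm_linear_l gT_lin gT_linear_l).
have gen P := root_gen (P := P) Hlie Hinv Hcar Hnorm Hx.
move: y; apply: (gen (gcomm^~ z)) => [c u v|a ah|al ra]; first exact: lin_l.
  move: z; apply: (gen (gcomm a)) => [c u v|b bh|be rb]; first exact: lin_r; rewrite -(vsprojK ah).
    by rewrite -(vsprojK bh); exact: gT_comm_hh.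
  exact: gT_comm_hroot.
move: z; apply: (gen (gcomm (x al))) => [c u v|b bh|be rb]; first exact: lin_r.
  by rewrite -(vsprojK bh); exact: gT_comm_rooth.
exact: gT_comm_roots.
Qed.

Definition vertex_rep (u : toroidal N G) : {linear T -> T} :=
  mklin (tor_act_lin gT_lin gT_linear_l zT_lin derT_lin u).

Lemma vertex_rep_lie u v t : vertex_rep (tor_br br form u v) t =
  vertex_rep u (vertex_rep v t) - vertex_rep v (vertex_rep u t).
Proof.
apply: tor_act_br; [exact: gT_lin|exact: gT_linear_l|exact: zT_lin|exact: zT_linear_l|
  exact: derT_lin|exact: gT_comm|exact: zgT|exact: zzT|exact: der_gT|exact: der_zT|exact: derT_comm].
Qed.

Lemma vertex_rep_linear c u v t :
  vertex_rep (c *: u + v) t = c *: vertex_rep u t + vertex_rep v t.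
Proof. exact: (tor_act_linl _ gT_linear_l zT_linear_l). Qed.

Lemma vertex_rep_g y p t : vertex_rep (tor_g y p) t = gT y p t.
Proof.
rewrite -[LHS]/(tor_act gT zT derT (tor_g y p) t) /tor_act /= (loop_act1 gT_linear_l).
rewrite (lin0 (zT_linear_l _)) /der_act big1 ?addr0// => i _; by rewrite mxE scale0r.
Qed.

Lemma vertex_rep_z z t : vertex_rep (0, z, 0) t = zT z t.
Proof.
rewrite -[LHS]/(tor_act gT zT derT (0, z, 0) t) /tor_act /= (lin0 (loop_act_linl gT_linear_l _)) add0r.
rewrite /der_act big1 ?addr0// => i _; by rewrite mxE scale0r.
Qed.

Lemma vertex_rep_d i t : vertex_rep (tor_d G i) t = derT i t.
Proof.
rewrite -[LHS]/(tor_act gT zT derT (tor_d G i) t) /tor_act /= (lin0 (loop_act_linl gT_linear_l _)) add0r.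
rewrite (lin0 (zT_linear_l _)) add0r /der_act (bigD1 i)//= big1 => [|j ji].
  by rewrite mxE !eqxx scale1r addr0.
by rewrite mxE (negPf ji) andbF scale0r.
Qed.

End VertexRepresentation.

(** * Transfer to the concrete tensor product and faithfulness *)

Section TensorLinear.
Lemma tensor_linear_map (K : fieldType) (M W : lmodType K) (f : tensor M W -> tensor M W) :
  (forall c u v, f (c *: u + v) = c *: f u + f v) ->
  exists g : {linear tensor M W -> tensor M W}, forall t, g t = f t.
Proof.
move=> fl; pose g : {linear tensor M W -> tensor M W} :=
  HB.pack f (GRing.isLinear.Build K _ _ _ f fl).
by exists g.
Qed.

Variables (R : realType) (M W : lmodType R[i]).

(* The tensor product as a bundled module: unification must not see through it. *)
Definition tensorC : lmodType R[i] := tensor M W.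
Lemma tensorC_like : tensor_like (T := tensorC) (@tens _ M W).
Proof. exact: tensor_tensor_like. Qed.

Lemma tensorC_lin c (u v : tensor M W) : c *: (u : tensorC) + v = (c *: u + v : tensor M W).
Proof. by []. Qed.
Lemma tensorC_sub (u v : tensor M W) : (u : tensorC) - v = (u - v : tensor M W).
Proof. by []. Qed.

Lemma tensorC_subE (a b : tensorC) (a' b' : tensor M W) : a = a' -> b = b' -> a - b = (a' - b' : tensor M W).
Proof. by move=> -> ->; exact: tensorC_sub. Qed.
Lemma tensorC_linE c (a b : tensorC) (a' b' : tensor M W) : a = a' -> b = b' ->
  c *: a + b = (c *: a' + b' : tensor M W).
Proof. by move=> -> ->; exact: tensorC_lin. Qed.

Lemma fsum_tensorC (I : choiceType) (F : I -> tensor M W) :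
  fsum (F : I -> tensorC) = \sum_(i \in [set: I]) F i.
Proof. by []. Qed.

Let linear_transfer (f : tensorC -> tensorC) :
  (forall c u v, f (c *: u + v) = c *: f u + f v) ->
  forall c (u v : tensor M W), (f : tensor M W -> tensor M W) (c *: u + v) =
    (c *: (f u : tensor M W) + (f v : tensor M W) : tensor M W).
Proof. by move=> fl c u v; rewrite -tensorC_lin -[RHS]tensorC_lin; apply: fl. Qed.

Lemma tensorC_linear (f : {linear tensorC -> tensorC}) :
  exists g : {linear tensor M W -> tensor M W}, forall t : tensor M W, (g t : tensor M W) = f t.
Proof.
have fl c u v : f (c *: u + v) = c *: f u + f v by exact: linearP.
exact: (tensor_linear_map (linear_transfer fl)).
Qed.
End TensorLinear.

Section TensorRepresentation.
Variables (R : realType) (N : nat).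
Local Notation C := R[i].
Variables (G : vectType C) (br : {bilinear G -> G -> G}) (form : {biscalar G}).
Variables (h : {vspace G}) (x : subvs_of h -> G) (eps : subvs_of h -> subvs_of h -> C).
Local Notation H := (subvs_of h).
Local Notation "<< a , b >>" := (hform form a b).
Local Notation root := (is_root br form).
Hypothesis Hlie : lie_bracket br.
Hypothesis Hinv : invariant_form br form.
Hypothesis Hcar : cartan_subalgebra br h.
Hypothesis Hade : type_ADE br form h.
Hypothesis Hnorm : forall al : H, root al -> <<al, al>> = 2.
Hypothesis Hx : root_vector_choice br form x.
Hypothesis Heps : structure_constants br form x eps.
Variables (W : lmodType C) (A : Z1_ops N h W).
Hypothesis HZ : Z1_module br form x eps A.
Hypothesis HC : center_acts_faithfully A.
Hypothesis sepW : separated W.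
Variables (M : lmodType C) (F : heisenberg_ops h M).
Hypothesis HF : level_one_fock form F.

(** Contracting with a functional [L] on $W$ sends $m\otimes w$ to $L(w)m$, so $L(w)=0$ for every
    [L]. *)
Lemma tens_eq0 (m : M) (w : W) : m != 0 -> tens m w = 0 -> w = 0.
Proof.
move=> m0 mw0; apply: sepW => L Ll.
have [E EE] := tlike_lift (tensor_tensor_like M W) (b := fun m w => (L w : C) *: m)
  (fun w c u v => scale_linP c (L w : C) u v) (fun m c u v => etrans (congr1 (fun d : C => d *: m) (Ll c u v))
    (etrans (scalerDl _ _ _) (congr1 (fun t => t + _) (esym (scalerA _ _ _))))).
have := EE m w; rewrite mw0 linear0 => /esym/eqP; rewrite scaler_eq0 (negPf m0) orbF.
by move=> /eqP.
Qed.

Lemma tensor_rep_exists : exists rho : toroidal N G -> {linear tensor M W -> tensor M W},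
  [/\ vertex_action br form x A F rho, lie_module br form rho & faithful rho].
Proof.
have [phi [phil phitk phiinj]] := HC.
have [s [us sP]] := roots_finite Hlie Hinv Hcar Hnorm Hx.
have HT := tensorC_like M W.
have [V [Vlie Vlin Vg Vz Vd]] : exists V : toroidal N G -> {linear tensorC M W -> tensorC M W},
    [/\ forall u v t, V (tor_br br form u v) t = V u (V v t) - V v (V u t),
      forall c u v t, V (c *: u + v) t = c *: V u t + V v t,
      forall y p t, V (tor_g y p) t = gT x A HF HT s y p t,
      forall z t, V (0, z, 0) t = zT HT phi z t & forall i t, V (tor_d G i) t = derT A F HT i t].
  exists (vertex_rep HZ HF HT phi sP); split.
  - exact: (vertex_rep_lie Hlie Hinv Hcar Hnorm Hx Heps HZ HF HT phil phitk us sP).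
  - exact: (vertex_rep_linear HZ HF HT phil sP).
  - exact: (vertex_rep_g HZ HF HT phil sP).
  - exact: vertex_rep_z.
  - exact: (vertex_rep_d HZ HF HT phil sP).
have [rho rhoE] : exists rho : toroidal N G -> {linear tensor M W -> tensor M W},
    forall u (t : tensor M W), (rho u t : tensor M W) = V u t.
  have /choice[rho rhoE] u := tensorC_linear (V u).
  by exists rho.
have VV u v (t : tensor M W) : V u (V v t) = (rho u (rho v t : tensor M W) : tensor M W).
  exact: (etrans (congr1 (V u) (esym (rhoE v t))) (esym (rhoE u (rho v t)))).
have rho_lie u v t : rho (tor_br br form u v) t = rho u (rho v t) - rho v (rho u t).
  exact: (etrans (etrans (rhoE _ _) (Vlie u v t)) (tensorC_subE (VV u v t) (VV v u t))).
have rho_lin c u v t : rho (c *: u + v) t = c *: rho u t + rho v t.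
  exact: (etrans (etrans (rhoE _ _) (Vlin c u v t)) (tensorC_linE c (esym (rhoE u t)) (esym (rhoE v t)))).
have rho_g y p (t : tensor M W) : (rho (tor_g y p) t : tensor M W) = gT x A HF HT s y p t.
  exact: (etrans (rhoE _ _) (Vg y p t)).
(* The statement sums over natural indices $(p,q)$, the operators over integers $(q,p)$; terms with
   a negative index vanish. *)
have vertexE al (r : 'rV[int]_N) n (m : M) (w : W) :
    vop A HF HT al r n (tens m w) = fsum (fun pq : nat * nat =>
      tens (Eminus F (- al) pq.1 (Eplus F (- al) pq.2 m)) (Zop A al r (n + pq.1%:Z - pq.2%:Z) w) : tensorC M W).
  rewrite /vop (fsum_reindex (h := fun pq : nat * nat => (pq.2%:Z, pq.1%:Z))).
  - by apply: eq_fsum => -[p q]; rewrite /comp vtermE.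
  - by move=> [p q] [p' q'] [-> ->].
  - move=> [q p]; rewrite vtermE; case: q => q; last first.
      by rewrite (Ep_neg HF)// (lin0 (Em_lin HF _ _)) (tens0l HT) eqxx.
    case: p => p; last by rewrite (Em_neg HF)// (tens0l HT) eqxx.
    by exists (p, q).
have cartanE be (r : 'rV[int]_N) n (m : M) (w : W) : hopT A F HT be r n (tens m w) =
    fsum (fun i => cartan_mode A F be i m (kop A ord0 r (n - i) w) : tensorC M W).
  apply: eq_fsum => i /=; rewrite /hterm kTE /cartan_mode.
  case: eqP => [->|/eqP i0]; first exact: oT0E.
  exact: oTE.
exists rho; split.
- split.
  + move=> al r n m w ra; rewrite -[RHS]fsum_tensorC -vertexE.
    exact: (etrans (rho_g _ _ _) (gT_root Hlie Hinv Hcar Hnorm Hx HZ HF HT us sP (n, r) _ ra)).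
  + move=> be r n m w; rewrite -[RHS]fsum_tensorC -cartanE.
    exact: (etrans (rho_g _ _ _) (gT_cartan Hlie Hinv Hcar Hnorm Hx A HF HT sP be (n, r) _)).
  + move=> i r n m w; apply: (etrans (rhoE _ _)); apply: (etrans (Vz _ _)).
    by apply: (etrans (zTE HT phi _ m w)); rewrite phitk.
  + move=> m w; apply: (etrans (rhoE _ _)); apply: (etrans (Vd _ _)); rewrite /derT unlift_none.
    exact: d0TE.
  + move=> i m w; apply: (etrans (rhoE _ _)); apply: (etrans (Vd _ _)); rewrite /derT liftK.
    exact: dTE.
- by [].
- move=> u v uv; apply/eqP; rewrite -subr_eq0; apply/eqP.
  have uvV (t : tensor M W) : V u t = V v t.
    exact: (etrans (esym (rhoE u t)) (etrans (uv t) (rhoE v t))).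
  have Vl t : linear (fun u => V u t) by move=> c a b; exact: Vlin.
  (* The ideal is the kernel. A central element in it kills every $\mathrm{vac}\otimes w$, hence
     acts as 0 on $W$, where the centre is faithful. *)
  apply: (ideal_eq0 Hlie Hinv Hcar Hnorm Hx Heps Hade (k := fun u => forall t, V u t = 0)).
  + by move=> w a a0 t; rewrite Vlie (a0 t) (a0 (V w t)) linear0 subr0.
  + move=> z z0; apply: phiinj => w; apply/eqP; rewrite -subr_eq0; apply/eqP.
    have phiB : linear (fun z => phi z w) by move=> c a b; exact: phil.
    rewrite (lin0 phiB) subr0; apply: (tens_eq0 (vac_neq0 HF)).
    exact: (etrans (esym (etrans (Vz _ _) (zTE HT phi z _ w))) (z0 _)).
  + move=> t; rewrite (linB (Vl t)); apply/eqP; rewrite subr_eq0; apply/eqP.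
    exact: uvV.
Qed.

End TensorRepresentation.

Theorem mainTheorem2 (R : realType) (N : nat) (G : vectType R[i])
    (br : {bilinear G -> G -> G}) (form : {biscalar G}) (h : {vspace G})
    (x : subvs_of h -> G) (eps : subvs_of h -> subvs_of h -> R[i]) :
  simple_lie_algebra br ->
  invariant_form br form ->
  cartan_subalgebra br h ->
  type_ADE br form h ->
  (forall alpha : subvs_of h, is_root br form alpha -> hform form alpha alpha = 2) ->
  root_vector_choice br form x ->
  structure_constants br form x eps ->
  exists (W : lmodType R[i]) (A : Z1_ops N h W),
    [/\ Z1_module br form x eps A,
        k0_acts_as_1 A,
        center_acts_faithfully A &
        forall (M : lmodType R[i]) (F : heisenberg_ops h M), level_one_fock form F ->
          exists rho : toroidal N G -> {linear tensor M W -> tensor M W},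
            [/\ vertex_action br form x A F rho, lie_module br form rho & faithful rho]].
Proof.
move=> [Hlie _ _] Hinv Hcar Hade Hnorm Hx Heps.
have [l [Am [emb [zc [f RL]]]]] := root_lattice_exists Hlie Hinv Hcar Hnorm Hx Heps Hade.
have [V [e [v0 [el eK v0_free sepV]]]] := dual_number_module R.
have HZ := zops_Z1_module (rl_embD RL) (rl_AmT RL) (rl_zcK RL) (rl_zcD RL) (rl_zcN RL)
  (rl_form RL) (rl_q_rootD RL) (rl_q_rootN RL) (rl_q_other RL) (rl_q_root RL)
  (rl_fD RL) (rl_fN RL) (rl_fC RL) (cmod_central N el eK).
have HC := center_act_faithful HZ (fun g => @zops_kact_inj _ _ _ _ el eK _ v0_free _ form _ l Am emb zc f g).
exists (zmod l (@cmod R N V)), (zops form Am emb zc f (cmod_central N el eK)); split=> //.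
  exact: zops_k0.
move=> M F HF; apply: (tensor_rep_exists Hlie Hinv Hcar Hade Hnorm Hx Heps HZ HC _ HF).
(* $W$ is a direct sum over $Q$ of copies of a direct sum of copies of the dual numbers. *)
by do 2! apply: separated_finsupp.
Qed.
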